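(* Let $k$ be a field and let $I$ be a $\Delta$-cellular binomial ideal in $k[x]=k[x_1,\dots,x_n]$. Let $\mathcal M$ be the set consisting of $1$ and of all monomials $m\in M_{\rm emb}(I)$ with $m\notin I$. For $m\in\mathcal M$, let $(L_{\rho(m)},\rho(m))$ be the partial character on $\mathbb Z^\Delta$ such that $(I:m)\cap k[\mathbb N^\Delta]=I(\rho(m))$. Then $$I=\bigcap_{m\in\mathcal M}\operatorname{Hull}\Big((I+I(\rho(m))):\big(\textstyle\prod_{i\in\Delta}x_i\big)^\infty\Big)$$ $$=\bigcap_{m\in\mathcal M}\Big[\Big((I+I(\rho(m))):\big(\textstyle\prod_{i\in\Delta}x_i\big)^\infty\Big)+M_{\rm emb}\Big((I+I(\rho(m))):\big(\textstyle\prod_{i\in\Delta}x_i\big)^\infty\Big)\Big].$$ Assume now that $k$ is algebraically closed. If, for $m\in\mathcal M$, $g(m)$ and $\rho(m)_1,\dots,\rho(m)_{g(m)}$ are the number and the partial characters attached to $\rho(m)$ as in the context, so that $I(\rho(m))=\bigcap_{\ell=1}^{g(m)}I(\rho(m)_\ell)$ is a minimal primary decomposition, then $$I=\bigcap_{m\in\mathcal M}\ \bigcap_{\ell=1}^{g(m)}\Big[\Big((I+I(\rho(m)_\ell)):\big(\textstyle\prod_{i\in\Delta}x_i\big)^\infty\Big)+M_{\rm emb}\Big((I+I(\rho(m))):\big(\textstyle\prod_{i\in\Delta}x_i\big)^\infty\Big)\Big]$$ is a (not necessarily minimal) primary decomposition of $I$.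
   Context: Conventions: $0\in\mathbb N$; $k^*$ is the multiplicative group of $k$. A binomial is a polynomial with at most two terms; a binomial ideal is an ideal generated by binomials. For $\Delta\subseteq\{1,\dots,n\}$, $\Delta^c$ is its complement, $\mathbb N^\Delta=\{u\in\mathbb N^n: u_i=0 \text{ for } i\notin\Delta\}$, $\mathbb Z^\Delta$ is defined analogously, and $k[\mathbb N^\Delta]=k[x_i: i\in\Delta]$. $\operatorname{Hull}(J)$ denotes the intersection of the minimal primary components of an ideal $J$ (those belonging to the minimal primes of $J$). A partial character on $\mathbb Z^\Delta$ is a pair $(L_\rho,\rho)$ with $L_\rho$ a subgroup of $\mathbb Z^\Delta$ and $\rho:L_\rho\to k^*$ a group homomorphism. Its lattice ideal is $I(\rho)=\langle x^u-\rho(u-v)x^v: u,v\in\mathbb N^\Delta,\ u-v\in L_\rho\rangle\subseteq k[\mathbb N^\Delta]$; its extension to $k[x]$ is also denoted $I(\rho)$. The saturation of a lattice $L\subseteq\mathbb Z^\Delta$ is $\operatorname{Sat}(L)=(\mathbb Q\otimes_{\mathbb Z}L)\cap\mathbb Z^\Delta$. A proper ideal $I\subset k[x]$ is $\Delta$-cellular if $x_i$ is a nonzerodivisor modulo $I$ for $i\in\Delta$ and nilpotent modulo $I$ for $i\in\Delta^c$. If $I$ is a $\Delta$-cellular binomial ideal, there is a (unique) partial character $(L_\rho,\rho)$ on $\mathbb Z^\Delta$ with $I\cap k[\mathbb N^\Delta]=I(\rho)$; for a monomial $m\notin I$ the ideal $(I:m)$ is again a $\Delta$-cellular binomial ideal.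 A lattice $L\subseteq\mathbb Z^\Delta$ is associated to a $\Delta$-cellular binomial ideal $I$ if there is a monomial $m\in k[\mathbb N^{\Delta^c}]$ (a witness monomial of $L$) such that $(I:m)\cap k[\mathbb N^\Delta]=I(\tau)$ for some partial character $\tau:L\to k^*$. With $I\cap k[\mathbb N^\Delta]=I(\rho)$, an associated lattice $L$ is embedded if $\operatorname{rank}(L)>\operatorname{rank}(L_\rho)$. $M_{\rm emb}(I)\subseteq k[x]$ is the monomial ideal generated by the witness monomials of embedded associated lattices to $I$ (it is $0$ if there are none). In the claim $M_{\rm emb}$ is also applied to the ideals $(I+I(\rho(m))):(\prod_{i\in\Delta}x_i)^\infty$, which are $\Delta$-cellular binomial ideals. Decomposition of lattice ideals (known): suppose $k$ is algebraically closed of characteristic $p\ge 0$, and $(L_\rho,\rho)$ is a partial character on $\mathbb Z^\Delta$. If $p>0$, let $\operatorname{Sat}'_p(L_\rho)$ be the largest sublattice of $\operatorname{Sat}(L_\rho)$ containing $L_\rho$ such that $|\operatorname{Sat}'_p(L_\rho)/L_\rho|$ is coprime to $p$; let $\operatorname{Sat}'_0(L_\rho)=\operatorname{Sat}(L_\rho)$. Put $g=|\operatorname{Sat}'_p(L_\rho)/L_\rho|$. There are exactly $g$ distinct partial characters $\rho_1,\dots,\rho_g$ extending $\rho$ to $\operatorname{Sat}'_p(L_\rho)$, and each $\rho_\ell$ extends uniquely to a partial character $\chi_\ell$ on $\operatorname{Sat}(L_\rho)$. The associated primes of $I(\rho)$ are $I(\chi_1),\dots,I(\chi_g)$, all minimal,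 $I(\rho_\ell)$ is $I(\chi_\ell)$-primary, and $I(\rho)=\bigcap_{\ell=1}^g I(\rho_\ell)$ is the minimal primary decomposition. *)

(* Defs.v *)
From HB Require Import structures.
From mathcomp Require Import all_boot all_order all_algebra.
From mathcomp Require Import boolp classical_sets cardinality.
From mathcomp Require Import mpoly.

Set Implicit Arguments.
Unset Strict Implicit.
Unset Printing Implicit Defensive.

Import GRing.Theory.

Local Open Scope ring_scope.
Local Open Scope classical_set_scope.

(* Ideals are Prop-valued sets and may be the whole ring, unlike those of
   [idealr_closed], which are boolean and proper. *)
Section Ideals.
Variable R : comNzRingType.
Implicit Types (I J P Q S G : set R) (F : set (set R)).

Definition is_ideal I : Prop :=
  [/\ I 0, forall f g, I f -> I g -> I (f + g) & forall a f, I f -> I (a * f)].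

(* The ideal of the subring [S] generated by [G]; [S = setT] gives the ideal of
   [R] generated by [G]. *)
Definition ideal_gen_in S G : set R :=
  [set f | exists r (a h : 'I_r -> R),
     [/\ forall i, S (a i), forall i, G (h i) & f = \sum_i a i * h i]].

Definition ideal_gen G : set R := ideal_gen_in setT G.

Definition ideal_add I J : set R :=
  [set f | exists2 g, I g & exists2 h, J h & f = g + h].

Definition ideal_colon I (h : R) : set R := [set f | I (f * h)].

Definition ideal_sat I (h : R) : set R := [set f | exists N : nat, I (f * h ^+ N)].

Definition radical I : set R := [set f | exists N : nat, I (f ^+ N)].

Definition prime_ideal P : Prop :=
  [/\ is_ideal P, ~ P 1 & forall f g, P (f * g) -> P f \/ P g].

Definition primary_ideal Q : Prop :=
  [/\ is_ideal Q, ~ Q 1 & forall f g, Q (f * g) -> Q f \/ radical Q g].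

Definition minimal_prime I P : Prop :=
  [/\ prime_ideal P, I `<=` P &
      forall P', prime_ideal P' -> I `<=` P' -> P' `<=` P -> P' = P].

Definition primary_decomposition I F : Prop :=
  [/\ finite_set F, forall Q, F Q -> primary_ideal Q & I = \bigcap_(Q in F) Q].

Definition minimal_primary_decomposition I F : Prop :=
  [/\ primary_decomposition I F,
      forall Q Q', F Q -> F Q' -> radical Q = radical Q' -> Q = Q' &
      forall Q, F Q -> ~ (\bigcap_(Q' in F `\ Q) Q' `<=` Q)].

Definition minimal_primary_component I Q : Prop :=
  minimal_prime I (radical Q) /\
  exists2 F, minimal_primary_decomposition I F & F Q.

Definition Hull I : set R := \bigcap_(Q in minimal_primary_component I) Q.

End Ideals.

(* Subgroups of Z^n, seen as sets of integer row vectors. *)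
Section Lattices.
Variable n : nat.
Implicit Types (Delta : {set 'I_n}) (L S : set 'rV[int]_n).

Definition is_lattice L : Prop := zmod_closed (mem L).

Definition ZDelta Delta : set 'rV[int]_n :=
  [set u | forall i, i \notin Delta -> u 0 i = 0].

Definition NDelta Delta : set 'X_{1..n} :=
  [set u | forall i, i \notin Delta -> u i = 0%N].

Definition mdiff (u v : 'X_{1..n}) : 'rV[int]_n := \row_i ((u i)%:Z - (v i)%:Z).

Definition ratmx m (B : 'M[int]_(m, n)) : 'M[rat]_(m, n) := map_mx intr B.

(* The image of the tensor product of L with Q in Q^n: its Q-linear span. *)
Definition Qspan L : set 'rV[rat]_n :=
  [set w | exists m (B : 'M[int]_(m, n)),
     (forall i, L (row i B)) /\ (w <= ratmx B)%MS].

Definition lattice_rank L : nat :=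
  \max_(r < n.+1 | `[< exists m (B : 'M[int]_(m, n)),
     (forall i, L (row i B)) /\ \rank (ratmx B) = r >]) r.

Definition Sat Delta L : set 'rV[int]_n :=
  [set u | Qspan L (ratmx u)] `&` ZDelta Delta.

(* [has_index S L g]: g elements of S represent each coset of S / L once. *)
Definition has_index S L (g : nat) : Prop :=
  exists r : 'I_g -> 'rV[int]_n,
    (forall i, S (r i)) /\ (forall u, S u -> exists! i, L (u - r i)).

Definition prime_to_p_overlattice p Delta L S : Prop :=
  [/\ is_lattice S, L `<=` S, S `<=` Sat Delta L &
      exists2 g, has_index S L g & coprime g p].

Definition is_Sat' (p : nat) Delta L S : Prop :=
  if p == 0%N then S = Sat Delta L
  else prime_to_p_overlattice p Delta L S /\
       forall S', prime_to_p_overlattice p Delta L S' -> S' `<=` S.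

End Lattices.

Definition has_char (k : fieldType) (p : nat) : Prop :=
  if p == 0%N then [pchar k] =i pred0 else p \in [pchar k].

(* The values of [pc_val] outside [pc_lat] carry no meaning; [pc_eq] is the
   equality of partial characters. *)
Record partial_char (k : fieldType) n (Delta : {set 'I_n}) := PartialChar {
  pc_lat : set 'rV[int]_n;
  pc_val : 'rV[int]_n -> k;
  pc_lattice : is_lattice pc_lat;
  pc_ZDelta : pc_lat `<=` ZDelta Delta;
  pc_unit : forall u, pc_lat u -> pc_val u != 0;
  pc_mul : forall u v, pc_lat u -> pc_lat v ->
    pc_val (u + v) = pc_val u * pc_val v
}.

Section PartialCharacters.
Variables (k : fieldType) (n : nat) (Delta : {set 'I_n}).
Implicit Types rho tau : partial_char k Delta.

Definition pc_extends rho tau : Prop :=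
  pc_lat rho `<=` pc_lat tau /\
  forall u, pc_lat rho u -> pc_val tau u = pc_val rho u.

Definition pc_eq rho tau : Prop := pc_extends rho tau /\ pc_extends tau rho.

(* [rhol] lists the partial characters rho_1, ..., rho_g extending rho to
   Sat'_p(L_rho), where g = |Sat'_p(L_rho) / L_rho|. *)
Definition attached_chars (p : nat) rho (g : nat)
    (rhol : 'I_g -> partial_char k Delta) : Prop :=
  exists S : set 'rV[int]_n,
    [/\ is_Sat' p Delta (pc_lat rho) S,
        has_index S (pc_lat rho) g,
        forall l, pc_lat (rhol l) = S /\ pc_extends rho (rhol l),
        forall l l', pc_eq (rhol l) (rhol l') -> l = l' &
        forall tau, pc_lat tau = S -> pc_extends rho tau ->
          exists l, pc_eq tau (rhol l)].

(* k[N^Delta] as a subring of k[x] *)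
Definition polyN : set {mpoly k[n]} :=
  [set f | forall m, m \in msupp f -> NDelta Delta m].

Definition lattice_binomials rho : set {mpoly k[n]} :=
  [set f | exists u v, [/\ NDelta Delta u, NDelta Delta v,
     pc_lat rho (mdiff u v) &
     f = 'X_[u] - pc_val rho (mdiff u v) *: 'X_[v]]].

Definition lattice_ideal rho : set {mpoly k[n]} :=
  ideal_gen_in polyN (lattice_binomials rho).

Definition lattice_ideal_ext rho : set {mpoly k[n]} :=
  ideal_gen (lattice_ideal rho).

End PartialCharacters.

Section Cellular.
Variables (k : fieldType) (n : nat) (Delta : {set 'I_n}).
Implicit Types (I : set {mpoly k[n]}) (m : 'X_{1..n}).

Definition binomial : set {mpoly k[n]} := [set f | (size (msupp f) <= 2)%N].

Definition binomial_ideal I : Prop :=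
  exists2 G : set {mpoly k[n]}, G `<=` binomial & I = ideal_gen G.

Definition cellular I : Prop :=
  [/\ is_ideal I, ~ I 1,
      forall i, i \in Delta -> forall f, I ('X_i * f) -> I f &
      forall i, i \notin Delta -> exists N : nat, I ('X_i ^+ N)].

Definition witness_monomial I (L : set 'rV[int]_n) m : Prop :=
  NDelta (~: Delta) m /\
  exists2 tau : partial_char k Delta, pc_lat tau = L &
    ideal_colon I 'X_[m] `&` polyN Delta = lattice_ideal tau.

Definition embedded_lattice I (L : set 'rV[int]_n) : Prop :=
  (exists m, witness_monomial I L m) /\
  exists2 rho : partial_char k Delta,
    I `&` polyN Delta = lattice_ideal rho &
    (lattice_rank (pc_lat rho) < lattice_rank L)%N.

Definition M_emb I : set {mpoly k[n]} :=
  ideal_gen [set f | exists L m,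
    [/\ embedded_lattice I L, witness_monomial I L m & f = 'X_[m]]].

(* Exponents of the monomials in the index set of the decompositions. *)
Definition M_index I : set 'X_{1..n} :=
  [set m | m = 0%MM \/ (M_emb I 'X_[m] /\ ~ I 'X_[m])].

(* (I + I(rho)) : (prod_(i in Delta) x_i)^infty *)
Definition sat_sum I (rho : partial_char k Delta) : set {mpoly k[n]} :=
  ideal_sat (ideal_add I (lattice_ideal_ext rho)) (\prod_(i in Delta) 'X_i).

End Cellular.

(* Main.v *)
(* Modulo a binomial ideal [I], monomials are grouped into classes of monomials that
   agree up to a nonzero scalar, and [I] contains the components of its elements
   along these classes.  So an [f] outside [I] has a component outside [I], in the
   class of some monomial [m] not in [I].  Take [m0 = m] if [m] lies in [M_emb(I)] and
   [m0 = 1] otherwise.  In both cases [J = (I + I(rho(m0))) : x^infty] leaves the class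
   of [m] unchanged, and the lattice of [m] has the same rank as that of [rho(m0)], so
   that [m] does not lie in [J + M_emb(J)].  Hence [f] is not in the component of [m0].

   For the hull, let [P] be the radical of a nonminimal component of [J] and [P' < P] a
   prime over [J].  Choose variables [x_E] that are independent modulo the lattice of
   [rho(m0)] and maximal as such.  An element of [P] outside [P'] is, up to a monomial,
   integral over [k[x_E]] modulo [P'], and the last coefficient of an integral equation
   gives a nonzero polynomial of [k[x_E]] in [P] (unless [P] contains a variable of
   [Delta]).  Such polynomials have a leading term for an order on the exponents, so
   multiplication by them does not send the class component of [f] into [I].

   For the last decomposition, the characters [rho_l] are linearly independent, which
   splits a monomial as a sum of elements [h_l] sending [I(rho_l)] into [I(rho)].
   A component is primary because a polynomial in the variables of [Delta] has a
   [p^e]-th power congruent to [0] or to a polynomial with a leading term for the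
   order. *)

Require Import Defs.
From HB Require Import structures.
From mathcomp Require Import all_boot all_order all_algebra.
From mathcomp Require Import boolp classical_sets cardinality.
From mathcomp Require Import mpoly.
From mathcomp Require Import ring zify.

Set Implicit Arguments.
Unset Strict Implicit.
Unset Printing Implicit Defensive.

Import Order.TTheory GRing.Theory Num.Theory.

Local Open Scope ring_scope.
Local Open Scope classical_set_scope.

(** * Ideals and primary decompositions *)

(** All three intersections rest on one notion, [detects rho m]: the lattice of [m] lies between
    that of [rho] and its saturation, with the same character on the smaller one. It is stable under
    congruence modulo [I] and under multiplication by monomials in the variables of Delta, so
    arguments may run up to such monomials, which saturation cancels at the end. In the first two
    equalities the field is arbitrary: the primes over [J] need not be generated by binomials, and
    no grading is available on them. The hull is therefore reached through multipliers that keep [f]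
    detected, not through the shape of the components. The order on exponents is only a preorder,
    with the whole saturation as neutral elements, so a polynomial can have several top exponents.
    In [k[x_E]] this cannot happen; in the primary case a Frobenius power moves the differences of
    exponents from the saturation into [S], where the character turns one top monomial into a
    multiple of another. The index set can be infinite. Finiteness of the set of components comes
    from [(I : m)] depending only on the part of [m] outside Delta. *)

Section IdealTheory.
Variable R : comNzRingType.
Implicit Types (I J K P Q S G : set R) (f g h : R).

Lemma ideal_0 I : is_ideal I -> I 0.
Proof. by case. Qed.

Lemma idealD I f g : is_ideal I -> I f -> I g -> I (f + g).
Proof. by case=> _ + _; apply. Qed.

Lemma ideal_mull I a f : is_ideal I -> I f -> I (a * f).
Proof. by case=> _ _; apply. Qed.

Lemma ideal_mulr I a f : is_ideal I -> I f -> I (f * a).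
Proof. by rewrite mulrC; apply: ideal_mull. Qed.

Lemma idealN I f : is_ideal I -> I f -> I (- f).
Proof. by move=> idI If; rewrite -mulN1r; apply: ideal_mull. Qed.

Lemma idealB I f g : is_ideal I -> I f -> I g -> I (f - g).
Proof. by move=> idI If Ig; apply: idealD => //; apply: idealN. Qed.

Lemma idealDr I f g : is_ideal I -> I f -> I (f + g) <-> I g.
Proof.
move=> idI If; split=> [Ifg|]; last exact: idealD.
by rewrite -(addKr f g); apply: idealD => //; apply: idealN.
Qed.

Lemma ideal_sum I (T : Type) (s : seq T) (p : pred T) (F : T -> R) :
  is_ideal I -> (forall i, p i -> I (F i)) -> I (\sum_(i <- s | p i) F i).
Proof.
move=> idI IF; apply: (big_ind I) => //; first exact: ideal_0.
by move=> f g; apply: idealD.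
Qed.

Lemma idealX_le I f N N' :
  is_ideal I -> (N <= N')%N -> I (f ^+ N) -> I (f ^+ N').
Proof. by move=> idI /subnK<- IfN; rewrite exprD; apply: ideal_mull. Qed.

Lemma ideal_gen_in0 S G : ideal_gen_in S G 0.
Proof.
by exists 0%N, (fun _ => 0), (fun _ => 0); split=> [[]|[]|] //; rewrite big_ord0.
Qed.

Lemma ideal_gen_inD S G f g :
  ideal_gen_in S G f -> ideal_gen_in S G g -> ideal_gen_in S G (f + g).
Proof.
move=> [r [a [h [Sa Gh ->]]]] [r' [a' [h' [Sa' Gh' ->]]]].
exists (r + r')%N, (fun i => match split i with inl j => a j | inr j => a' j end),
  (fun i => match split i with inl j => h j | inr j => h' j end).
split=> [i|i|]; try by case: split.
rewrite big_split_ord /=; congr (_ + _); apply: eq_bigr => i _.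
  by rewrite (unsplitK (inl _ i)).
by rewrite (unsplitK (inr _ i)).
Qed.

Lemma mem_ideal_gen_in S G a h : S a -> G h -> ideal_gen_in S G (a * h).
Proof.
move=> Sa Gh; exists 1%N, (fun=> a), (fun=> h); split=> //.
by rewrite big_ord1.
Qed.

Lemma ideal_gen_in_ind S G (P : R -> Prop) :
    P 0 -> (forall f g, P f -> P g -> P (f + g)) ->
    (forall a h, S a -> G h -> P (a * h)) ->
  forall f, ideal_gen_in S G f -> P f.
Proof.
move=> P0 PD PM f [r [a [h [Sa Gh ->]]]].
by apply: (big_ind P) => // i _; apply: PM.
Qed.

Lemma ideal_gen_inM S G a f : (forall b, S b -> S (a * b)) ->
  ideal_gen_in S G f -> ideal_gen_in S G (a * f).
Proof.
move=> SM; apply: (ideal_gen_in_ind (P := fun f => ideal_gen_in S G (a * f)))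
  => [|f' g Hf Hg|b h Sb Gh].
- by rewrite mulr0; apply: ideal_gen_in0.
- by rewrite mulrDr; apply: ideal_gen_inD.
- by rewrite mulrA; apply: mem_ideal_gen_in => //; apply: SM.
Qed.

Lemma is_ideal_gen G : is_ideal (ideal_gen G).
Proof.
split=> [|f g|a f]; [exact: ideal_gen_in0|exact: ideal_gen_inD|].
exact: ideal_gen_inM.
Qed.

Lemma sub_ideal_gen G : G `<=` ideal_gen G.
Proof. by move=> f Gf; rewrite -[f]mul1r; apply: mem_ideal_gen_in. Qed.

Lemma ideal_gen_min G I : is_ideal I -> G `<=` I -> ideal_gen G `<=` I.
Proof.
move=> idI GI; apply: (ideal_gen_in_ind (P := I)) => [|g h|a h _ /GI]; first exact: ideal_0.
  exact: idealD.
exact: ideal_mull.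
Qed.

Lemma is_ideal_add I J : is_ideal I -> is_ideal J -> is_ideal (ideal_add I J).
Proof.
move=> idI idJ; split.
- by exists 0; [exact: ideal_0|exists 0; [exact: ideal_0|rewrite addr0]].
- move=> _ _ [f If [g Jg ->]] [f' If' [g' Jg' ->]].
  exists (f + f'); first exact: idealD.
  by exists (g + g'); [exact: idealD|rewrite addrACA].
- move=> a _ [f If [g Jg ->]]; exists (a * f); first exact: ideal_mull.
  by exists (a * g); [exact: ideal_mull|rewrite mulrDr].
Qed.

Lemma sub_ideal_addl I J : is_ideal J -> I `<=` ideal_add I J.
Proof. by move=> idJ f If; exists f => //; exists 0; [exact: ideal_0|rewrite addr0]. Qed.

Lemma sub_ideal_addr I J : is_ideal I -> J `<=` ideal_add I J.
Proof. by move=> idI f Jf; exists 0; [exact: ideal_0|exists f; rewrite ?add0r]. Qed.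

Lemma is_ideal_colon I h : is_ideal I -> is_ideal (ideal_colon I h).
Proof.
move=> idI; split=> [|f g If Ig|a f If]; rewrite /ideal_colon /=.
- by rewrite mul0r; apply: ideal_0.
- by rewrite mulrDl; apply: idealD.
- by rewrite -mulrA; apply: ideal_mull.
Qed.

Lemma is_ideal_sat I h : is_ideal I -> is_ideal (ideal_sat I h).
Proof.
move=> idI; split=> [|f g [N If] [N' Ig]|a f [N If]].
- by exists 0%N; rewrite mul0r; apply: ideal_0.
- exists (N + N')%N; rewrite mulrDl exprD; apply: idealD => //.
    by rewrite mulrA; apply: ideal_mulr.
  by rewrite [h ^+ N * _]mulrC mulrA; apply: ideal_mulr.
- by exists N; rewrite -mulrA; apply: ideal_mull.
Qed.

Lemma sub_ideal_sat I h : I `<=` ideal_sat I h.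
Proof. by move=> f If; exists 0%N; rewrite expr0 mulr1. Qed.

Lemma sub_radical I : I `<=` radical I.
Proof. by move=> f If; exists 1%N. Qed.

Lemma radical_setI I J :
  is_ideal I -> is_ideal J -> radical (I `&` J) = radical I `&` radical J.
Proof.
move=> idI idJ; apply/seteqP; split=> f.
  by case=> N [If Jf]; split; exists N.
case=> -[N If] [N' Jf]; exists (maxn N N'); split.
  by apply: idealX_le If => //; apply: leq_maxl.
by apply: idealX_le Jf => //; apply: leq_maxr.
Qed.

Lemma primeX P f N : prime_ideal P -> P (f ^+ N) -> P f.
Proof.
case=> idP P1 Pp; elim: N => [|N IH]; first by rewrite expr0 => /P1.
by rewrite exprS => /Pp[].
Qed.

Lemma is_ideal_radical I : is_ideal I -> is_ideal (radical I).
Proof.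
move=> idI; split=> [|f g [N If] [N' Ig]|a f [N If]].
- by exists 1%N; apply: ideal_0.
- exists (N + N')%N; rewrite exprDn; apply: ideal_sum => // i _.
  rewrite -mulr_natl; apply: ideal_mull => //.
  have [leN|/ltnW gtN] := leqP N' i.
    by apply: ideal_mull => //; apply: idealX_le Ig.
  apply: ideal_mulr => //; apply: idealX_le If => //.
  by rewrite -(leq_add2r i) subnK ?leq_add2l // -ltnS ltn_ord.
- by exists N; rewrite exprMn; apply: ideal_mull.
Qed.

Lemma radical_primary_prime Q : primary_ideal Q -> prime_ideal (radical Q).
Proof.
case=> idQ Q1 Qp; split; first exact: is_ideal_radical.
  by case=> N; rewrite expr1n.
move=> f g [N]; rewrite exprMn => /Qp[Qf|[M]]; first by left; exists N.
by rewrite -exprM => Qg; right; exists (N * M)%N.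
Qed.

Lemma primary_setI I J : primary_ideal I -> primary_ideal J ->
  radical I = radical J -> primary_ideal (I `&` J).
Proof.
move=> [idI I1 Ip] [idJ J1 Jp] rIJ; split.
- split=> [|f g [If Jf] [Ig Jg]|a f [If Jf]]; split;
  by [apply: ideal_0|apply: idealD|apply: ideal_mull].
- by case.
- move=> f g [/Ip If /Jp Jf]; rewrite radical_setI // -rIJ setIid.
  rewrite -rIJ in Jf.
  by case: If => [If|]; [case: Jf => [Jf|]; [left|right]|right].
Qed.

(** A single stationary step suffices, since the chains of counterexamples to be excluded are strict
    at every step. *)
Definition acc_ideals : Prop := forall I : nat -> set R,
  (forall i, is_ideal (I i)) -> (forall i, I i `<=` I i.+1) ->
  exists i, I i.+1 `<=` I i.

Definition list_inter (s : seq (set R)) : set R :=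
  [set f | forall Q, Q \in s -> Q f].

Lemma noetherian_ind (Pr : set R -> Prop) : acc_ideals ->
    (forall I, is_ideal I ->
      (forall J, is_ideal J -> I `<=` J -> ~ (J `<=` I) -> Pr J) -> Pr I) ->
  forall I, is_ideal I -> Pr I.
Proof.
move=> acc step I idI; apply: contrapT => nPI.
pose T := {J : set R | is_ideal J /\ ~ Pr J}.
have next (t : T) : {u : T | sval t `<=` sval u /\ ~ (sval u `<=` sval t)}.
  apply: cid; case: t => J [idJ nPJ] /=; apply: contrapT => /forallNP nex.
  apply: nPJ; apply: step => // J' idJ' JJ' nJ'J; apply: contrapT => nPJ'.
  by apply: (nex (exist _ J' (conj idJ' nPJ'))).
pose F := fix F i : T := if i is j.+1 then sval (next (F j)) else exist _ I (conj idI nPI).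
have [i||i] := acc (fun i => sval (F i)); first by case: (F i) => ? [].
  by move=> i /=; case: (next (F i)) => ? [].
by rewrite /=; case: (next (F i)) => ? [].
Qed.

(** If [f * g] is in [I], with [f] outside [I] and [g] outside its radical, and the colon ideals by
    powers of [g] are stationary from [g ^+ N.+1] on, then [I] is the intersection of
    [I : g ^+ N.+1] and [I + (g ^+ N.+1)], both strictly larger. The unit ideal gets the empty
    list. *)
Lemma lasker_noether I : acc_ideals -> is_ideal I ->
  exists s : seq (set R), (forall Q, Q \in s -> primary_ideal Q) /\ I = list_inter s.
Proof.
move=> acc; move: I; apply: noetherian_ind => // I idI IH.
have [I1|nI1] := pselect (I 1).
  exists [::]; split=> //; apply/seteqP; split=> f // _.
  by rewrite -[f]mulr1; apply: ideal_mull.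
have [pI|npI] := pselect (primary_ideal I).
  exists [:: I]; split=> [Q|]; first by rewrite inE => /eqP->.
  apply/seteqP; split=> f; first by move=> If Q; rewrite inE => /eqP->.
  by apply; rewrite inE.
have [f [g [Ifg If Ig]]] : exists f g, [/\ I (f * g), ~ I f & ~ radical I g].
  apply: contrapT => nex; apply: npI; split=> // f g Ifg.
  have [If|nIf] := pselect (I f); first by left.
  right; apply: contrapT => nIg.
  by apply: nex; exists f, g.
pose C N := ideal_colon I (g ^+ N.+1).
have idC N : is_ideal (C N) by apply: is_ideal_colon.
have subC N : C N `<=` C N.+1.
  by move=> h; rewrite /C /ideal_colon /= [g ^+ _.+2]exprS mulrCA; apply: ideal_mull.
have [N stN] := acc C idC subC.
have stab M h : I (h * g ^+ (N.+1 + M)) -> I (h * g ^+ N.+1).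
  elim: M h => [|M IHM] h; first by rewrite addn0.
  rewrite addnS exprS mulrA => /IHM; rewrite -mulrA -exprS => hI.
  exact: stN.
pose J := ideal_add I (ideal_gen [set g ^+ N.+1]).
have idJ : is_ideal J by apply/is_ideal_add/is_ideal_gen.
have [||s [sP sI]] := IH (C N) (idC N).
- by move=> h Ih; apply: ideal_mulr.
- move=> CI; apply: If; apply: CI; rewrite /C /ideal_colon /= exprS mulrA.
  exact: ideal_mulr.
have [||s' [sP' sI']] := IH J idJ.
- by apply: sub_ideal_addl; apply: is_ideal_gen.
- move=> JI; apply: Ig; exists N.+1; apply: JI; apply: sub_ideal_addr => //.
  exact: sub_ideal_gen.
exists (s ++ s'); split.
  by move=> Q; rewrite mem_cat => /orP[/sP|/sP'].
apply/seteqP; split=> h.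
  move=> Ih Q; rewrite mem_cat => /orP[].
    by have : list_inter s h by [rewrite -sI; apply: ideal_mulr]; apply.
  have : list_inter s' h; last by apply.
  by rewrite -sI'; apply: sub_ideal_addl => //; apply: is_ideal_gen.
move=> hI.
have : C N h by rewrite sI => Q Qs; apply: hI; rewrite mem_cat Qs.
have : J h by rewrite sI' => Q Qs; apply: hI; rewrite mem_cat Qs orbT.
case=> a Ia [b bg ->].
have {bg} [c ->] : exists c, b = c * g ^+ N.+1.
  apply: (ideal_gen_in_ind (P := fun b => exists c, b = c * g ^+ N.+1)) bg
    => [|u v [c ->] [c' ->]|u v _ ->].
  - by exists 0; rewrite mul0r.
  - by exists (c + c'); rewrite mulrDl.
  - by exists u.
rewrite /C /ideal_colon /= mulrDl => /idealDr => /(_ idI (ideal_mulr _ idI Ia)).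
by rewrite -mulrA -exprD => /stab Ic; apply: idealD.
Qed.

Lemma list_interP s : list_inter s = \bigcap_(Q in [set` s]) Q.
Proof. by apply/seteqP; split=> f sf Q Qs; apply: sf. Qed.

(* A list of primary ideals of minimal length gives an irredundant
   decomposition, since two components with the same radical could be merged. *)
Lemma minimal_primary_decomposition_exists I : acc_ideals -> is_ideal I ->
  exists F, minimal_primary_decomposition I F.
Proof.
move=> acc idI; have [s0 [s0P s0I]] := lasker_noether acc idI.
pose good m := `[< exists s : seq (set R), [/\ size s = m,
  (forall Q, Q \in s -> primary_ideal Q) & I = list_inter s] >].
have exg : exists m, good m by exists (size s0); apply/asboolP; exists s0.
case: (ex_minnP exg) => m /asboolP[s [sm sP sI]] min.
have short (s' : seq (set R)) : (forall Q, Q \in s' -> primary_ideal Q) -> I = list_inter s' ->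
    (size s <= size s')%N.
  by move=> s'P s'I; rewrite sm; apply: min; apply/asboolP; exists s'.
exists [set` s]; split.
- split; [exact: finite_seq| by move=> Q /sP|by rewrite -list_interP].
- move=> Q Q' Qs Q's rQ; apply: contrapT => /eqP neQ.
  have Q's' : Q' \in rem Q s.
    rewrite /= in Qs Q's; move: Q's; rewrite (perm_mem (perm_to_rem Qs)) inE.
    by rewrite eq_sym (negPf neQ).
  have := short (Q `&` Q' :: rem Q' (rem Q s)).
  rewrite /= !size_rem //.
  have s2 : (1 < size s)%N.
    rewrite /= in Qs; rewrite (perm_size (perm_to_rem Qs)) /= ltnS lt0n size_eq0.
    by case: (rem Q s) Q's'.
  move=> H; suff : (size s <= (size s).-2.+1)%N by lia.
  apply: H.
    move=> A; rewrite inE => /predU1P[->|/mem_rem/mem_rem/sP//].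
    by apply: primary_setI => //; apply: sP.
  rewrite sI; apply/seteqP; split=> f fs A.
    rewrite inE => /predU1P[->|/mem_rem/mem_rem/fs//].
    by split; apply: fs.
  rewrite (perm_mem (perm_to_rem Qs)) inE => /predU1P[->|].
    by have [] := fs _ (mem_head _ _).
  rewrite (perm_mem (perm_to_rem Q's')) inE => /predU1P[->|As].
    by have [] := fs _ (mem_head _ _).
  by apply: fs; rewrite inE As orbT.
- move=> Q Qs sQ; have := short [seq A <- s | A != Q].
  have -> : (size s <= size [seq A <- s | A != Q])%N = false.
    rewrite size_filter; apply/negbTE; rewrite -ltnNge -(count_predC [pred A | A != Q] s).
    rewrite -[X in (X < _)%N]addn0 ltn_add2l -has_count.
    by apply/hasP; exists Q => //=; rewrite eqxx.
  move=> H; suff : false by [].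
  apply: H; first by move=> A; rewrite mem_filter => /andP[_ /sP].
  rewrite sI; apply/seteqP; split=> f fs A.
    by rewrite mem_filter => /andP[_ /fs].
  move=> As; have [->|neA] := eqVneq A Q.
    apply: sQ => B [/= Bs nB]; apply: fs; rewrite mem_filter Bs andbT.
    by apply/eqP.
  by apply: fs; rewrite mem_filter neA.
Qed.

End IdealTheory.

(** * Dickson's lemma and the ascending chain condition *)

Section Dickson.

(** Each index of the subsequence minimizes [f] among all indices after the previous one, so later
    values cannot be smaller. *)
Lemma nondecreasing_subseq (f : nat -> nat) : exists phi : nat -> nat,
  {homo phi : i j / (i < j)%N} /\ {homo f \o phi : i j / (i <= j)%N}.
Proof.
have argmin N : {i | (N <= i)%N /\ forall j, (N <= j)%N -> (f i <= f j)%N}.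
  apply: cid; pose good v := `[< exists2 i, (N <= i)%N & f i = v >].
  have exg : exists v, good v by exists (f N); apply/asboolP; exists N.
  case: (ex_minnP exg) => v /asboolP[i Ni <-] min; exists i; split=> // j Nj.
  by apply: min; apply/asboolP; exists j.
pose phi := fix phi k := if k is j.+1 then sval (argmin (phi j).+1)
                         else sval (argmin 0%N).
have phiS k : (phi k < phi k.+1)%N by rewrite /=; case: (argmin _) => ? [].
exists phi; split; first exact: homo_ltn ltn_trans phiS.
have step k : (f (phi k) <= f (phi k.+1))%N.
  have lek : (phi k <= phi k.+1)%N by apply: ltnW.
  case: k lek => [|k] lek; first by have [_] := svalP (argmin 0%N); apply.
  have [_] := svalP (argmin (phi k).+1); apply.
  exact: ltn_trans (phiS k) (phiS k.+1).
by apply: homo_leq step => [i|j i k]; [exact: leqnn|exact: leq_trans].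
Qed.

Lemma dickson n (u : nat -> 'X_{1..n}) :
  exists i j, (i < j)%N /\ (u i <= u j)%MM.
Proof.
have [phi [phi_lt phi_le]] : exists phi : nat -> nat,
    {homo phi : i j / (i < j)%N} /\
    forall c, c \in enum 'I_n -> {homo (fun k => u (phi k) c) : i j / (i <= j)%N}.
  (* Coordinates are treated one at a time, each refining the subsequence found so far. *)
  elim: (enum _) => [|c s [phi [phi_lt phi_le]]]; first by exists id; split.
  have [psi [psi_lt psi_le]] := nondecreasing_subseq (fun k => u (phi k) c).
  exists (phi \o psi); split=> [i j /psi_lt/phi_lt //|d].
  rewrite inE => /predU1P[->|ds] i j leij; first exact: psi_le.
  apply: phi_le => //; move: leij; rewrite leq_eqVlt => /predU1P[->//|/psi_lt].
  exact: ltnW.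
exists (phi 0%N), (phi 1%N); split; first exact: phi_lt.
by apply/mnm_lepP => c; apply: phi_le => //; rewrite mem_enum.
Qed.

End Dickson.

(* If [f i] has minimal leading monomial among the elements of [I i.+1] outside
   [I i], then by Dickson's lemma some [f j] can be reduced by an earlier [f i]. *)
Lemma mpoly_acc (k : fieldType) n : acc_ideals {mpoly k[n]}.
Proof.
move=> I idI subI; apply: contrapT => /forallNP nst.
have leI i j : (i <= j)%N -> I i `<=` I j.
  move=> /subnK<-; elim: (j - i)%N => [//|m IH] f /IH.
  by rewrite addSn; apply: subI.
have minf i : {f | [/\ I i.+1 f, ~ I i f &
    forall g, I i.+1 g -> (mlead g < mlead f)%O -> I i g]}.
  apply: cid; have := nst i => /existsNP[f /not_implyP].
  move: {-1}(mlead f) (erefl (mlead f)) => m.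
  elim/(well_founded_ind (@ltom_wf n)): m f => m IH f fm [If nIf].
  have [[g [Ig ltg nIg]]|nex] :=
    pselect (exists g, [/\ I i.+1 g, (mlead g < mlead f)%O & ~ I i g]).
    by apply: (IH (mlead g) _ g) => //; rewrite -fm.
  exists f; split=> // g Ig ltg; apply: contrapT => nIg.
  by apply: nex; exists g.
pose F i := sval (minf i).
have [i [j [ltij lem]]] := dickson (fun i => mlead (F i)).
rewrite /F in lem; case: (minf i) lem => f /= [If nIf _].
case: (minf j) => g /= [Ig nIg ming] lefg.
have f0 : f != 0 by apply/eqP => f0; apply: nIf; rewrite f0; apply: ideal_0.
have g0 : g != 0 by apply/eqP => g0; apply: nIg; rewrite g0; apply: ideal_0.
pose h := ((mleadc g / mleadc f) *: 'X_[mlead g - mlead f]) * f.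
have Ijh : I j h.
  by apply: ideal_mull => //; apply: (leI i.+1) If.
have fc0 : mleadc f != 0 by rewrite mleadc_eq0.
have c0 : mleadc g / mleadc f != 0 by rewrite mulf_neq0 ?invr_eq0 ?mleadc_eq0.
have gh : I j.+1 (g - h) by apply: idealB => //; apply: subI.
apply: nIg; rewrite -(subrK h g); apply: idealD => //.
have [->|gh0] := eqVneq (g - h) 0; first exact: ideal_0.
have hc m : h@_(mlead g - mlead f + m) = mleadc g / mleadc f * f@_m.
  by rewrite /h -scalerAl mcoeffZ ['X_[_] * f]mulrC mcoeffMX.
have hlead : h@_(mlead g) = mleadc g.
  by rewrite -{1}(submK lefg) hc divfK.
have hle : (mlead h <= mlead g)%O.
  apply: le_trans (mleadM_le _ _) _.
  by rewrite mleadZ_proper ?mleadXm ?submK // mcoeffX eqxx mulr1.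
apply: ming => //; rewrite lt_neqAle; apply/andP; split.
  apply: contraNneq gh0 => E; rewrite -mleadc_eq0 E.
  by rewrite mcoeffB hlead subrr.
by apply: le_trans (mleadB_le _ _) _; rewrite leUx lexx.
Qed.

(** * Grading by classes of monomials *)

Section Projection.
Variables (k : fieldType) (n : nat).
Implicit Types (C D : set 'X_{1..n}) (f g b : {mpoly k[n]}) (I K G : set {mpoly k[n]}).
Implicit Types (m t u v w z : 'X_{1..n}).

Definition mproj C f : {mpoly k[n]} :=
  \sum_(z <- msupp f | `[< C z >]) f@_z *: 'X_[z].

Lemma mcoeff_mproj C f z : (mproj C f)@_z = if `[< C z >] then f@_z else 0.
Proof.
rewrite /mproj raddf_sum /= (eq_bigr (fun w => f@_w * (w == z)%:R)); last first.
  by move=> w _; rewrite mcoeffZ mcoeffX.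
have [zf|zf] := boolP (z \in msupp f); last first.
  rewrite (memN_msupp_eq0 zf) if_same big_seq_cond big1 // => w /andP[wf _].
  by case: eqVneq zf => [<-|]; rewrite ?wf // mulr0.
rewrite big_mkcond (bigD1_seq z) ?msupp_uniq //= eqxx mulr1 big1 ?addr0 // => w.
by move=> /negPf->; rewrite mulr0 if_same.
Qed.

Lemma mprojD C f g : mproj C (f + g) = mproj C f + mproj C g.
Proof.
apply/mpolyP => z; rewrite mcoeffD !mcoeff_mproj mcoeffD.
by case: ifP; rewrite ?addr0.
Qed.

Lemma mproj0 C : mproj C 0 = 0.
Proof. by apply/mpolyP => z; rewrite mcoeff_mproj mcoeff0 if_same. Qed.

Lemma mprojZ C c f : mproj C (c *: f) = c *: mproj C f.
Proof.
apply/mpolyP => z; rewrite mcoeffZ !mcoeff_mproj mcoeffZ.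
by case: ifP; rewrite ?mulr0.
Qed.

Lemma mprojN C f : mproj C (- f) = - mproj C f.
Proof. by rewrite -scaleN1r mprojZ scaleN1r. Qed.

Lemma mproj_sum C (T : Type) (s : seq T) (p : pred T) (F : T -> {mpoly k[n]}) :
  mproj C (\sum_(i <- s | p i) F i) = \sum_(i <- s | p i) mproj C (F i).
Proof. by apply: (big_morph (mproj C)); [exact: mprojD|exact: mproj0]. Qed.

Lemma mprojX C z : mproj C 'X_[z] = if `[< C z >] then 'X_[z] else 0.
Proof.
apply/mpolyP => w; rewrite mcoeff_mproj mcoeffX.
case: eqVneq => [<-|zw]; first by case: ifP => Cz; rewrite ?mcoeffX ?eqxx ?mcoeff0.
by rewrite if_same; case: ifP => _; rewrite ?mcoeff0 // mcoeffX (negPf zw).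
Qed.

Lemma mproj_id C f : (forall z, z \in msupp f -> C z) -> mproj C f = f.
Proof.
move=> Cf; apply/mpolyP => z; rewrite mcoeff_mproj.
case: ifPn => // /asboolPn nCz; rewrite memN_msupp_eq0 //.
by apply: contra_notN nCz => /Cf.
Qed.

Lemma mproj_eq0 C f : (forall z, z \in msupp f -> ~ C z) -> mproj C f = 0.
Proof.
move=> Cf; apply/mpolyP => z; rewrite mcoeff_mproj mcoeff0.
case: ifPn => // /asboolP Cz; rewrite memN_msupp_eq0 //.
by apply/negP => /Cf.
Qed.

Lemma eq_mproj C D f :
  (forall z, z \in msupp f -> C z <-> D z) -> mproj C f = mproj D f.
Proof.
move=> CD; apply/mpolyP => z; rewrite !mcoeff_mproj.
have [zf|/memN_msupp_eq0->] := boolP (z \in msupp f); last by rewrite !if_same.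
by rewrite (asbool_equiv_eq (CD z zf)).
Qed.

Lemma mproj_mproj C D f : mproj C (mproj D f) = mproj (C `&` D) f.
Proof.
apply/mpolyP => z; rewrite !mcoeff_mproj.
have -> : `[< (C `&` D) z >] = `[< C z >] && `[< D z >] by apply: asbool_and.
by case: `[< C z >]; case: `[< D z >].
Qed.

Lemma mproj_setC C f : f = mproj C f + mproj (~` C) f.
Proof.
apply/mpolyP => z; rewrite mcoeffD !mcoeff_mproj.
have -> : `[< (~` C) z >] = ~~ `[< C z >] by apply: asbool_neg.
by case: ifP; rewrite ?addr0 ?add0r.
Qed.

Lemma mcoeffMX_if f m z :
  (f * 'X_[m])@_z = if (m <= z)%MM then f@_(z - m) else 0.
Proof.
case: ifP => [lemz|]; first by rewrite -{1}(submK lemz) addmC mcoeffMX.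
move=> /negbT nle; apply: memN_msupp_eq0; apply: contra nle.
rewrite (perm_mem (msuppMX f m)) => /mapP[w _ ->].
exact: lem_addr.
Qed.

Lemma mproj_mulX C f m :
  mproj C (f * 'X_[m]) = mproj [set z | C (m + z)%MM] f * 'X_[m].
Proof.
apply/mpolyP => z; rewrite mcoeff_mproj !mcoeffMX_if.
have [lemz|_] := boolP (m <= z)%MM; last by rewrite if_same.
by rewrite mcoeff_mproj /= [(m + _)%MM]addmC submK.
Qed.

Lemma mprojM_gen G K C : is_ideal K ->
    (forall b t, G b -> K (mproj C (b * 'X_[t]))) ->
  forall f, ideal_gen G f -> K (mproj C f).
Proof.
move=> idK KG; apply: (ideal_gen_in_ind (P := fun f => K (mproj C f))).
- by rewrite mproj0; apply: ideal_0.
- by move=> f g Kf Kg; rewrite mprojD; apply: idealD.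
- move=> a b _ Gb; rewrite [a]mpolyE mulr_suml mproj_sum.
  apply: ideal_sum => // t _.
  rewrite -scalerAl mprojZ -mul_mpolyC [_ * b]mulrC.
  by apply: ideal_mull => //; apply: KG.
Qed.

Lemma idealZ K c f : is_ideal K -> K f -> K (c *: f).
Proof. by move=> idK Kf; rewrite -mul_mpolyC; apply: ideal_mull. Qed.

Lemma idealZI K c f : is_ideal K -> c != 0 -> K (c *: f) -> K f.
Proof.
by move=> idK c0 /(idealZ c^-1 idK); rewrite scalerA mulVf // scale1r.
Qed.

(** The monomials lying in [K] form a single class, any nonzero scalar being allowed for them. *)
Definition mcong K z w : Prop := exists2 c : k, c != 0 & K ('X_[z] - c *: 'X_[w]).

Lemma mcong_refl K z : is_ideal K -> mcong K z z.
Proof.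
by move=> idK; exists 1; rewrite ?oner_eq0 // scale1r subrr; apply: ideal_0.
Qed.

Lemma mcong_sym K z w : is_ideal K -> mcong K z w -> mcong K w z.
Proof.
move=> idK [c c0 Kc]; exists c^-1; first by rewrite invr_eq0.
have -> : 'X_[w] - c^-1 *: 'X_[z] = - c^-1 *: ('X_[z] - c *: 'X_[w]).
  by rewrite scalerBr scalerA mulNr mulVf // !scaleNr scale1r opprK addrC.
exact: idealZ.
Qed.

Lemma mcong_trans K u v w : is_ideal K ->
  mcong K u v -> mcong K v w -> mcong K u w.
Proof.
move=> idK [c c0 Kc] [d d0 Kd]; exists (c * d); first by rewrite mulf_neq0.
have -> : 'X_[u] - (c * d) *: 'X_[w]
          = ('X_[u] - c *: 'X_[v]) + c *: ('X_[v] - d *: 'X_[w]) :> {mpoly k[n]}.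
  by rewrite scalerBr scalerA addrA subrK.
by apply: idealD => //; apply: idealZ.
Qed.

Lemma mcong_add K t z w : is_ideal K -> mcong K z w -> mcong K (t + z) (t + w).
Proof.
move=> idK [c c0 Kc]; exists c => //.
by rewrite !mpolyXD scalerAr -mulrBr; apply: ideal_mull.
Qed.

Lemma mcong_sub I K z w : I `<=` K -> mcong I z w -> mcong K z w.
Proof. by move=> IK [c c0 /IK Kc]; exists c. Qed.

Lemma mcong_mem K z w : is_ideal K -> mcong K z w -> K 'X_[z] -> K 'X_[w].
Proof.
move=> idK [c c0 Kc] Kz; apply: (idealZI idK c0).
by rewrite -(subKr 'X_[z] (c *: 'X_[w])); apply: idealB.
Qed.

Definition mcong_closed K C := forall z w, mcong K z w -> C z -> C w.

Lemma mcong_closed_class K w : is_ideal K -> mcong_closed K [set z | mcong K z w].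
Proof.
move=> idK z z' zz' zw; apply: mcong_trans zw => //.
exact: mcong_sym.
Qed.

(* The quotient by a binomial ideal is graded by the classes of monomials that
   agree up to a nonzero scalar. *)
Definition class_graded K := forall C, mcong_closed K C ->
  forall f, K f -> K (mproj C f).

Lemma binomialP b : Defs.binomial b ->
  exists (c d : k) u v, b = c *: 'X_[u] + d *: 'X_[v].
Proof.
rewrite /Defs.binomial /=; move: (mpolyE b); case: (msupp b) => [|u [|v [|]]] //= ->.
- by move=> _; exists 0, 0, 0%MM, 0%MM; rewrite big_nil !scale0r addr0.
- by move=> _; exists b@_u, 0, u, 0%MM; rewrite big_seq1 scale0r addr0.
- by move=> _; exists b@_u, b@_v, u, v; rewrite big_cons big_seq1.
Qed.

(** With both coefficients nonzero, the two monomials are congruent, so [C] contains both or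
    neither; otherwise only a monomial is left, which the projection keeps or kills. *)
Lemma mproj_binomial K C c d u v : is_ideal K -> mcong_closed K C ->
  K (c *: 'X_[u] + d *: 'X_[v]) -> K (mproj C (c *: 'X_[u] + d *: 'X_[v])).
Proof.
move=> idK clC; have mono (a : k) w : K (a *: 'X_[w]) -> K (mproj C (a *: 'X_[w])).
  move=> Kw; rewrite mprojZ mprojX; case: ifP => // _.
  by rewrite scaler0; apply: ideal_0.
have [->|c0] := eqVneq c 0; first by rewrite scale0r add0r; apply: mono.
have [->|d0] := eqVneq d 0; first by rewrite scale0r addr0; apply: mono.
move=> Kb; have uv : mcong K u v.
  exists (- (d / c)); first by rewrite oppr_eq0 mulf_neq0 ?invr_eq0.
  apply: (idealZI idK c0); rewrite scalerBr scalerA mulrN scaleNr opprK.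
  by rewrite mulrC divfK.
have CuCv : `[< C u >] = `[< C v >].
  by apply/asbool_equiv_eq; split; apply: clC => //; apply: mcong_sym.
rewrite mprojD !mprojZ !mprojX CuCv; case: ifP => // _.
by rewrite !scaler0 addr0; apply: ideal_0.
Qed.

Lemma mproj_binomial_ideal I K C : binomial_ideal I -> is_ideal K -> I `<=` K ->
  mcong_closed K C -> forall f, I f -> K (mproj C f).
Proof.
move=> [G GB defI] idK IK clC f If.
have KG b : G b -> K b by move=> Gb; apply: IK; rewrite defI; apply: sub_ideal_gen.
rewrite defI in If; apply: (mprojM_gen idK _ If) => b t Gb.
have := ideal_mulr 'X_[t] idK (KG _ Gb); have [c [d [u [v ->]]]] := binomialP (GB _ Gb).
by rewrite mulrDl -!scalerAl -!mpolyXD; apply: mproj_binomial.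
Qed.

Lemma binomial_ideal_graded K : binomial_ideal K -> class_graded K.
Proof.
move=> bK C clC; case: (bK) => G _ defK; apply: mproj_binomial_ideal => //.
by rewrite defK; apply: is_ideal_gen.
Qed.

Lemma mproj_class K w f : is_ideal K ->
  exists c : k, K (mproj [set z | mcong K z w] f - c *: 'X_[w]).
Proof.
move=> idK; rewrite /mproj; elim/big_ind: _ => [|g h [c Kg] [d Kh]|z].
- by exists 0; rewrite scale0r subr0; apply: ideal_0.
- by exists (c + d); rewrite scalerDl opprD addrACA; apply: idealD.
- case/asboolP=> c c0 Kc; exists (f@_z * c); rewrite -scalerA -scalerBr.
  exact: idealZ.
Qed.

(** [Q] need not be graded by the classes of [K]: if all class components of [f] were in [Q], so
    would be their sum [f]. Modulo [K] the component of a class is a scalar multiple of any of its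
    monomials, hence [w] is outside [Q] as well. *)
Lemma class_detect K Q f : is_ideal K -> is_ideal Q -> K `<=` Q -> ~ Q f ->
  exists w, [/\ w \in msupp f, ~ Q 'X_[w] & ~ Q (mproj [set z | mcong K z w] f)].
Proof.
move=> idK idQ KQ; move: {2}(size (msupp f)) (leqnn (size (msupp f))) => s.
elim: s f => [|s IH] f szf nQf.
  case: nQf; move: szf; rewrite leqn0 size_eq0 => /eqP/msuppnil0->.
  exact: ideal_0.
have [f0|/mlead_supp wf] := eqVneq f 0; first by case: nQf; rewrite f0; apply: ideal_0.
set w := mlead f in wf; pose Cw := [set z | mcong K z w].
have [Qw|nQw] := pselect (Q (mproj Cw f)); last first.
  exists w; split=> // Qw; apply: nQw.
  have [c /KQ Kc] := mproj_class w f idK.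
  by rewrite -(subrK (c *: 'X_[w]) (mproj _ f)); apply: idealD => //; apply: idealZ.
have nQf' : ~ Q (mproj (~` Cw) f).
  by move=> Qf'; apply: nQf; rewrite (mproj_setC Cw f); apply: idealD.
have subf z : z \in msupp (mproj (~` Cw) f) -> z \in msupp f /\ ~ Cw z.
  rewrite !mcoeff_msupp mcoeff_mproj.
  by case: ifP => [/asboolP|]; rewrite ?eqxx.
have szf' : (size (msupp (mproj (~` Cw) f)) <= s)%N.
  rewrite -ltnS; apply: leq_trans szf.
  have /= := @uniq_leq_size _ (w :: msupp (mproj (~` Cw) f)) (msupp f).
  apply; first rewrite /= msupp_uniq andbT.
    by apply/negP => /subf[_]; apply; apply: mcong_refl.
  by move=> z; rewrite inE => /predU1P[->//|/subf[]].
have [w' [w'f' nQw' nQp]] := IH _ szf' nQf'.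
have [w'f nw'] := subf _ w'f'.
exists w'; split=> //; move: nQp; rewrite mproj_mproj.
rewrite (@eq_mproj _ [set z | mcong K z w']) // => z _; split=> [[]//|zw'].
split=> // zw; apply: nw'; apply: mcong_trans zw => //.
exact: mcong_sym.
Qed.

End Projection.

(** * Exponents, lattices and partial characters *)

Section Exponents.
Variable n : nat.
Implicit Types (Delta : {set 'I_n}) (L : set 'rV[int]_n).
Implicit Types (a b t u v w : 'X_{1..n}) (x y : 'rV[int]_n).

Lemma NDelta0 Delta : NDelta Delta 0%MM.
Proof. by move=> i _; rewrite mnm0E. Qed.

Lemma NDeltaD Delta u v : NDelta Delta u -> NDelta Delta v -> NDelta Delta (u + v)%MM.
Proof. by move=> Nu Nv i iD; rewrite mnmDE Nu ?Nv. Qed.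

Lemma NDeltaDl Delta u v : NDelta Delta (u + v)%MM -> NDelta Delta u.
Proof. by move=> Nuv i /Nuv; rewrite mnmDE => /eqP; rewrite addn_eq0 => /andP[/eqP]. Qed.

Lemma NDeltaMn Delta u N : NDelta Delta u -> NDelta Delta (u *+ N)%MM.
Proof. by move=> Nu i iD; rewrite mulmnE Nu. Qed.

Lemma NDelta_mono Delta u v : (u <= v)%MM -> NDelta Delta v -> NDelta Delta u.
Proof. by move=> /submK <-; rewrite addmC; apply: NDeltaDl. Qed.

Lemma mdiffE u v i : mdiff u v 0 i = (u i)%:Z - (v i)%:Z.
Proof. by rewrite mxE. Qed.

Lemma mdiffxx u : mdiff u u = 0.
Proof. by apply/rowP => i; rewrite mdiffE mxE subrr. Qed.

Lemma mdiffN u v : - mdiff u v = mdiff v u.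
Proof. by apply/rowP => i; rewrite mxE !mdiffE opprB. Qed.

Lemma mdiffD u v u' v' : mdiff (u + u')%MM (v + v')%MM = mdiff u v + mdiff u' v'.
Proof. by apply/rowP => i; rewrite !mxE !mnmDE; lia. Qed.

Lemma mdiff_trans v u w : mdiff u v + mdiff v w = mdiff u w.
Proof. by apply/rowP => i; rewrite !mxE; lia. Qed.

Lemma mdiff_add2l t u v : mdiff (t + u)%MM (t + v)%MM = mdiff u v.
Proof. by rewrite mdiffD mdiffxx add0r. Qed.

Lemma mdiff_eq u v u' v' : mdiff u v = mdiff u' v' -> (u + v' = u' + v)%MM.
Proof.
move=> /rowP E; apply/mnmP => i; have := E i; rewrite !mdiffE !mnmDE.
lia.
Qed.

Lemma mdiff_ZDelta Delta u v :
  NDelta Delta u -> NDelta Delta v -> ZDelta Delta (mdiff u v).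
Proof. by move=> Nu Nv i iD; rewrite mdiffE Nu ?Nv. Qed.

Definition pos_part x : 'X_{1..n} :=
  [multinom (if (0 <= x 0%R i)%R then `|x 0%R i|%N else 0%N) | i < n].

Lemma pos_partK x : mdiff (pos_part x) (pos_part (- x)) = x.
Proof.
apply/rowP => i; rewrite mdiffE !mnmE mxE; move: (x 0 i) => z.
by case: (lerP 0 z); case: (lerP 0 (- z)); lia. Qed.

Lemma NDelta_pos_part Delta x : ZDelta Delta x -> NDelta Delta (pos_part x).
Proof. by move=> Zx i iD; rewrite mnmE Zx. Qed.

Lemma ZDeltaN Delta x : ZDelta Delta x -> ZDelta Delta (- x).
Proof. by move=> Zx i iD; rewrite mxE Zx. Qed.

Lemma ZDeltaP Delta x : ZDelta Delta x ->
  exists a b, [/\ NDelta Delta a, NDelta Delta b & x = mdiff a b].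
Proof.
move=> Zx; exists (pos_part x), (pos_part (- x)).
by rewrite pos_partK; split=> //; apply: NDelta_pos_part => //; apply: ZDeltaN.
Qed.

Lemma lattice0 L : is_lattice L -> L 0.
Proof. by case=> /set_mem. Qed.

Lemma latticeB L x y : is_lattice L -> L x -> L y -> L (x - y).
Proof. by case=> _ LB Lx Ly; apply/set_mem/LB; apply/mem_set. Qed.

Lemma latticeN L x : is_lattice L -> L x -> L (- x).
Proof. by move=> latL Lx; rewrite -sub0r; apply: latticeB => //; apply: lattice0. Qed.

Lemma latticeD L x y : is_lattice L -> L x -> L y -> L (x + y).
Proof.
by move=> latL Lx Ly; rewrite -[y]opprK; apply: latticeB => //; apply: latticeN.
Qed.

Lemma latticeMn L x N : is_lattice L -> L x -> L (x *+ N).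
Proof.
move=> latL Lx; elim: N => [|N IH]; first by rewrite mulr0n; apply: lattice0.
by rewrite mulrS; apply: latticeD.
Qed.

Lemma latticeMz L x (N : int) : is_lattice L -> L x -> L (x *~ N).
Proof.
move=> latL Lx; case: N => N; first by rewrite -pmulrn; apply: latticeMn.
by rewrite NegzE mulrNz; apply: latticeN => //; rewrite -pmulrn; apply: latticeMn.
Qed.

Lemma is_latticeI L : L 0 -> (forall x y, L x -> L y -> L (x - y)) -> is_lattice L.
Proof.
move=> L0 LB; split; first exact/mem_set.
by move=> x y /set_mem Lx /set_mem Ly; apply/mem_set/LB.
Qed.

Definition Delta_vec Delta : 'X_{1..n} := (\sum_(i in Delta) U_(i))%MM.

Lemma Delta_vecE Delta i : Delta_vec Delta i = (i \in Delta).
Proof.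
rewrite /Delta_vec mnm_sumE (eq_bigr (fun j => (j == i : nat))); last first.
  by move=> j _; rewrite mnm1E.
have [iD|iD] := boolP (i \in Delta); last first.
  by rewrite big1 // => j jD; case: eqVneq iD => // <-; rewrite jD.
rewrite (bigD1 i) //= eqxx big1 // => j /andP[_ /negPf->] //.
Qed.

Lemma NDelta_Delta_vec Delta N : NDelta Delta (Delta_vec Delta *+ N)%MM.
Proof. by apply: NDeltaMn => i; rewrite Delta_vecE => /negPf->. Qed.

Lemma NDelta_le Delta u : NDelta Delta u -> (u <= Delta_vec Delta *+ mdeg u)%MM.
Proof.
move=> Nu; apply/mnm_lepP => i; rewrite mulmnE Delta_vecE.
have [iD|/Nu->//] := boolP (i \in Delta).
by rewrite mul1n mdegE (bigD1 i) //= leq_addr.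
Qed.

End Exponents.

Section PartialCharacters.
Variables (k : fieldType) (n : nat) (Delta : {set 'I_n}).
Implicit Types (rho tau : partial_char k Delta) (x y : 'rV[int]_n).
Implicit Types (a b t u v w z : 'X_{1..n}) (f g : {mpoly k[n]}).
Implicit Types (I K : set {mpoly k[n]}) (C : set 'X_{1..n}).

Local Notation N := (NDelta Delta).

Lemma pc_lat0 rho : pc_lat rho 0.
Proof. exact: (lattice0 (pc_lattice rho)). Qed.

Lemma pc_latN rho x : pc_lat rho x -> pc_lat rho (- x).
Proof. exact: (latticeN (pc_lattice rho)). Qed.

Lemma pc_latD rho x y : pc_lat rho x -> pc_lat rho y -> pc_lat rho (x + y).
Proof. exact: (latticeD (pc_lattice rho)). Qed.

Lemma pc_lat_mdiffC rho u v : pc_lat rho (mdiff u v) -> pc_lat rho (mdiff v u).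
Proof. by move=> /pc_latN; rewrite mdiffN. Qed.

Lemma pc_val0 rho : pc_val rho 0 = 1.
Proof.
have := pc_mul (pc_lat0 rho) (pc_lat0 rho); rewrite addr0 => E.
by apply: (mulfI (pc_unit (pc_lat0 rho))); rewrite -E mulr1.
Qed.

Lemma polyNX u : N u -> polyN Delta ('X_[u] : {mpoly k[n]}).
Proof. by move=> Nu m; rewrite msuppX inE => /eqP->. Qed.

Lemma polyN0 : polyN Delta (0 : {mpoly k[n]}).
Proof. by move=> m; rewrite msupp0. Qed.

Lemma polyN1 : polyN Delta (1 : {mpoly k[n]}).
Proof. by rewrite -mpolyX0; apply: polyNX; apply: NDelta0. Qed.

Lemma polyND f g : polyN Delta f -> polyN Delta g -> polyN Delta (f + g).
Proof. by move=> Nf Ng m /msuppD_le; rewrite mem_cat => /orP[/Nf|/Ng]. Qed.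

Lemma polyNM f g : polyN Delta f -> polyN Delta g -> polyN Delta (f * g).
Proof.
move=> Nf Ng m /msuppM_le/allpairsP[[u v] /= [/Nf Nu /Ng Nv ->]].
exact: NDeltaD.
Qed.

Lemma polyNZ c f : polyN Delta f -> polyN Delta (c *: f).
Proof. by move=> Nf m /msuppZ_le/Nf. Qed.

Lemma polyN_sum (T : eqType) (s : seq T) (F : T -> {mpoly k[n]}) :
  (forall i, i \in s -> polyN Delta (F i)) -> polyN Delta (\sum_(i <- s) F i).
Proof.
move=> NF; rewrite big_seq; apply: (big_ind (polyN Delta)) => //.
  exact: polyN0.
by move=> ? ?; apply: polyND.
Qed.

Lemma lattice_binomials_sub rho : lattice_binomials rho `<=` lattice_ideal rho.
Proof. by move=> f Bf; rewrite -[f]mul1r; apply: mem_ideal_gen_in => //; apply: polyN1. Qed.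

Lemma lattice_ideal_polyN rho : lattice_ideal rho `<=` polyN Delta.
Proof.
apply: (ideal_gen_in_ind (P := polyN Delta)); [exact: polyN0|exact: polyND|].
move=> a _ Na [u [v [Nu Nv _ ->]]]; apply: polyNM => //.
by apply: polyND; [exact: polyNX|rewrite -scaleNr; apply/polyNZ/polyNX].
Qed.

Lemma lattice_ideal_extE rho : lattice_ideal_ext rho = ideal_gen (lattice_binomials rho).
Proof.
apply/seteqP; split; apply: ideal_gen_min; try exact: is_ideal_gen.
  apply: (ideal_gen_in_ind (P := ideal_gen _)).
  - exact: (ideal_0 (is_ideal_gen _)).
  - by move=> f g; apply: (idealD (is_ideal_gen _)).
  - by move=> a h _ Bh; apply: mem_ideal_gen_in.
move=> f /lattice_binomials_sub; apply: sub_ideal_gen.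
Qed.

Lemma is_ideal_lattice_ext rho : is_ideal (lattice_ideal_ext rho).
Proof. exact: is_ideal_gen. Qed.

Lemma lattice_ideal_sub_ext rho : lattice_ideal rho `<=` lattice_ideal_ext rho.
Proof. exact: sub_ideal_gen. Qed.

Lemma lattice_ext_min rho K : is_ideal K ->
  lattice_binomials rho `<=` K -> lattice_ideal_ext rho `<=` K.
Proof. by move=> idK; rewrite lattice_ideal_extE; apply: ideal_gen_min. Qed.

Lemma lattice_binomialsX rho u v : N u -> N v -> pc_lat rho (mdiff u v) ->
  lattice_binomials rho ('X_[u] - pc_val rho (mdiff u v) *: 'X_[v]).
Proof. by move=> Nu Nv Luv; exists u, v. Qed.

Definition shift_closed rho C := forall t u v, N u -> N v ->
  pc_lat rho (mdiff u v) -> C (t + u)%MM -> C (t + v)%MM.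

Lemma mproj_lattice_ext rho C K : is_ideal K -> lattice_ideal_ext rho `<=` K ->
  shift_closed rho C -> forall f, lattice_ideal_ext rho f -> K (mproj C f).
Proof.
move=> idK extK clC f; rewrite lattice_ideal_extE; apply: mprojM_gen => //.
move=> _ t [u [v [Nu Nv Luv ->]]].
rewrite mulrBl -scalerAl -!mpolyXD mprojD mprojN mprojZ !mprojX.
have -> : `[< C (u + t)%MM >] = `[< C (v + t)%MM >].
  rewrite ![(_ + t)%MM]addmC; apply/asbool_equiv_eq; split; apply: clC => //.
  exact: pc_lat_mdiffC.
case: ifP => _; last by rewrite scaler0 subr0; apply: ideal_0.
rewrite !mpolyXD scalerAl -mulrBl; apply: ideal_mulr => //; apply: extK.
exact/lattice_ideal_sub_ext/lattice_binomials_sub/lattice_binomialsX.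
Qed.

(** Projecting to the monomials of [k[N^Delta]] only truncates the coefficients of the lattice
    binomials, so the extension to [k[x]] contracts back to the lattice ideal. *)
Lemma mproj_polyN_lattice_ext rho f :
  lattice_ideal_ext rho f -> lattice_ideal rho (mproj N f).
Proof.
rewrite lattice_ideal_extE.
apply: (ideal_gen_in_ind (P := fun f => lattice_ideal rho (mproj N f))).
- by rewrite mproj0; apply: ideal_gen_in0.
- by move=> g h Hg Hh; rewrite mprojD; apply: ideal_gen_inD.
move=> a h _ Bh; rewrite [a]mpolyE mulr_suml mproj_sum.
apply: (big_ind (lattice_ideal rho)); first exact: ideal_gen_in0.
  by move=> ? ?; apply: ideal_gen_inD.
move=> t _; rewrite -scalerAl mprojZ mulrC mproj_mulX scalerAr mulrC.
have [Nt|Nt] := pselect (N t); last first.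
  rewrite mproj_eq0 ?mulr0; first exact: ideal_gen_in0.
  by move=> z _ /= /NDeltaDl.
rewrite mproj_id; last first.
  move=> z /(lattice_ideal_polyN (lattice_binomials_sub Bh)) Nz.
  exact: NDeltaD.
by apply: mem_ideal_gen_in => //; apply/polyNZ/polyNX.
Qed.

Lemma lattice_ext_polyN rho f :
  lattice_ideal_ext rho f -> polyN Delta f -> lattice_ideal rho f.
Proof. by move=> /mproj_polyN_lattice_ext + Nf; rewrite mproj_id. Qed.

Let weighted_sum (F : 'X_{1..n} -> k) f := \sum_(z <- msupp f) f@_z * F z.

Let weighted_sumE F f s : uniq s -> {subset msupp f <= s} ->
  weighted_sum F f = \sum_(z <- s) f@_z * F z.
Proof.
move=> us fs; rewrite (bigID (mem (msupp f))) /=.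
rewrite [X in _ + X]big1 => [|z /memN_msupp_eq0->]; last first.
  by rewrite mul0r.
rewrite addr0 -big_filter; apply: perm_big; apply: uniq_perm.
- exact: msupp_uniq.
- exact: filter_uniq.
by move=> z; rewrite mem_filter; have [/fs->|] := boolP (z \in msupp f).
Qed.

Let weighted_sumD F f g : weighted_sum F (f + g) = weighted_sum F f + weighted_sum F g.
Proof.
pose s := undup (msupp f ++ msupp g).
rewrite !(@weighted_sumE F _ s) ?undup_uniq //.
- by rewrite -big_split; apply: eq_bigr => z _; rewrite mcoeffD mulrDl.
- by move=> z zg; rewrite mem_undup mem_cat zg orbT.
- by move=> z zg; rewrite mem_undup mem_cat zg.
- by move=> z /msuppD_le; rewrite mem_undup.
Qed.

Let weighted_sumZ F c f : weighted_sum F (c *: f) = c * weighted_sum F f.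
Proof.
rewrite (@weighted_sumE F _ (msupp f)) ?msupp_uniq //; last exact: msuppZ_le.
by rewrite mulr_sumr; apply: eq_bigr => z _; rewrite mcoeffZ mulrA.
Qed.

Let weighted_sumX F u : weighted_sum F 'X_[u] = F u.
Proof. by rewrite /weighted_sum msuppX big_seq1 mcoeffX eqxx mul1r. Qed.

(* The linear form sending [x^(u + s)] to [rho s] for [s] in the lattice, and all
   other monomials to [0], kills the ideal. *)
Lemma lattice_ext_monomial rho u : ~ lattice_ideal_ext rho 'X_[u].
Proof.
pose F z := if `[< pc_lat rho (mdiff z u) >] then pc_val rho (mdiff z u) else 0.
suff F0 f : lattice_ideal_ext rho f -> weighted_sum F f = 0.
  move=> /F0; rewrite weighted_sumX /F mdiffxx asboolT ?pc_val0; last exact: pc_lat0.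
  by move/eqP; rewrite oner_eq0.
have sum0 : weighted_sum F 0 = 0 by rewrite /weighted_sum msupp0 big_nil.
rewrite lattice_ideal_extE.
apply: (ideal_gen_in_ind (P := fun f => weighted_sum F f = 0)) => //.
  by move=> g h g0 h0; rewrite weighted_sumD g0 h0 addr0.
move=> a _ _ [v [w [Nv Nw Lvw ->]]]; rewrite [a]mpolyE mulr_suml.
rewrite (big_morph _ (weighted_sumD F) sum0) big1 // => t _.
rewrite -scalerAl weighted_sumZ mulrBr -scalerAr -!mpolyXD.
rewrite weighted_sumD -scaleNr weighted_sumZ !weighted_sumX /F.
have E : mdiff (t + v)%MM u = mdiff v w + mdiff (t + w)%MM u.
  by rewrite -[mdiff v w](mdiff_add2l t) mdiff_trans.
case: ifPn => /asboolP Lv; case: ifPn => /asboolP Lw.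
- by rewrite E pc_mul // mulNr subrr mulr0.
- case: Lw; have -> : mdiff (t + w)%MM u = - mdiff v w + mdiff (t + v)%MM u.
    by rewrite E addKr.
  by apply: pc_latD => //; apply: pc_latN.
- by case: Lv; rewrite E; apply: pc_latD.
- by rewrite mulr0 addr0 mulr0.
Qed.

End PartialCharacters.

Lemma addmCA n : left_commutative (@mnm_add n).
Proof. by move=> u v w; rewrite !addmA [(u + v)%MM]addmC. Qed.

(** * Saturation in the variables of Delta *)

Section Saturation.
Variables (k : fieldType) (n : nat) (Delta : {set 'I_n}).
Implicit Types (rho sigma tau : partial_char k Delta) (x y : 'rV[int]_n).
Implicit Types (a b t u v w z : 'X_{1..n}) (f g : {mpoly k[n]}).
Implicit Types (I K : set {mpoly k[n]}) (C : set 'X_{1..n}).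

Local Notation N := (NDelta Delta).

Definition saturated K := forall f u, N u -> K (f * 'X_[u]) -> K f.

Lemma cellular_saturated I : cellular Delta I -> saturated I.
Proof.
case=> _ _ nzd _ f u; move: {2}(mdeg u) (erefl (mdeg u)) => d.
elim: d u => [|d IH] u.
  by move=> /eqP; rewrite mdeg_eq0 => /eqP-> _; rewrite mpolyX0 mulr1.
move=> du Nu; have [i ui] : exists i, u i != 0%N.
  apply: contrapT => /forallNP u0; suff u00 : u = 0%MM by rewrite u00 mdeg0 in du.
  by apply/mnmP => i; rewrite mnm0E; apply/eqP/negPn/negP/u0.
have iD : i \in Delta by apply: contraNT ui => /Nu->.
have lu : (U_(i) <= u)%MM by rewrite lep1mP.
rewrite -(submK lu) mpolyXD mulrA mulrC => /(nzd i iD); apply: IH.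
  by move: du; rewrite -{1}(submK lu) mdegD mdeg1 addn1 => -[].
by apply: NDelta_mono Nu; apply: lem_subr.
Qed.

Lemma saturated_mcong K t z w : saturated K -> N t ->
  mcong K (t + z)%MM (t + w)%MM -> mcong K z w.
Proof.
move=> satK Nt [c c0 Kc]; exists c => //; apply: (satK _ t Nt).
by rewrite mulrBl -scalerAl -!mpolyXD ![(_ + t)%MM]addmC.
Qed.

Lemma saturated_mono K t z : saturated K -> N t -> K 'X_[t + z] -> K 'X_[z].
Proof. by move=> satK Nt; rewrite mpolyXD mulrC; apply: satK. Qed.

Lemma prod_Delta N0 : (\prod_(i in Delta) 'X_i) ^+ N0 =
  'X_[Delta_vec Delta *+ N0] :> {mpoly k[n]}.
Proof. by rewrite mprodXE mpolyXn. Qed.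

Local Notation sum_ext I rho := (ideal_add I (lattice_ideal_ext rho)).

Lemma is_ideal_sum_ext I rho : is_ideal I -> is_ideal (sum_ext I rho).
Proof. by move=> idI; apply: is_ideal_add => //; apply: is_ideal_lattice_ext. Qed.

Lemma is_ideal_sat_sum I rho : is_ideal I -> is_ideal (sat_sum I rho).
Proof. by move=> idI; apply/is_ideal_sat/is_ideal_sum_ext. Qed.

Lemma sat_sumP I rho f : is_ideal I ->
  sat_sum I rho f <-> exists2 u, N u & sum_ext I rho (f * 'X_[u]).
Proof.
move=> idI; split=> [[M]|[u Nu If]].
  by rewrite prod_Delta => If; exists (Delta_vec Delta *+ M)%MM => //; apply: NDelta_Delta_vec.
exists (mdeg u); rewrite prod_Delta -(submK (NDelta_le Nu)) addmC mpolyXD mulrA.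
by apply: ideal_mulr => //; apply: is_ideal_sum_ext.
Qed.

Lemma sub_sat_sum I rho : is_ideal I -> I `<=` sat_sum I rho.
Proof.
move=> idI f If; apply: sub_ideal_sat; apply: sub_ideal_addl => //.
exact: is_ideal_lattice_ext.
Qed.

Lemma ext_sub_sat_sum I rho : is_ideal I -> lattice_ideal_ext rho `<=` sat_sum I rho.
Proof. by move=> idI f If; apply: sub_ideal_sat; apply: sub_ideal_addr. Qed.

Lemma sat_sum_saturated I rho : is_ideal I -> saturated (sat_sum I rho).
Proof.
move=> idI f u Nu /sat_sumP[//|v Nv Kf]; apply/sat_sumP => //.
by exists (u + v)%MM; [exact: NDeltaD|rewrite mpolyXD mulrA].
Qed.

Lemma sat_sum_min I rho K : is_ideal K -> saturated K -> I `<=` K ->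
  lattice_ideal rho `<=` K -> sat_sum I rho `<=` K.
Proof.
move=> idK satK IK rK f [M]; rewrite prod_Delta => -[g Ig [h Hh E]].
apply: (satK _ (Delta_vec Delta *+ M)%MM); first exact: NDelta_Delta_vec.
rewrite E; apply: idealD => //; first exact: IK.
by apply: lattice_ext_min Hh => // b /lattice_binomials_sub; apply: rK.
Qed.

Lemma mproj_sum_ext I rho C : is_ideal I -> class_graded I -> mcong_closed I C ->
  shift_closed rho C -> forall f, sum_ext I rho f -> sum_ext I rho (mproj C f).
Proof.
move=> idI grI clC shC _ [f If [g Hg ->]]; rewrite mprojD.
apply: idealD; first exact: is_ideal_sum_ext.
  by apply: sub_ideal_addl; [exact: is_ideal_lattice_ext|exact: grI].
apply: mproj_lattice_ext Hg => //; first exact: is_ideal_sum_ext.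
exact: sub_ideal_addr.
Qed.

(** After multiplication by ['X_[u]], the set [C] is replaced by the exponents congruent to some
    [u + z] modulo [K] with [z] in [C]. Congruences modulo [I] and translations by the lattice of
    [rho] are both congruences modulo [K], so this set satisfies the two closure conditions of
    [mproj_sum_ext]. *)
Lemma sat_sum_graded I rho : is_ideal I -> class_graded I -> class_graded (sat_sum I rho).
Proof.
move=> idI grI C clC f; set K := sat_sum I rho in clC *.
have idK : is_ideal K by apply: is_ideal_sat_sum.
have satK : saturated K by apply: sat_sum_saturated.
have IK : I `<=` K by apply: sub_sat_sum.
case/sat_sumP => // u Nu Kf; apply/sat_sumP => //; exists u => //.
pose C' := [set z' | exists2 z, C z & mcong K z' (u + z)%MM].
have clC' : mcong_closed K C'.
  move=> z w zw [y Cy zy]; exists y => //; apply: mcong_trans zy => //.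
  exact: mcong_sym.
have -> : mproj C f = mproj [set z | C' (u + z)%MM] f.
  apply: eq_mproj => z _; split=> [Cz|[y Cy /saturated_mcong zy]].
    by exists z => //; apply: mcong_refl.
  by apply: clC Cy; apply: mcong_sym => //; apply: zy.
rewrite -mproj_mulX; apply: mproj_sum_ext => //.
  by move=> z w /(mcong_sub IK); apply: clC'.
move=> t v w Nv Nw Lvw; apply: clC'; rewrite addmC [(t + w)%MM]addmC.
rewrite ![(_ + t)%MM]addmC; apply: mcong_add => //.
exists (pc_val rho (mdiff v w)); first exact: pc_unit.
apply: ext_sub_sat_sum => //.
exact/lattice_ideal_sub_ext/lattice_binomials_sub/lattice_binomialsX.
Qed.

(** Outside the class of the monomials of [sat_sum I rho], its congruence is generated by that of
    [I] and by lattice translations. The set [C] of exponents reached in this way from [w + u] is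
    closed under both; if it missed [z + u], projecting the binomial to [C] would leave only a
    multiple of ['X_[w + u]]. *)
Lemma sat_sum_mcong I rho z w : is_ideal I -> saturated I -> class_graded I ->
    ~ sat_sum I rho 'X_[w] -> mcong (sat_sum I rho) z w ->
  exists t t', [/\ N t, N t', pc_lat rho (mdiff t t') & mcong I (t' + z)%MM (t + w)%MM].
Proof.
move=> idI satI grI nKw [c c0] /sat_sumP[//|u Nu].
rewrite mulrBl -scalerAl -!mpolyXD => Kb.
pose C := [set y | exists t t', [/\ N t, N t', pc_lat rho (mdiff t t') &
  mcong I (t' + y)%MM (t + (w + u))%MM]].
have clC : mcong_closed I C.
  move=> y y' yy' [t [t' [Nt Nt' Ltt' yw]]]; exists t, t'; split=> //.
  by apply: mcong_trans yw => //; apply: mcong_add => //; apply: mcong_sym.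
have shC : shift_closed rho C.
  move=> s a b Na Nb Lab [t [t' [Nt Nt' Ltt' yw]]].
  exists (b + t)%MM, (a + t')%MM; split; try exact: NDeltaD.
    by rewrite mdiffD; apply: pc_latD => //; apply: pc_lat_mdiffC.
  have -> : (a + t' + (s + b) = b + (t' + (s + a)))%MM.
    by apply/mnmP => i; rewrite !mnmDE; lia.
  by rewrite -addmA; apply: mcong_add.
have Cw : C (w + u)%MM.
  exists 0%MM, 0%MM; rewrite mdiffxx; split; try exact: NDelta0.
    exact: pc_lat0.
  exact: mcong_refl.
have [[t [t' [Nt Nt' Ltt' zw]]]|nCz] := pselect (C (z + u)%MM).
  exists t, t'; split=> //; apply: (saturated_mcong satI Nu).
  by rewrite ![(u + _)%MM]addmC -!addmA.
case: nKw; apply/sat_sumP => //; exists u => //.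
have idK := is_ideal_sum_ext rho idI.
have := mproj_sum_ext idI grI clC shC Kb.
rewrite mprojD mprojN mprojZ !mprojX asboolF // asboolT // sub0r => /(idealN idK).
by rewrite opprK -mpolyXD => /(idealZI idK c0).
Qed.

Lemma sat_sum_mproj I rho w f : is_ideal I -> saturated I -> class_graded I ->
    (forall e : {mpoly k[n]}, lattice_binomials rho e -> I (e * 'X_[w])) -> sat_sum I rho f ->
  I (mproj [set z | mcong I z w] f).
Proof.
move=> idI satI grI bI /sat_sumP[//|u Nu [f1 If1 [f2 ef2 E]]].
pose C := [set z | mcong I z (u + w)%MM].
have clC : mcong_closed I C by apply: mcong_closed_class.
apply: (satI _ u Nu).
have -> : mproj [set z | mcong I z w] f = mproj [set z | C (u + z)%MM] f.
  by apply: eq_mproj => z _; split; [exact: mcong_add|exact: saturated_mcong].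
rewrite -mproj_mulX E mprojD; apply: idealD => //; first exact: grI.
move: ef2; rewrite lattice_ideal_extE; apply: mprojM_gen => //.
(* If one exponent of [b * 'X_[t]] is in the class of [u + w], then ['X_[a] * b * 'X_[t]] is a
   multiple of [b * 'X_[w]] modulo [I], and ['X_[a]] cancels. So either the product is in [I] or its
   projection is zero. *)
move=> b t Bb; have bIt a : N a -> C (a + t)%MM -> I (b * 'X_[t]).
  move=> Na [c c0 Ic]; apply: (satI _ a Na); rewrite -mulrA -mpolyXD addmC.
  rewrite -(subrK (c *: 'X_[u + w]) 'X_[a + t]) mulrDr; apply: idealD => //.
    exact: ideal_mull.
  rewrite -scalerAr; apply: idealZ => //; rewrite mpolyXD mulrCA.
  by apply: ideal_mull => //; apply: bI.
case: (Bb) => [a [a' [Na Na' Laa' defb]]].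
have [Ibt|nIbt] := pselect (I (b * 'X_[t])); first exact: grI.
have nC c : N c -> ~ C (c + t)%MM by move=> Nc /(bIt _ Nc).
rewrite defb mulrBl -scalerAl -!mpolyXD mprojD mprojN mprojZ !mprojX.
rewrite !asboolF; try exact: nC.
by rewrite scaler0 subr0; apply: ideal_0.
Qed.

(** * The partial character of a monomial *)

Section Witness.
Variables (K : set {mpoly k[n]}) (w : 'X_{1..n}).
Hypotheses (idK : is_ideal K) (satK : saturated K) (nKw : ~ K 'X_[w]).

Lemma saturated_nmono a : N a -> ~ K 'X_[w + a].
Proof. by move=> Na; rewrite addmC => /saturated_mono => /(_ satK Na). Qed.

Lemma scalar_uniq a b c d : N b -> K ('X_[w + a] - c *: 'X_[w + b]) ->
  K ('X_[w + a] - d *: 'X_[w + b]) -> c = d.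
Proof.
move=> Nb Kc Kd; apply/eqP; rewrite -subr_eq0; apply: contrapT => /negP cd.
apply: (saturated_nmono Nb); apply: (idealZI idK cd).
by have := idealB idK Kd Kc; rewrite opprB addrC addrA subrK -scalerBl.
Qed.

(** The character [tau] is read off the congruences between multiples of ['X_[w]]. If [a - b] were
    outside its lattice, projecting ['X_[a] - c *: 'X_[b]] to the coset of [a] would leave the
    monomial ['X_[a]] in the colon ideal. *)
Lemma lattice_ideal_witness tau :
    ideal_colon K 'X_[w] `&` polyN Delta = lattice_ideal tau ->
  (forall a b c, N a -> N b -> c != 0 -> K ('X_[w + a] - c *: 'X_[w + b]) ->
     pc_lat tau (mdiff a b) /\ pc_val tau (mdiff a b) = c) /\
  (forall a b, N a -> N b -> pc_lat tau (mdiff a b) ->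
     K ('X_[w + a] - pc_val tau (mdiff a b) *: 'X_[w + b])).
Proof.
move=> defT.
have idC := is_ideal_colon 'X_[w] idK.
have TC : lattice_ideal_ext tau `<=` ideal_colon K 'X_[w].
  apply: lattice_ext_min => // f /lattice_binomials_sub.
  by rewrite -defT => -[].
have second a b : N a -> N b -> pc_lat tau (mdiff a b) ->
    K ('X_[w + a] - pc_val tau (mdiff a b) *: 'X_[w + b]).
  move=> Na Nb Lab.
  have := TC _ (lattice_ideal_sub_ext (lattice_binomials_sub (lattice_binomialsX Na Nb Lab))).
  by rewrite /ideal_colon /= mulrBl -scalerAl -!mpolyXD ![(_ + w)%MM]addmC.
split=> // a b c Na Nb c0 Kab.
suff Lab : pc_lat tau (mdiff a b).
  by split=> //; apply: (scalar_uniq Nb (second _ _ Na Nb Lab) Kab).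
have tab : lattice_ideal_ext tau ('X_[a] - c *: 'X_[b]).
  apply: lattice_ideal_sub_ext; rewrite -defT; split.
    by rewrite /ideal_colon /= mulrBl -scalerAl -!mpolyXD ![(_ + w)%MM]addmC.
  by apply: polyND; [exact: polyNX|rewrite -scaleNr; apply/polyNZ/polyNX].
apply: contrapT => nLab; apply: (saturated_nmono Na).
rewrite mpolyXD mulrC.
have := @mproj_lattice_ext _ _ _ tau [set z | pc_lat tau (mdiff a z)] _ idC TC _ _ tab.
rewrite mprojD mprojN mprojZ !mprojX asboolT /=; last first.
  by rewrite mdiffxx; apply: pc_lat0.
rewrite asboolF // scaler0 subr0; apply.
move=> t u v Nu Nv Luv /= La; rewrite -(mdiff_trans (t + u)%MM).
by rewrite mdiff_add2l; apply: pc_latD.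
Qed.

Hypothesis grK : class_graded K.

Let coh c a b := K ('X_[w + a] - c *: 'X_[w + b]).

Let coh_eq c a b a' b' : N b -> (a + b' = a' + b)%MM -> coh c a b -> coh c a' b'.
Proof.
move=> Nb E; rewrite /coh => Kab; apply: (satK Nb).
rewrite mulrBl -scalerAl -!mpolyXD.
have -> : (w + a' + b = b' + (w + a))%MM by rewrite -addmA -E addmA addmC.
have -> : (w + b' + b = b' + (w + b))%MM by rewrite -addmA addmCA.
by rewrite !(mpolyXD _ b') scalerAr -mulrBr; apply: ideal_mull.
Qed.

Let coh_mul c d a b a' b' : coh c a b -> coh d a' b' -> coh (c * d) (a + a')%MM (b + b')%MM.
Proof.
rewrite /coh => Kab Ka'b'.
have -> : 'X_[w + (a + a')] - (c * d) *: 'X_[w + (b + b')] =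
  'X_[a'] * ('X_[w + a] - c *: 'X_[w + b]) +
  c *: ('X_[b] * ('X_[w + a'] - d *: 'X_[w + b'])) :> {mpoly k[n]}.
  rewrite !mulrBr !scalerBr -!scalerAr -!mpolyXD !scalerA.
  have -> : (a' + (w + a) = w + (a + a'))%MM by apply/mnmP => i; rewrite !mnmDE; lia.
  have -> : (a' + (w + b) = b + (w + a'))%MM by apply/mnmP => i; rewrite !mnmDE; lia.
  have -> : (b + (w + b') = w + (b + b'))%MM by apply/mnmP => i; rewrite !mnmDE; lia.
  by rewrite addrA subrK.
by apply: idealD => //; [exact: ideal_mull|apply: idealZ => //; apply: ideal_mull].
Qed.

Let coh_sym c a b : c != 0 -> coh c a b -> coh c^-1 b a.
Proof.
rewrite /coh => c0 Kab; apply: (idealZI idK (_ : - c != 0)); first by rewrite oppr_eq0.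
by rewrite scalerBr scalerA mulNr mulfV // !scaleNr scale1r opprK addrC.
Qed.

(** The pair of positive and negative parts is a canonical way to write [x] as a difference;
    [coh_eq] carries the scalar to every other pair. By [scalar_uniq] at most one scalar qualifies,
    so [val] involves no real choice on [L]. *)
Let cand x : set k := [set c | c != 0 /\ coh c (pos_part x) (pos_part (- x))].
Let L : set 'rV[int]_n := [set x | ZDelta Delta x /\ cand x !=set0].
Let val x := xget 0 (cand x).

Let candP a b c : N a -> N b -> c != 0 -> coh c a b -> cand (mdiff a b) c.
Proof.
move=> Na Nb c0 Kab; split=> //; apply: coh_eq Kab => //.
by apply: mdiff_eq; rewrite pos_partK.
Qed.

Let cand_coh a b c : N a -> N b -> cand (mdiff a b) c -> coh c a b.
Proof.
move=> Na Nb [c0]; apply: coh_eq.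
  by apply: NDelta_pos_part; apply: ZDeltaN; apply: mdiff_ZDelta.
by apply: mdiff_eq; rewrite pos_partK.
Qed.

Let LP a b : N a -> N b -> L (mdiff a b) -> cand (mdiff a b) (val (mdiff a b)).
Proof. by move=> Na Nb [_ [c candc]]; apply: xgetPex; exists c. Qed.

Let valE a b c : N a -> N b -> c != 0 -> coh c a b ->
  L (mdiff a b) /\ val (mdiff a b) = c.
Proof.
move=> Na Nb c0 Kab; have candc := candP Na Nb c0 Kab.
have Lab : L (mdiff a b) by split; [exact: mdiff_ZDelta|exists c].
split=> //; apply: (scalar_uniq Nb _ Kab).
by have /cand_coh := LP Na Nb Lab; apply.
Qed.

Let L_ZDelta : L `<=` ZDelta Delta.
Proof. by move=> x []. Qed.

Let mulL a b a' b' : N a -> N b -> N a' -> N b' -> L (mdiff a b) -> L (mdiff a' b') ->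
  L (mdiff a b + mdiff a' b') /\
  val (mdiff a b + mdiff a' b') = val (mdiff a b) * val (mdiff a' b').
Proof.
move=> Na Nb Na' Nb' /LP-/(_ Na Nb) c1 /LP-/(_ Na' Nb') c2; rewrite -mdiffD.
apply: valE; try exact: NDeltaD.
  by apply: mulf_neq0; [case: c1|case: c2].
by apply: coh_mul; apply: cand_coh.
Qed.

Let latL : is_lattice L.
Proof.
apply: is_latticeI => [|x y Lx Ly].
  have := @valE 0%MM 0%MM 1; rewrite mdiffxx; case; rewrite ?oner_eq0 //.
  - exact: NDelta0.
  - exact: NDelta0.
  - by rewrite /coh scale1r subrr; apply: ideal_0.
have [a [b [Na Nb xE]]] := ZDeltaP (L_ZDelta Lx).
have [a' [b' [Na' Nb' yE]]] := ZDeltaP (L_ZDelta Ly).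
rewrite xE in Lx *; rewrite yE in Ly *; rewrite mdiffN.
have cd := LP Na' Nb' Ly; have [c0 _] := cd.
apply: (mulL _ _ _ _ _ _).1 => //.
by apply: (valE _ _ _ (coh_sym c0 (cand_coh Na' Nb' cd))).1; rewrite // invr_eq0.
Qed.

Let val_unit x : L x -> val x != 0.
Proof. by case=> _ /(xgetPex 0)[]. Qed.

Let val_mul x y : L x -> L y -> val (x + y) = val x * val y.
Proof.
move=> Lx Ly.
have [a [b [Na Nb xE]]] := ZDeltaP (L_ZDelta Lx).
have [a' [b' [Na' Nb' yE]]] := ZDeltaP (L_ZDelta Ly).
by rewrite xE in Lx *; rewrite yE in Ly *; apply: (mulL _ _ _ _ _ _).2.
Qed.

(** For the hard inclusion, a class of [tau] in [k[N^Delta]], shifted by [w], is a class of [K]. As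
    [K] is graded, it contains the shifted component [p] of [f], which is [c *: 'X_[z]] modulo the
    lattice ideal; since ['X_[w + z]] is not in [K], the scalar [c] is zero. *)
Lemma witness_exists : exists tau : partial_char k Delta,
  ideal_colon K 'X_[w] `&` polyN Delta = lattice_ideal tau.
Proof.
pose tau := PartialChar latL L_ZDelta val_unit val_mul; exists tau.
have idC := is_ideal_colon 'X_[w] idK.
have TC : lattice_ideal_ext tau `<=` ideal_colon K 'X_[w].
  apply: lattice_ext_min => // _ [a [b [Na Nb /(LP Na Nb)/(cand_coh Na Nb) Lab ->]]].
  by rewrite /ideal_colon /= mulrBl -scalerAl -!mpolyXD ![(_ + w)%MM]addmC.
apply/seteqP; split=> [f [Kf Nf]|f Tf]; last first.
  split; last exact: lattice_ideal_polyN Tf.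
  exact/TC/lattice_ideal_sub_ext.
apply: lattice_ext_polyN => //; apply: contrapT => nTf.
have idT := is_ideal_lattice_ext tau.
have [z [zf _ nTp]] := class_detect idT idT (@subset_refl _ _) nTf.
have Nz := Nf _ zf.
have [c Tc] := mproj_class z f idT.
set p := mproj _ f in nTp Tc.
have Kp : K (p * 'X_[w]).
  have -> : p = mproj [set y | [set y' | mcong K y' (w + z)%MM] (w + y)%MM] f.
    apply: eq_mproj => y /Nf Ny /=; split=> [[d d0 Td]|[d d0 Kd]].
      exists d => //; have := TC _ Td.
      by rewrite /ideal_colon /= mulrBl -scalerAl -!mpolyXD ![(_ + w)%MM]addmC.
    exists d => //; have [Lyz valyz] := valE Ny Nz d0 Kd.
    apply/lattice_ideal_sub_ext/lattice_binomials_sub; exists y, z.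
    by split=> //=; rewrite valyz.
  by rewrite -mproj_mulX; apply: grK => //; apply: mcong_closed_class.
have : K (c *: 'X_[z] * 'X_[w]).
  have := idealB idK Kp (TC _ Tc).
  by rewrite -mulrBl opprB addrC subrK.
have [c0 _|c0] := eqVneq c 0.
  by apply: nTp; move: Tc; rewrite c0 scale0r subr0.
rewrite -scalerAl -mpolyXD addmC => /(idealZI idK c0).
exact: saturated_nmono.
Qed.

End Witness.

End Saturation.

(** * Rank, saturation and order of lattices *)

Section LatticeRank.
Variable n : nat.
Implicit Types (L S : set 'rV[int]_n) (x y : 'rV[int]_n) (Delta E : {set 'I_n}).

Lemma lattice_rank_ge L m (B : 'M[int]_(m, n)) : (forall i, L (row i B)) ->
  (\rank (ratmx B) <= lattice_rank L)%N.
Proof.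
move=> LB; have rn : (\rank (ratmx B) < n.+1)%N by rewrite ltnS rank_leq_col.
apply: (@leq_bigmax_cond _ _ (fun r : 'I_n.+1 => nat_of_ord r) (Ordinal rn)).
by apply/asboolP; exists m, B.
Qed.

Lemma lattice_rank_attained L : exists m (B : 'M[int]_(m, n)),
  (forall i, L (row i B)) /\ \rank (ratmx B) = lattice_rank L.
Proof.
rewrite /lattice_rank.
elim/big_ind: _ => [|r s [m [B [LB rB]]] [m' [B' [LB' rB']]]|r /asboolP//].
  by exists 0%N, 0; split=> [[]//|]; apply/eqP; rewrite -leqn0 rank_leq_row.
by case: (leqP r s) => _; [exists m', B'|exists m, B].
Qed.

Lemma ratmxE m (B : 'M[int]_(m, n)) i j : ratmx B i j = (B i j)%:~R.
Proof. by rewrite mxE. Qed.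

(** Saturation in the whole of Z^n, by integer multiples instead of rational spans; [SatP] relates
    it to [Sat]. *)
Definition rat_sat L : set 'rV[int]_n := [set x | exists2 N, (0 < N)%N & L (x *+ N)].

Lemma sub_rat_sat L : L `<=` rat_sat L.
Proof. by move=> x Lx; exists 1%N. Qed.

Lemma rat_satD L x y : is_lattice L -> rat_sat L x -> rat_sat L y -> rat_sat L (x + y).
Proof.
move=> latL [N N0 Lx] [M M0 Ly]; exists (N * M)%N; first by rewrite muln_gt0 N0.
rewrite mulrnDl; apply: latticeD => //; first by rewrite mulrnA; apply: latticeMn.
by rewrite mulnC mulrnA; apply: latticeMn.
Qed.

Lemma rat_satN L x : is_lattice L -> rat_sat L x -> rat_sat L (- x).
Proof. by move=> latL [N N0 Lx]; exists N => //; rewrite mulNrn; apply: latticeN. Qed.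

Lemma rat_sat_idem L : rat_sat (rat_sat L) `<=` rat_sat L.
Proof.
move=> x [N N0 [M M0 Lx]]; exists (N * M)%N; first by rewrite muln_gt0 N0.
by rewrite mulrnA.
Qed.

Lemma lattice_rank_sat L S : L `<=` rat_sat S -> (lattice_rank L <= lattice_rank S)%N.
Proof.
move=> LS; have [m [B [LB <-]]] := lattice_rank_attained L.
have /choice[N NP] i : exists N, (0 < N)%N /\ S (row i B *+ N).
  by have [N N0 SN] := LS _ (LB i); exists N.
pose B' : 'M[int]_(m, n) := \matrix_i (row i B *+ N i).
have -> : \rank (ratmx B) = \rank (ratmx B').
  have -> : ratmx B' = diag_mx (\row_i (N i)%:R) *m ratmx B.
    apply/matrixP => i j; rewrite mul_diag_mx [RHS]mxE !ratmxE mxE.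
    by rewrite mxE mulmxnE mxE rmorphMn /= mulr_natl.
  rewrite eqmxMfull // row_full_unit unitmxE det_diag unitfE.
  apply/prodf_neq0 => i _; rewrite mxE pnatr_eq0 -lt0n.
  by case: (NP i).
by apply: lattice_rank_ge => i; rewrite rowK; case: (NP i).
Qed.

Lemma lattice_rank_sub L S : L `<=` S -> (lattice_rank L <= lattice_rank S)%N.
Proof. by move=> LS; apply: lattice_rank_sat => x /LS; apply: sub_rat_sat. Qed.

Lemma ratmx_inj m : injective (@ratmx n m).
Proof.
move=> A B /matrixP AB; apply/matrixP => i j.
by have := AB i j; rewrite !mxE => /intr_inj.
Qed.

(** Denominators are cleared: [N] is the product of the denominators of the coefficients [D], and
    [e] lists the coefficients times [N]. *)
Lemma Qspan_rat_sat L m (B : 'M[int]_(m, n)) x : is_lattice L ->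
  (forall i, L (row i B)) -> (ratmx x <= ratmx B)%MS -> rat_sat L x.
Proof.
move=> latL LB /submxP[D xE].
pose d i := `|denq (D 0%R i)|%N; pose N := (\prod_i d i)%N.
pose e := \row_i (numq (D 0 i) *+ (\prod_(j | j != i) d j)%N).
have d0 i : (0 < d i)%N by rewrite absz_gt0 denq_neq0.
exists N; first by rewrite prodn_gt0.
suff -> : x *+ N = e *m B.
  rewrite mulmx_sum_row; apply: (big_ind L) => [|y z|i _].
  - exact: lattice0.
  - exact: latticeD.
  - by rewrite -[e 0 i]intz scaler_int; apply: latticeMz.
apply: ratmx_inj; rewrite /ratmx map_mxM /=.
have -> : map_mx intr (x *+ N) = ratmx x *+ N.
  by apply/matrixP => i j; rewrite !(mxE, mulmxnE) rmorphMn.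
rewrite xE -scaler_nat scalemxAl scaler_nat; congr (_ *m _).
apply/rowP => i; rewrite mulmxnE !mxE rmorphMn /=.
have -> : (numq (D 0 i))%:~R = D 0 i *+ d i.
  by rewrite -mulr_natr natr_absz gtr0_norm ?denq_gt0 // numqE.
by rewrite -mulrnA /N (bigD1 i).
Qed.

(** Appending a vector of [S] to rows of [L] of maximal rank cannot raise the rank, so the vector is
    in their rational span. *)
Lemma lattice_rank_le_sat L S : is_lattice L -> L `<=` S ->
  (lattice_rank S <= lattice_rank L)%N -> S `<=` rat_sat L.
Proof.
move=> latL LS rSL x Sx; have [m [B [LB rB]]] := lattice_rank_attained L.
apply: (Qspan_rat_sat latL LB).
have CE : ratmx (col_mx B x) = col_mx (ratmx B) (ratmx x) by rewrite /ratmx map_col_mx.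
have sub : (ratmx B <= ratmx (col_mx B x))%MS.
  by rewrite CE -addsmxE addsmxSl.
have rk : (\rank (ratmx (col_mx B x)) <= \rank (ratmx B))%N.
  rewrite rB; apply: leq_trans rSL; apply: lattice_rank_ge => i.
  rewrite -[i]splitK; case: (split i) => j /=.
    by rewrite rowKu; apply/LS/LB.
  by rewrite rowKd (_ : row j x = x) // [j]ord1 row_id.
have := (mxrank_leqif_sup sub).2; rewrite eqn_leq rk (mxrankS sub) => /esym.
by apply: submx_trans; rewrite CE -addsmxE addsmxSr.
Qed.

Lemma SatP Delta L x : is_lattice L ->
  Sat Delta L x <-> ZDelta Delta x /\ rat_sat L x.
Proof.
move=> latL; split=> [[[m [B [LB xB]]] Zx]|[Zx [N N0 Lx]]]; split=> //.
  exact: Qspan_rat_sat xB.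
exists 1%N, (x *+ N); split=> [i|]; first by rewrite [i]ord1 row_id.
have -> : ratmx (x *+ N) = N%:R *: ratmx x.
  by apply/matrixP => i j; rewrite !(mxE, mulmxnE) rmorphMn mulr_natl.
by rewrite eqmx_scale // pnatr_eq0 -lt0n.
Qed.

End LatticeRank.

(** * An order modulo the saturation of a lattice *)

Section LatticeOrder.
Variables (n : nat) (Delta : {set 'I_n}) (L : set 'rV[int]_n).
Hypothesis latL : is_lattice L.
Implicit Types (x y : 'rV[int]_n) (E : {set 'I_n}) (a b : 'X_{1..n}).

Lemma mdiffMn a b N : mdiff (a *+ N)%MM (b *+ N)%MM = mdiff a b *+ N.
Proof. by apply/rowP => i; rewrite mulmxnE !mdiffE !mulmnE; lia. Qed.

Lemma ltm_muln a b N : (a < b)%O -> (0 < N)%N -> ((a *+ N)%MM < (b *+ N)%MM)%O.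
Proof.
move=> ab; case: N => // N _; elim: N => [|N IH]; first by rewrite !mulm1n.
by rewrite mulmS [(b *+ _)%MM]mulmS; apply: ltm_add.
Qed.

(* The variables indexed by [E] form a transcendence basis modulo a lattice ideal
   of lattice [L]. *)
Definition lattice_complement E : Prop := [/\ E \subset Delta,
  (forall x, ZDelta E x -> L x -> x = 0) &
  forall i, i \in Delta -> exists N a b, [/\ (0 < N)%N, NDelta E a, NDelta E b &
    L (mdiff (U_(i) *+ N + b)%MM a)]].

(** [E] is a maximal subset of Delta with no nonzero vector of [L] supported on it. For [i] outside
    [E], maximality gives a vector of [L] on [i |: E] with nonzero coordinate at [i], which is the
    required relation once its sign is fixed. *)
Lemma lattice_complement_exists : exists E, lattice_complement E.
Proof.
pose P (E : {set 'I_n}) := (E \subset Delta) && `[< forall x, ZDelta E x -> L x -> x = 0 >].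
have P0 : P finset.set0.
  rewrite /P finset.sub0set; apply/asboolP => x Zx _; apply/rowP => i.
  by rewrite Zx ?inE // mxE.
have [E /maxsetP[/andP[ED /asboolP ZE] maxE] _] := maxset_exists P0.
exists E; split=> // i iD; have [iE|niE] := boolP (i \in E).
  exists 1%N, U_(i)%MM, 0%MM; rewrite mulm1n addm0 mdiffxx; split=> //.
  - by move=> j; rewrite mnm1E; case: eqVneq => // <-; rewrite iE.
  - exact: NDelta0.
  - exact: lattice0.
have [x [Zx Lx x0]] : exists x, [/\ ZDelta (i |: E) x, L x & x <> 0].
  apply: contrapT => nex; move: niE; rewrite -(maxE (i |: E)) ?finset.setU11 //.
    rewrite /P finset.subUset finset.sub1set iD ED; apply/asboolP => x Zx Lx.
    by apply: contrapT => x0; apply: nex; exists x.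
  exact: finset.subsetUr.
have xi : x 0 i != 0.
  apply/eqP => xi; apply: x0; apply: ZE => // j jE.
  by have [->//|ji] := eqVneq j i; apply: Zx; rewrite !inE negb_or ji.
wlog xi0 : x Zx Lx x0 xi / 0 < x 0 i.
  move=> W; have [x_le0|] := lerP (x 0 i) 0; last exact: W.
  apply: (W (- x)).
  - exact: ZDeltaN.
  - exact: latticeN.
  - by move/eqP; rewrite oppr_eq0 => /eqP.
  - by rewrite mxE oppr_eq0.
  - by rewrite mxE oppr_gt0 lt_neqAle xi.
pose y : 'rV[int]_n := \row_j (if j == i then 0 else x 0 j).
have Zy : ZDelta E y.
  move=> j jE; rewrite mxE; case: eqVneq => // ji.
  by apply: Zx; rewrite !inE negb_or ji.
have [b [a [Nb Na yE]]] := ZDeltaP Zy.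
exists `|x 0%R i|%N, a, b; split=> //; first by rewrite absz_gt0.
suff -> : mdiff (U_(i) *+ `|x 0%R i| + b)%MM a = x by [].
have /rowP yj := yE.
apply/rowP => j; have := yj j; rewrite !mxE mnmDE mulmnE mnm1E.
have [<-|ij] := eqVneq i j; first by move: xi0; lia.
by rewrite mul0n; lia.
Qed.

Variable E : {set 'I_n}.
Hypothesis compE : lattice_complement E.

(* The positive cone of a total group preorder on [ZDelta Delta] whose neutral
   elements form the saturation of [L]. *)
Definition Pos : set 'rV[int]_n := [set x | exists N a b,
  [/\ (0 < N)%N, NDelta E a, NDelta E b, (b < a)%O & L (x *+ N - mdiff a b)]].

Lemma Pos_mdiff a b : NDelta E a -> NDelta E b -> (b < a)%O -> Pos (mdiff a b).
Proof.
move=> Na Nb ba; exists 1%N, a, b; split=> //.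
by rewrite mulr1n subrr; apply: lattice0.
Qed.

Lemma PosD x y : Pos x -> Pos y -> Pos (x + y).
Proof.
move=> [N [a [b [N0 Na Nb ba Lx]]]] [M [c [d [M0 Nc Nd dc Ly]]]].
exists (N * M)%N, (a *+ M + c *+ N)%MM, (b *+ M + d *+ N)%MM; split.
- by rewrite muln_gt0 N0.
- by apply: NDeltaD; apply: NDeltaMn.
- by apply: NDeltaD; apply: NDeltaMn.
- by apply: ltm_add; apply: ltm_muln.
have -> : (x + y) *+ (N * M) - mdiff (a *+ M + c *+ N)%MM (b *+ M + d *+ N)%MM
          = (x *+ N - mdiff a b) *+ M + (y *+ M - mdiff c d) *+ N.
  rewrite mdiffD !mdiffMn !mulrnBl -!mulrnA [(M * N)%N]mulnC mulrnDl opprD.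
  by rewrite addrACA.
by apply: latticeD => //; apply: latticeMn.
Qed.

Lemma Pos_rat_sat x : Pos x -> ~ rat_sat L x.
Proof.
case: compE => _ ZE _ [N [a [b [N0 Na Nb ba Lx]]]] [M M0 Mx].
have : L (mdiff a b *+ M).
  have -> : mdiff a b *+ M = (x *+ M) *+ N - (x *+ N - mdiff a b) *+ M.
    by rewrite mulrnBl opprB addrC -mulrnA -mulrnA mulnC subrK.
  by apply: latticeB => //; apply: latticeMn.
rewrite -mdiffMn => /(ZE _ (mdiff_ZDelta (NDeltaMn _ Na) (NDeltaMn _ Nb))).
rewrite -(mdiffxx 0%MM) => /mdiff_eq; rewrite addm0 add0m => E0.
by have := ltm_muln ba M0; rewrite E0 ltxx.
Qed.

Lemma Pos_total x : ZDelta Delta x -> [\/ Pos x, Pos (- x) | rat_sat L x].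
Proof.
case: compE => ED ZE genE Zx.
(* [Z] holds the vectors with a positive multiple congruent modulo [L] to a vector supported on [E].
   It is a group containing the unit vectors of Delta, so it contains [x], and comparing [a] with
   [b] decides the sign. *)
pose Z y := exists N a b, [/\ (0 < N)%N, NDelta E a, NDelta E b &
  L (y *+ N - mdiff a b)].
have ZD y z : Z y -> Z z -> Z (y + z).
  move=> [N [a [b [N0 Na Nb Ly]]]] [M [c [d [M0 Nc Nd Lz]]]].
  exists (N * M)%N, (a *+ M + c *+ N)%MM, (b *+ M + d *+ N)%MM; split.
  - by rewrite muln_gt0 N0.
  - by apply: NDeltaD; apply: NDeltaMn.
  - by apply: NDeltaD; apply: NDeltaMn.
  have -> : (y + z) *+ (N * M) - mdiff (a *+ M + c *+ N)%MM (b *+ M + d *+ N)%MM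
          = (y *+ N - mdiff a b) *+ M + (z *+ M - mdiff c d) *+ N.
    rewrite mdiffD !mdiffMn !mulrnBl -!mulrnA [(M * N)%N]mulnC mulrnDl opprD.
    by rewrite addrACA.
  by apply: latticeD => //; apply: latticeMn.
have ZN y : Z y -> Z (- y).
  move=> [N [a [b [N0 Na Nb Ly]]]]; exists N, b, a; split=> //.
  by rewrite mulNrn -(mdiffN a) -opprD; apply: latticeN.
have Z0 : Z 0.
  exists 1%N, 0%MM, 0%MM; rewrite mdiffxx mulr1n subr0.
  by split; rewrite ?lattice0 //; try exact: NDelta0; apply: lattice0.
have Zmono u : NDelta Delta u -> Z (mdiff u 0%MM).
  move=> Nu; rewrite [u]multinomUE_id.
  apply: (big_ind (fun u => Z (mdiff u 0%MM))) => [|v w Zv Zw|i _].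
  - by rewrite mdiffxx.
  - by rewrite -[0%MM]addm0 mdiffD; apply: ZD.
  have [iD|/Nu->] := boolP (i \in Delta); last by rewrite mulm0n mdiffxx.
  have [N [a [b [N0 Na Nb Li]]]] := genE i iD.
  have ZU : Z (mdiff U_(i)%MM 0%MM).
    exists N, a, b; split=> //.
    suff -> : mdiff U_(i)%MM 0%MM *+ N - mdiff a b = mdiff (U_(i) *+ N + b)%MM a by [].
    apply/rowP => j; rewrite mxE mulmxnE !mxE mnmDE mulmnE mnm0E.
    by lia.
  elim: (u i) => [|m IH]; first by rewrite mulm0n mdiffxx.
  by rewrite mulmS -[0%MM]addm0 mdiffD; apply: ZD.
have [u [v [Nu Nv xE]]] := ZDeltaP Zx.
have [N [a [b [N0 Na Nb Lx]]]] : Z x.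
  rewrite xE -(mdiff_trans 0%MM) -(mdiffN v); apply: ZD; first exact: Zmono.
  exact/ZN/Zmono.
case: (ltgtP a b) => ab.
- constructor 2; exists N, b, a; split=> //.
  by rewrite mulNrn -(mdiffN a) -opprD; apply: latticeN.
- by constructor 1; exists N, a, b.
- by constructor 3; exists N => //; move: Lx; rewrite ab mdiffxx subr0.
Qed.

End LatticeOrder.

Lemma exists_maximal (T : eqType) (s : seq T) (P : T -> Prop) (R : T -> T -> Prop) :
    (forall x, P x -> ~ R x x) -> (forall x y z, R x y -> R y z -> R x z) ->
    (exists2 x, x \in s & P x) ->
  exists x, [/\ x \in s, P x & forall y, y \in s -> P y -> ~ R x y].
Proof.
move=> irrR trR; elim: s => [|a s IH] [x]; first by [].
have [/IH[x0 [x0s Px0 maxx0]]|nex] := pselect (exists2 x, x \in s & P x).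
  have [[Pa Rx0a]|nPR] := pselect (P a /\ R x0 a).
    exists a; split=> // [|y]; first exact: mem_head.
    rewrite inE => /predU1P[->|ys Py Ray]; first exact: irrR.
    by apply: (maxx0 y) => //; apply: trR Ray.
  exists x0; split=> // [|y]; first by rewrite inE x0s orbT.
  by rewrite inE => /predU1P[-> Pa Rx0a|]; [apply: nPR|apply: maxx0].
rewrite inE => /predU1P[->|xs Px]; last by case: nex; exists x.
move=> Pa; exists a; split=> // [|y]; first exact: mem_head.
rewrite inE => /predU1P[->|ys Py]; first exact: irrR.
by case: nex; exists y.
Qed.

(** * Multiplication by polynomials with a leading term *)

Section TopTerm.
Variables (k : fieldType) (n : nat) (Delta E : {set 'I_n}) (L : set 'rV[int]_n).
Hypotheses (latL : is_lattice L) (compE : lattice_complement Delta L E).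
Variables (K : set {mpoly k[n]}) (W : set 'X_{1..n}).
Hypotheses (idK : is_ideal K) (satK : saturated Delta K).
Implicit Types (a b t u v w z : 'X_{1..n}) (f g : {mpoly k[n]}).

Local Notation N := (NDelta Delta).

(** [W] selects the classes on which the order makes sense: it is stable under translation in the
    Delta directions, and by [W_sat] such a translation fixes a class of [W] only along the
    saturation of [L], hence never along a vector of [Pos]. *)
Hypothesis W_mcong : forall w z t t', N t -> N t' -> W w ->
  mcong K (t' + z)%MM (t + w)%MM -> W z.
Hypothesis W_sat : forall w t t', N t -> N t' -> W w ->
  mcong K (t + w)%MM (t' + w)%MM -> rat_sat L (mdiff t t').

Local Notation class w := [set z | mcong K z w].

Definition detected f := exists2 w, W w & ~ K (mproj (class w) f).

Definition top_term g u := [/\ u \in msupp g, polyN Delta g &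
  forall v, v \in msupp g -> v != u -> Pos L E (mdiff u v)].

Lemma eq_mproj_class f v w : mcong K v w -> mproj (class v) f = mproj (class w) f.
Proof.
move=> vw; apply: eq_mproj => z _ /=; split=> zv; first exact: mcong_trans zv vw.
by apply: mcong_trans zv _ => //; apply: mcong_sym.
Qed.

(* The leading term of [g] times a component of [f] that is maximal for the order
   defined by [Pos] cannot cancel. *)
Lemma detected_top_term g u f : top_term g u -> detected f -> detected (g * f).
Proof.
move=> [ug Ng top_u] [w Ww nKw].
pose P v := W v /\ ~ K (mproj (class v) f).
(* [prec v v'] says that the class of [v'] is that of [v] moved by the positive vector [t - t']. *)
pose prec v v' := exists t t', [/\ N t, N t', Pos L E (mdiff t t') &
  mcong K (t + v)%MM (t' + v')%MM].
have irr v : P v -> ~ prec v v.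
  move=> [Wv _] [t [t' [Nt Nt' Ptt' tv]]].
  exact: (Pos_rat_sat latL compE Ptt' (W_sat Nt Nt' Wv tv)).
have tr v1 v2 v3 : prec v1 v2 -> prec v2 v3 -> prec v1 v3.
  move=> [t [t' [Nt Nt' Ptt' tv]]] [s [s' [Ns Ns' Pss' sv]]].
  exists (s + t)%MM, (t' + s')%MM; split; try exact: NDeltaD.
    by rewrite addmC mdiffD; apply: PosD.
  rewrite -addmA; apply: mcong_trans (mcong_add s idK tv) _ => //.
  by rewrite addmCA -addmA; apply: mcong_add.
have [v vf vw] : exists2 v, v \in msupp f & mcong K v w.
  apply: contrapT => nex; apply: nKw; rewrite mproj_eq0; first exact: ideal_0.
  by move=> z zf zw; apply: nex; exists z.
have [v0 [v0f [Wv0 nKv0] maxv0]] : exists v, [/\ v \in msupp f, P v &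
    forall v', v' \in msupp f -> P v' -> ~ prec v v'].
  apply: exists_maximal => //; exists v => //; split.
    apply: (W_mcong (@NDelta0 n Delta) (@NDelta0 n Delta) Ww).
    exact: mcong_add.
  by rewrite (eq_mproj_class _ vw).
have Nu := Ng _ ug.
exists (u + v0)%MM.
  apply: (W_mcong Nu (@NDelta0 n Delta) Wv0); rewrite add0m; exact: mcong_refl.
rewrite [g]mpolyE mulr_suml mproj_sum (bigD1_seq u) ?msupp_uniq //=.
move=> Ksum.
have Krest : K (\sum_(v <- msupp g | v != u)
    mproj (class (u + v0)%MM) (g@_v *: 'X_[v] * f)).
  rewrite big_seq_cond; apply: ideal_sum => // z /andP[zg zu].
  rewrite -scalerAl mprojZ mulrC mproj_mulX.
  apply: idealZ => //; apply: ideal_mulr => //.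
  (* The term [z] of [g] reaches the class of [u + v0] only from the class of some [z0] in [f]. As
     [u - z] is positive, [z0] lies beyond [v0], so by maximality its component is in [K]. *)
  have [[z0 z0f zz0]|nex] := pselect (exists2 z0, z0 \in msupp f &
      mcong K (z + z0)%MM (u + v0)%MM); last first.
    rewrite mproj_eq0; first exact: ideal_0.
    by move=> y yf yz; apply: nex; exists y.
  have Nz := Ng _ zg.
  have -> : mproj [set y | (class (u + v0)%MM) (z + y)%MM] f = mproj (class z0) f.
    apply: eq_mproj => y _ /=; split=> [zy|yz0].
      apply: (saturated_mcong satK Nz); apply: mcong_trans zy _ => //.
      exact: mcong_sym.
    by apply: mcong_trans zz0 => //; apply: mcong_add.
  apply: contrapT => nKz0; apply: (maxv0 z0 z0f).
    by split=> //; apply: (W_mcong Nu Nz Wv0 zz0).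
  exists u, z; split=> //; first exact: top_u.
  exact: mcong_sym.
move: Ksum; rewrite addrC => /(idealDr _ idK Krest).
rewrite -scalerAl mprojZ mulrC mproj_mulX => /idealZI.
rewrite -mcoeff_msupp => /(_ idK ug) /(satK Nu); apply: contra_not nKv0.
rewrite (@eq_mproj _ _ _ (class v0)) // => y _ /=; split.
  exact: (saturated_mcong satK Nu).
exact: mcong_add.
Qed.

Lemma top_term_complement g : polyN E g -> g != 0 -> top_term g (mlead g).
Proof.
have [ED _ _] := compE.
move=> Ng g0; split=> [|z zg i iD|v vg vu]; first exact: mlead_supp.
  by apply: Ng zg _ _; apply: contra iD => /(fintype.subsetP ED).
apply: Pos_mdiff => //; first exact/Ng/mlead_supp.
  exact: Ng.
by rewrite lt_neqAle vu msupp_le_mlead.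
Qed.

Lemma top_termX u : N u -> top_term 'X_[u] u.
Proof.
move=> Nu; rewrite /top_term msuppX; split=> [|z|v].
- exact: mem_head.
- by rewrite msuppX inE => /eqP->.
- by rewrite inE => ->.
Qed.

End TopTerm.

(** * Embedded witnesses and the components *)

Section EmbeddedWitnesses.
Variables (k : fieldType) (n : nat) (Delta : {set 'I_n}).
Implicit Types (rho sigma tau : partial_char k Delta).
Implicit Types (a b t u v w z m : 'X_{1..n}) (f g : {mpoly k[n]}).
Implicit Types (I J K : set {mpoly k[n]}).

Local Notation N := (NDelta Delta).
Local Notation M_emb K := (M_emb Delta K).

Lemma is_ideal_M_emb K : is_ideal (M_emb K).
Proof. exact: is_ideal_gen. Qed.

Lemma M_emb_msupp K f z : M_emb K f -> z \in msupp f ->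
  exists L w, [/\ embedded_lattice Delta K L, witness_monomial Delta K L w & (w <= z)%MM].
Proof.
move=> Mf; move: f Mf z.
apply: (ideal_gen_in_ind (P := fun f => forall z, z \in msupp f -> exists L w,
  [/\ embedded_lattice Delta K L, witness_monomial Delta K L w & (w <= z)%MM])).
- by move=> z; rewrite msupp0.
- by move=> f g Hf Hg z /msuppD_le; rewrite mem_cat => /orP[/Hf|/Hg].
move=> a _ _ [L [w [eL wL ->]]] z.
rewrite (perm_mem (msuppMX a w)) => /mapP[z' _ ->].
by exists L, w; split=> //; apply: lem_addr.
Qed.

Lemma M_embX K L w : embedded_lattice Delta K L -> witness_monomial Delta K L w ->
  M_emb K 'X_[w].
Proof. by move=> eL wL; apply: sub_ideal_gen; exists L, w. Qed.

Lemma M_emb_mproj K f C : M_emb K f ->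
  (forall z, C z -> ~ M_emb K 'X_[z]) -> mproj C f = 0.
Proof.
move=> Mf nC; apply: mproj_eq0 => z zf /nC; apply.
have [L [w [eL wL wz]]] := M_emb_msupp Mf zf.
rewrite -(submK wz) mpolyXD; apply: (ideal_mull _ (is_ideal_M_emb K)).
exact: M_embX wL.
Qed.

Lemma colon_one_proper K tau : is_ideal K ->
  ideal_colon K 1 `&` polyN Delta = lattice_ideal tau -> ~ K 1.
Proof.
move=> idK defT K1; apply: (@lattice_ext_monomial _ _ _ tau 0%MM).
apply: lattice_ideal_sub_ext; rewrite mpolyX0 -defT; split; last exact: polyN1.
by rewrite /ideal_colon /= mulr1.
Qed.

Lemma ideal_colon1 K : ideal_colon K 1 = K.
Proof. by apply/seteqP; split=> f; rewrite /ideal_colon /= mulr1. Qed.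

(* Lattices of monomials only grow along divisibility, so a monomial whose lattice
   has the rank of the lattice of [1] is not a multiple of an embedded witness. *)
Lemma M_emb_free K rho z : is_ideal K -> saturated Delta K ->
    lattice_ideal rho `<=` K ->
    (forall a b, N a -> N b -> mcong K (z + a)%MM (z + b)%MM ->
       rat_sat (pc_lat rho) (mdiff a b)) ->
  ~ M_emb K 'X_[z].
Proof.
move=> idK satK rhoK zsat Mz.
have /(M_emb_msupp Mz)[L [w [[_ [sig sigP rk]] [_ [tau tauL tauP]] wz]]] :
    z \in msupp 'X_[k, z].
  by rewrite msuppX mem_head.
have nK1 : ~ K 1.
  by apply: (colon_one_proper idK (tau := sig)); rewrite ideal_colon1.
move: rk; rewrite ltnNge => /negP; apply.
have ZL x : L x -> ZDelta Delta x by rewrite -tauL; apply: pc_ZDelta.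
apply: (@leq_trans (lattice_rank (pc_lat rho))).
  apply: lattice_rank_sat => x Lx; have [a [b [Na Nb xE]]] := ZDeltaP (ZL _ Lx).
  rewrite xE in Lx *; apply: zsat => //.
  have nKw : ~ K 'X_[w].
    move=> Kw; apply: (@lattice_ext_monomial _ _ _ tau 0%MM).
    apply: lattice_ideal_sub_ext; rewrite mpolyX0 -tauP; split; last exact: polyN1.
    by rewrite /ideal_colon /= mul1r.
  rewrite -(submK wz) -!addmA; apply: mcong_add => //.
  exists (pc_val tau (mdiff a b)); first by apply: pc_unit; rewrite tauL.
  by apply: (lattice_ideal_witness idK satK nKw tauP).2; rewrite ?tauL.
apply: lattice_rank_sub => x rx.
have [a [b [Na Nb xE]]] := ZDeltaP (pc_ZDelta rx).
rewrite xE in rx *.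
have nKX0 : ~ K 'X_[0] by rewrite mpolyX0.
have := @lattice_ideal_witness _ _ _ K 0%MM idK satK nKX0 sig.
rewrite mpolyX0 ideal_colon1 => /(_ sigP) [sig1 _].
have := sig1 a b (pc_val rho (mdiff a b)) Na Nb (pc_unit rx).
rewrite !add0m => -[] //.
exact/rhoK/lattice_binomials_sub/lattice_binomialsX.
Qed.

Definition Delta_part (D : {set 'I_n}) z : 'X_{1..n} :=
  [multinom if i \in D then z i else 0%N | i < n].

Lemma NDelta_part D z : NDelta D (Delta_part D z).
Proof. by move=> i /negPf iD; rewrite mnmE iD. Qed.

Lemma Delta_part_add z : (Delta_part Delta z + Delta_part (~: Delta) z = z)%MM.
Proof. by apply/mnmP => i; rewrite mnmDE !mnmE !inE; case: (i \in Delta); rewrite ?addn0. Qed.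

(** Otherwise the part [w] of [z] outside Delta would have a lattice of larger rank than [rho]; it
    would be an embedded witness dividing [z]. With equal ranks, the larger lattice is inside the
    saturation of the smaller one. *)
Lemma M_emb_rat_sat K rho z : is_ideal K -> saturated Delta K -> class_graded K ->
    ~ K 'X_[z] -> K `&` polyN Delta = lattice_ideal rho -> ~ M_emb K 'X_[z] ->
  forall a b, N a -> N b -> mcong K (z + a)%MM (z + b)%MM ->
    rat_sat (pc_lat rho) (mdiff a b).
Proof.
move=> idK satK grK nKz defR nMz a b Na Nb.
pose w := Delta_part (~: Delta) z; pose d := Delta_part Delta z.
have Nd : N d by apply: NDelta_part.
have zE : z = (d + w)%MM by rewrite Delta_part_add.
have nKw : ~ K 'X_[w].
  by apply: contra_not nKz; rewrite zE mpolyXD; apply: ideal_mull.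
have [tau tauP] := witness_exists idK satK nKw grK.
have [tau1 _] := lattice_ideal_witness idK satK nKw tauP.
have rk : (lattice_rank (pc_lat tau) <= lattice_rank (pc_lat rho))%N.
  rewrite leqNgt; apply/negP => rk; apply: nMz.
  have ww : witness_monomial Delta K (pc_lat tau) w.
    by split; [exact: NDelta_part|exists tau].
  rewrite zE mpolyXD; apply: (ideal_mull _ (is_ideal_M_emb K)).
  by apply: M_embX (ww); split; [exists w|exists rho].
have sub : pc_lat rho `<=` pc_lat tau.
  move=> x rx; have [c [e [Nc Ne xE]]] := ZDeltaP (pc_ZDelta rx).
  rewrite xE in rx *; apply: (tau1 _ _ _ Nc Ne (pc_unit rx) _).1.
  rewrite !mpolyXD scalerAr -mulrBr; apply: ideal_mull => //.
  have : lattice_ideal rho ('X_[c] - pc_val rho (mdiff c e) *: 'X_[e]).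
    exact/lattice_binomials_sub/lattice_binomialsX.
  by rewrite -defR => -[].
rewrite zE -!addmA => /(saturated_mcong satK Nd)[c c0 Kc].
apply: (lattice_rank_le_sat (pc_lattice rho) sub rk).
exact: (tau1 _ _ _ Na Nb c0 Kc).1.
Qed.

(** By [M_emb_free] and [M_emb_rat_sat], lying outside [M_emb K] is a condition on the lattice of a
    monomial, and congruent monomials have the same lattice, even after factors in the variables of
    Delta are cancelled. *)
Lemma M_emb_mcong K rho z w t t' : is_ideal K -> saturated Delta K -> class_graded K ->
    K `&` polyN Delta = lattice_ideal rho -> N t -> N t' -> ~ K 'X_[w] ->
    mcong K (t' + z)%MM (t + w)%MM -> M_emb K 'X_[z] -> M_emb K 'X_[w].
Proof.
move=> idK satK grK defR Nt Nt' nKw zw Mz; apply: contrapT => nMw; move: Mz.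
apply: (@M_emb_free K rho) => // [f|a b Na Nb zab]; first by rewrite -defR => -[].
apply: (M_emb_rat_sat idK satK grK nKw defR nMw Na Nb).
apply: (saturated_mcong satK Nt).
have E c : mcong K (t' + (z + c))%MM (t + (w + c))%MM.
  by rewrite !addmA ![(_ + c)%MM]addmC; apply: mcong_add.
apply: mcong_trans (E b) => //; apply: mcong_trans (mcong_add t' idK zab) => //.
exact: mcong_sym.
Qed.

End EmbeddedWitnesses.

(** * Detection of polynomials outside I *)

Section Detection.
Variables (k : fieldType) (n : nat) (Delta : {set 'I_n}) (I : set {mpoly k[n]}).
Hypotheses (idI : is_ideal I) (satI : saturated Delta I) (grI : class_graded I).
Implicit Types (rho sigma tau : partial_char k Delta).
Implicit Types (a b t u v w z m : 'X_{1..n}) (f g : {mpoly k[n]}).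

Local Notation N := (NDelta Delta).
Local Notation M_emb K := (M_emb Delta K).
Local Notation class w := [set z | mcong I z w].

(** The second condition puts the lattice of [rho], with its character, inside that of [m]; the
    third puts the lattice of [m] inside the saturation of that of [rho]. *)
Definition detects rho m : Prop := [/\ ~ I 'X_[m],
  (forall e : {mpoly k[n]}, lattice_binomials rho e -> I (e * 'X_[m])) &
  forall a b, N a -> N b -> mcong I (m + a)%MM (m + b)%MM ->
    rat_sat (pc_lat rho) (mdiff a b)].

Lemma detects_shift rho m u : N u -> detects rho m -> detects rho (u + m).
Proof.
move=> Nu [nIm bI satm]; split=> [|e /bI Ie|a b Na Nb].
- by move/(saturated_mono satI Nu).
- by rewrite mpolyXD mulrCA; apply: ideal_mull.
- by rewrite -!addmA => /(saturated_mcong satI Nu); apply: satm.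
Qed.

Lemma detects_mcong rho m a b : detects rho m -> N a ->
  mcong (sat_sum I rho) (m + b)%MM (m + a)%MM -> mcong I (m + b)%MM (m + a)%MM.
Proof.
move=> dm Na [c c0]; have [nIm bI _] := detects_shift Na dm.
rewrite addmC in nIm bI; move/(sat_sum_mproj idI satI grI bI).
rewrite mprojD mprojN mprojZ !mprojX.
rewrite [X in _ - _ *: (if X then _ else _)]asboolT; last exact: mcong_refl.
case: asboolP => // _; rewrite sub0r => /(idealN idI); rewrite opprK.
by move/(idealZI idI c0).
Qed.

(** On the class of [m], the saturated sum contributes nothing beyond [I], and by [M_emb_free] no
    monomial of the class is in the embedded part, whose projection is therefore zero. *)
Lemma detects_component rho m f : detects rho m ->
  ideal_add (sat_sum I rho) (M_emb (sat_sum I rho)) f -> I (mproj (class m) f).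
Proof.
move=> dm [j Jj [mu Mmu ->]]; have [nIm bI satm] := dm.
rewrite mprojD; apply: idealD => //; first exact: (sat_sum_mproj idI satI grI bI).
have idJ := is_ideal_sat_sum rho idI.
rewrite (M_emb_mproj Mmu); first exact: ideal_0.
move=> z zm; apply: (@M_emb_free _ _ _ _ rho) => //.
- exact: sat_sum_saturated.
- by move=> g Lg; apply: ext_sub_sat_sum => //; apply: lattice_ideal_sub_ext.
move=> a b Na Nb zab; apply: satm => //; apply: (detects_mcong dm) => //.
have E c : mcong (sat_sum I rho) (z + c)%MM (m + c)%MM.
  rewrite ![(_ + c)%MM]addmC; apply: mcong_add => //.
  by apply: mcong_sub zm; apply: sub_sat_sum.
apply: mcong_trans (E b) => //; apply: mcong_trans zab => //.
exact: mcong_sym.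
Qed.

Variable rho : 'X_{1..n} -> partial_char k Delta.
Hypothesis rhoP : forall m, M_index Delta I m ->
  ideal_colon I 'X_[m] `&` polyN Delta = lattice_ideal (rho m).
Hypothesis nI1 : ~ I 1.

Lemma M_index_nmem m : M_index Delta I m -> ~ I 'X_[m].
Proof. by case=> [->|[]//]; rewrite mpolyX0. Qed.

Lemma M_index0 : M_index Delta I 0%MM.
Proof. by left. Qed.

Lemma rho0P : I `&` polyN Delta = lattice_ideal (rho 0%MM).
Proof. by rewrite -(rhoP M_index0) mpolyX0 ideal_colon1. Qed.

Lemma lattice_binomials_colon m e : M_index Delta I m ->
  lattice_binomials (rho m) e -> I (e * 'X_[m]).
Proof. by move=> /rhoP defR /lattice_binomials_sub; rewrite -defR => -[]. Qed.

Lemma detects_exists m : ~ I 'X_[m] ->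
  exists2 m0, M_index Delta I m0 & detects (rho m0) m.
Proof.
move=> nIm; have [Mm|nMm] := pselect (M_emb I 'X_[m]).
  have Mim : M_index Delta I m by right.
  exists m => //; split=> // [e|a b Na Nb [c c0 Ic]].
    exact: lattice_binomials_colon.
  apply: sub_rat_sat.
  exact: ((lattice_ideal_witness idI satI nIm (rhoP Mim)).1 _ _ _ Na Nb c0 Ic).1.
exists 0%MM; first exact: M_index0.
split=> // [e|a b].
  move/(lattice_binomials_colon M_index0); rewrite mpolyX0 mulr1.
  by move=> Ie; apply: ideal_mulr.
exact: (M_emb_rat_sat idI satI grI nIm rho0P nMm).
Qed.

(** The colon ideal is saturated and contains both summands. This upper bound determines the
    intersection of [sat_sum I (rho m)] with [k[N^Delta]]. *)
Lemma sat_sum_colon m : M_index Delta I m ->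
  sat_sum I (rho m) `<=` ideal_colon I 'X_[m].
Proof.
move=> Mm; apply: sat_sum_min.
- exact: is_ideal_colon.
- move=> f u Nu; rewrite /ideal_colon /= mulrAC => If.
  exact: (satI Nu If).
- by move=> f If; apply: ideal_mulr.
- by rewrite -rhoP // => f [].
Qed.

Lemma sat_sum_polyN m : M_index Delta I m ->
  sat_sum I (rho m) `&` polyN Delta = lattice_ideal (rho m).
Proof.
move=> Mm; apply/seteqP; split=> f.
  by case=> /(sat_sum_colon Mm) Cf Nf; rewrite -rhoP.
move=> Lf; split; last exact: lattice_ideal_polyN Lf.
by apply: ext_sub_sat_sum => //; apply: lattice_ideal_sub_ext.
Qed.

Lemma sub_component m : I `<=` ideal_add (sat_sum I (rho m)) (M_emb (sat_sum I (rho m))).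
Proof.
move=> f If; apply: sub_ideal_addl; first exact: is_ideal_M_emb.
exact: sub_sat_sum.
Qed.

Lemma component_decomposition : I = \bigcap_(m in M_index Delta I)
  ideal_add (sat_sum I (rho m)) (M_emb (sat_sum I (rho m))).
Proof.
apply/seteqP; split=> [f If m _|f capf]; first exact: sub_component.
apply: contrapT => nIf.
have [m [_ nIm nIp]] := class_detect idI idI (@subset_refl _ I) nIf.
have [m0 Mm0 dm] := detects_exists nIm.
by apply: nIp; apply: detects_component dm _; apply: capf.
Qed.

End Detection.

(** * The hull *)

Section IntegralModuloIdeal.
Variables (R : comNzRingType) (P : set R) (phi : {rmorphism R -> R}).
Hypotheses (idP : is_ideal P) (nP1 : ~ P 1).

(** Coefficients are taken in the image of [phi], later the retraction of [k[x]] onto [k[x_E]].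
    Passing to the quotient by [P] turns this into ordinary integrality, which is stable under sums
    and products. *)
Definition integral_mod z : Prop :=
  exists2 p : {poly R}, p \is monic & P (map_poly phi p).[z].

Definition mem_ideal_pred : {pred R} := fun f => `[< P f >].

Let mem_idealr_closed : idealr_closed mem_ideal_pred.
Proof.
split; first by apply/asboolP; apply: ideal_0.
  by apply/negP => /asboolP.
move=> a u v /asboolP Pu /asboolP Pv; apply/asboolP.
by apply: idealD => //; apply: ideal_mull.
Qed.

HB.instance Definition _ := isIdealr.Build R mem_ideal_pred mem_idealr_closed.

Local Notation Q := {ideal_quot mem_ideal_pred}.

Let toQ : {rmorphism R -> Q} := (\pi_Q)%qT.

Let toQ_eq0 f : (toQ f == 0) = `[< P f >].
Proof.
rewrite -(rmorph0 toQ) /= /toQ.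
by rewrite piE /= Quotient.equivE subr0.
Qed.

Let integral_modE z : integral_mod z <-> integralOver (toQ \o phi) (toQ z).
Proof.
have E (p : {poly R}) : (map_poly (toQ \o phi) p).[toQ z] = toQ (map_poly phi p).[z].
  by rewrite map_poly_comp horner_map.
split=> -[p mp]; first by move=> Pp; exists p; rewrite // rootE E toQ_eq0; apply/asboolP.
by rewrite rootE E toQ_eq0 => /asboolP; exists p.
Qed.

Lemma integral_modD y z : integral_mod y -> integral_mod z -> integral_mod (y + z).
Proof. by rewrite !integral_modE rmorphD; apply: integral_add. Qed.

Lemma integral_modM y z : integral_mod y -> integral_mod z -> integral_mod (y * z).
Proof. by rewrite !integral_modE rmorphM; apply: integral_mul. Qed.

Lemma integral_mod_id y : integral_mod (phi y).
Proof. by rewrite integral_modE; apply: (integral_id (toQ \o phi)). Qed.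

Lemma integral_mod_root y z m : (0 < m)%N -> P (z ^+ m - phi y) -> integral_mod z.
Proof.
move=> m0 Pz; exists ('X^m - y%:P); first by rewrite monicXnsubC.
by rewrite rmorphB /= map_polyXn map_polyC !hornerE.
Qed.

End IntegralModuloIdeal.

(* Cancelling factors [h] from an integral equation of [h] modulo [P'] until its
   constant term leaves [P']. *)
Lemma integral_mod_constant (R : comNzRingType) (P P' : set R)
    (phi : {rmorphism R -> R}) h :
    prime_ideal P -> prime_ideal P' -> P' `<=` P -> P h -> ~ P' h ->
  integral_mod P' phi h -> exists a, P (phi a) /\ ~ P' (phi a).
Proof.
move=> [idP _ _] [idP' nP'1 primeP'] P'P Ph nP'h [p]; elim/poly_ind: p => [|p c IH].
  by rewrite monicE lead_coef0 eq_sym oner_eq0.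
rewrite rmorphD rmorphM /= map_polyX map_polyC !hornerE /=.
have [P'c|nP'c] := pselect (P' (phi c)).
  have [->|p0] := eqVneq p 0.
    rewrite mul0r add0r monicE lead_coefC => /eqP c1.
    by case: nP'1; rewrite -(rmorph1 phi) -c1.
  rewrite monicE lead_coefDl ?lead_coefMX => [mp|]; last first.
    by rewrite size_polyC size_mulX // (leq_ltn_trans (leq_b1 _)) // ltnS lt0n size_poly_eq0.
  by rewrite addrC => /idealDr => /(_ idP' P'c) /primeP'[/(IH mp)|//].
move=> _ P'p; exists c; split=> //.
by apply: (idealDr _ idP (ideal_mull _ idP Ph)).1; apply: P'P P'p.
Qed.

Section Hull.
Variables (k : fieldType) (n : nat) (Delta : {set 'I_n}).
Implicit Types (a b t u v w z m : 'X_{1..n}) (f g h : {mpoly k[n]}).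
Implicit Types (I J K P Q : set {mpoly k[n]}) (E : {set 'I_n}).

Local Notation N := (NDelta Delta).

Section Restriction.
Variable E : {set 'I_n}.

Let vars : n.-tuple {mpoly k[n]} := [tuple (if i \in E then 'X_i else 0) | i < n].

Definition restrict : {rmorphism {mpoly k[n]} -> {mpoly k[n]}} := comp_mpoly vars.

Lemma polyN_restrict f : polyN E (restrict f).
Proof.
rewrite /restrict /= comp_mpolyEX; apply: polyN_sum => m _; apply: polyNZ.
rewrite comp_mpolyX; apply: (big_ind (polyN E)) => [||i _]; [exact: polyN1|exact: polyNM|].
elim: (m i) => [|d IH]; first by rewrite expr0; apply: polyN1.
rewrite exprS; apply: polyNM => //; rewrite tnth_mktuple.
case: ifP => iE; last exact: polyN0.
by apply: polyNX => j; rewrite mnm1E; case: eqVneq => // <-; rewrite iE.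
Qed.

Lemma restrict_id f : polyN E f -> restrict f = f.
Proof.
move=> Nf; rewrite /restrict /= comp_mpolyEX [RHS]mpolyE big_seq [RHS]big_seq.
apply: eq_bigr => m /Nf Nm; congr (_ *: _).
rewrite comp_mpolyX [RHS]mpolyXE_id.
apply: eq_bigr => i _; rewrite tnth_mktuple.
by case: ifPn => // /Nm->; rewrite !expr0.
Qed.

End Restriction.

Lemma prime_mono P u : prime_ideal P -> (forall i, i \in Delta -> ~ P 'X_i) ->
  N u -> ~ P 'X_[u].
Proof.
move=> primeP nPX Nu; rewrite mpolyXE_id; have [idP nP1 PM] := primeP.
apply: (big_ind (fun f => ~ P f)) => [//|f g nPf nPg /PM[]//|i _].
have [iD|/Nu->//] := boolP (i \in Delta).
by move/(primeX primeP); apply: nPX.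
Qed.

(** For [i] in Delta the complement gives [x_i^m x^b = c x^a] modulo [J], with [a] and [b] supported
    on [E]. Multiplying by [x^(d m - b)] makes [(x^d x_i)^m] an element of [k[x_E]]; summing the
    vectors [b] gives one [d] for all variables. Those outside Delta are already in [P']. *)
Lemma integral_generators J P' (L : set 'rV[int]_n) E : prime_ideal P' -> J `<=` P' ->
    is_ideal J -> lattice_complement Delta L E ->
    (forall a b, N a -> N b -> L (mdiff a b) -> mcong J a b) ->
    (forall i, i \notin Delta -> P' 'X_i) ->
  exists2 d, NDelta E d & forall i, integral_mod P' (restrict E) ('X_[d] * 'X_i).
Proof.
move=> [idP' nP'1 _] JP' idJ [ED _ genE] LJ P'X.
have ex i : exists r : nat * 'X_{1..n} * 'X_{1..n}, i \in Delta ->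
    [/\ (0 < r.1.1)%N, NDelta E r.1.2, NDelta E r.2 &
      L (mdiff (U_(i) *+ r.1.1 + r.2)%MM r.1.2)].
  have [iD|] := boolP (i \in Delta); last by exists (0%N, 0%MM, 0%MM).
  by have [m [a [b H]]] := genE i iD; exists (m, a, b).
have [r rP] := choice ex.
pose d := (\sum_(i in Delta) (r i).2)%MM.
have Nd : NDelta E d.
  by apply: (big_ind (NDelta E)) => [||i /rP[]//]; [exact: NDelta0|move=> ? ?; exact: NDeltaD].
exists d => // i; have [iD|iD] := boolP (i \in Delta); last first.
  apply: (@integral_mod_root _ _ _ 0 _ 1%N) => //.
  by rewrite rmorph0 subr0 expr1; apply: ideal_mull => //; apply: P'X.
have [m0 Na Nb Li] := rP i iD; set m := (r i).1.1 in m0 Li; set a := (r i).1.2 in Na Li.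
set b := (r i).2 in Nb Li.
have NED u : NDelta E u -> N u.
  by move=> Nu j jD; apply: Nu; apply: contra jD => /(fintype.subsetP ED).
have NU : N U_(i)%MM by move=> j jD; rewrite mnm1E; case: eqVneq jD => // <-; rewrite iD.
have [c c0 Jc] : mcong J (U_(i) *+ m + b)%MM a.
  by apply: LJ => //; [apply: NDeltaD (NED _ Nb); apply: NDeltaMn|apply: NED].
have bd : (b <= d *+ m)%MM.
  apply/mnm_lepP => j; rewrite mulmnE; apply: leq_trans (_ : d j <= _)%N.
    by rewrite /d mnm_sumE (bigD1 i) //= leq_addr.
  by rewrite leq_pmulr.
pose e := (d *+ m - b)%MM.
have Ne : NDelta E e by apply: NDelta_mono (NDeltaMn m Nd); apply: lem_subr.
apply: (@integral_mod_root _ _ _ ('X_[e] * (c *: 'X_[a])) _ m) => //.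
have -> : ('X_[d] * 'X_i) ^+ m = 'X_[e] * 'X_[U_(i) *+ m + b] :> {mpoly k[n]}.
  rewrite -mpolyXD mpolyXn -mpolyXD; congr ('X_[_]).
  rewrite [(U_(i) *+ m + b)%MM]addmC addmA submK //.
  by apply/mnmP => j; rewrite !(mulmnE, mnmDE) mulnDl.
rewrite restrict_id; last by apply: polyNM; [|apply: polyNZ]; apply: polyNX.
by rewrite -mulrBr; apply: ideal_mull => //; apply: JP'.
Qed.

(** Every monomial of [f] has degree below [msize f], so each of its variables can be paired with a
    factor ['X_[d]]; the factors left over are in [k[x_E]]. *)
Lemma integral_multiple P' E d : prime_ideal P' -> NDelta E d ->
    (forall i, integral_mod P' (restrict E) ('X_[d] * 'X_i)) ->
  forall f, integral_mod P' (restrict E) ('X_[d *+ msize f] * f).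
Proof.
move=> [idP' nP'1 _] Nd intd f.
have int_mono c u D : (mdeg u <= D)%N ->
    integral_mod P' (restrict E) ('X_[d *+ D] * (c *: 'X_[u])).
  move=> uD.
  have -> : 'X_[d *+ D] * (c *: 'X_[u]) =
      (c *: 'X_[d *+ (D - mdeg u)]) * \prod_i ('X_[d] * 'X_i) ^+ u i :> {mpoly k[n]}.
    rewrite (eq_bigr (fun i => 'X_[d] ^+ u i * 'X_i ^+ u i)); last first.
      by move=> i _; rewrite exprMn.
    rewrite big_split /= -mpolyXE_id prodrXr -mdegE -scalerAr -scalerAl mulrA.
    congr (_ *: (_ * _)); rewrite mpolyXn -mpolyXD; congr 'X_[_].
    by apply/mnmP => j; rewrite mnmDE !mulmnE -mulnDr subnK.
  apply: integral_modM => //.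
    rewrite -[_ *: _](@restrict_id E); last by apply/polyNZ/polyNX/NDeltaMn.
    exact: integral_mod_id.
  apply: (big_ind (integral_mod P' (restrict E))) => [|y z|i _].
  - by rewrite -(rmorph1 (restrict E)); apply: integral_mod_id.
  - exact: integral_modM.
  elim: (u i) => [|j IH]; last by rewrite exprS; apply: integral_modM.
  by rewrite expr0 -(rmorph1 (restrict E)); apply: integral_mod_id.
rewrite {2}[f]mpolyE mulr_sumr big_seq.
apply: (big_ind (integral_mod P' (restrict E))) => [|y z|u uf].
- by rewrite -(rmorph0 (restrict E)); apply: integral_mod_id.
- exact: integral_modD.
by apply: int_mono; apply: ltnW; apply: msize_mdeg_lt.
Qed.

Lemma nonminimal_prime_top_term J P P' (L : set 'rV[int]_n) E :
    prime_ideal P -> prime_ideal P' -> J `<=` P' -> P' `<=` P -> P' <> P ->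
    is_ideal J -> lattice_complement Delta L E -> is_lattice L ->
    (forall a b, N a -> N b -> L (mdiff a b) -> mcong J a b) ->
    (forall i, i \notin Delta -> P' 'X_i) ->
  exists g u, P g /\ top_term Delta E L g u.
Proof.
move=> primeP primeP' JP' P'P neP idJ compE latL LJ P'X.
have [[i [iD PX]]|nPX] := pselect (exists i, i \in Delta /\ P 'X_i).
  exists 'X_i, U_(i)%MM; split=> //; apply: top_termX => j jD.
  by rewrite mnm1E; case: eqVneq jD => // <-; rewrite iD.
have [h Ph nP'h] : exists2 h, P h & ~ P' h.
  apply: contrapT => nex; apply: neP; apply/seteqP; split=> // h Ph.
  by apply: contrapT => nP'h; apply: nex; exists h.
have [d Nd intd] := integral_generators primeP' JP' idJ compE LJ P'X.
have nP'd : ~ P' 'X_[d *+ msize h].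
  apply: prime_mono => // [i iD P'i|]; first by apply: nPX; exists i; split=> //; apply: P'P.
  have [ED _ _] := compE.
  by move=> j jD; apply: (NDeltaMn _ Nd); apply: contra jD => /(fintype.subsetP ED).
have [idP _ _] := primeP; have [_ _ primeM] := primeP'.
have [||a [Pa nP'a]] := integral_mod_constant primeP primeP' P'P _ _
  (integral_multiple primeP' Nd intd h).
- exact: ideal_mull.
- by move/primeM => [].
exists (restrict E a), (mlead (restrict E a)); split=> //.
apply: top_term_complement => //; first exact: polyN_restrict.
by apply/eqP => a0; apply: nP'a; rewrite a0; case: primeP' => /ideal_0.
Qed.

Variables (I : set {mpoly k[n]}) (rho : partial_char k Delta).
Hypothesis cellI : cellular Delta I.
Hypothesis grI : class_graded I.

Let idI : is_ideal I. Proof. by case: cellI. Qed.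
Let satI : saturated Delta I. Proof. exact: cellular_saturated. Qed.
Let J := sat_sum I rho.
Let idJ : is_ideal J. Proof. exact: is_ideal_sat_sum. Qed.

(** The aim is one [g] with [g * f] in [J] such that multiplication by [g] keeps polynomials
    detected. It is a product over the primary components of [J]: the factor is [1] for a minimal
    one, which contains [f], and a power of a polynomial with a leading term for the others. *)
Lemma Hull_detected f m : detects I rho m -> Hull J f ->
  I (mproj [set z | mcong I z m] f).
Proof.
move=> dm Hf; apply: contrapT => nIp.
have latL := pc_lattice rho.
have [E compE] := lattice_complement_exists Delta latL.
pose W := [set w | detects I rho w].
have W_mcong w z t t' : N t -> N t' -> W w -> mcong I (t' + z)%MM (t + w)%MM -> W z.
  move=> Nt Nt' dw zw; have [nItw bI satw] := detects_shift idI satI Nt dw.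
  split=> [Iz|e /bI Ie|a b Na Nb zab].
  - apply: nItw; apply: mcong_mem zw _ => //.
    by rewrite mpolyXD; apply: ideal_mull.
  - have [c c0 Ic] := zw; apply: (satI Nt'); rewrite -mulrA -mpolyXD addmC.
    rewrite -(subrK (c *: 'X_[t + w]) 'X_[t' + z]) mulrDr; apply: idealD => //.
      exact: ideal_mull.
    by rewrite -scalerAr; apply: idealZ.
  apply: satw => //.
  have Ec c : mcong I (t' + z + c)%MM (t + w + c)%MM.
    by rewrite ![(_ + c)%MM]addmC; apply: mcong_add.
  apply: mcong_trans (Ec b) => //; apply: mcong_trans (mcong_sym idI (Ec a)) _ => //.
  by rewrite -!addmA; apply: mcong_add.
have W_sat w t t' : N t -> N t' -> W w -> mcong I (t + w)%MM (t' + w)%MM ->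
    rat_sat (pc_lat rho) (mdiff t t').
  by move=> Nt Nt' [_ _ satw]; rewrite ![(_ + w)%MM]addmC; apply: satw.
pose pres g := forall f, detected I W f -> detected I W (g * f).
have presM g h : pres g -> pres h -> pres (g * h).
  by move=> pg ph f' /ph/pg; rewrite mulrA.
have pres1 : pres 1 by move=> f'; rewrite mul1r.
have presX g N0 : pres g -> pres (g ^+ N0).
  by move=> pg; elim: N0 => [//|N0 IH]; rewrite exprS; apply: presM.
have pres_top g u : top_term Delta E (pc_lat rho) g u -> pres g.
  by move=> tg f'; apply: (detected_top_term latL compE idI satI W_mcong W_sat tg).
(* [Hull] runs over the minimal components of all minimal primary decompositions. Those of one are
   enough here, and its finiteness makes the product of multipliers possible. *)
have [F FP] := minimal_primary_decomposition_exists (@mpoly_acc k n) idJ.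
have [[/finite_seqP[s sF] Fprim JF] _ _] := FP.
have JQ Q : F Q -> J `<=` Q by rewrite JF => FQ g; apply.
have each Q : F Q -> exists2 g, pres g & Q (g * f).
  move=> FQ; have [idQ _ _] := Fprim _ FQ.
  have [minQ|nminQ] := pselect (minimal_prime J (radical Q)).
    exists 1 => //; rewrite mul1r; apply: Hf; split=> //.
    by exists F.
  have primeQ := radical_primary_prime (Fprim _ FQ).
  have [P' [primeP' JP' P'Q neP]] : exists P', [/\ prime_ideal P', J `<=` P',
      P' `<=` radical Q & P' <> radical Q].
    apply: contrapT => nex; apply: nminQ; split=> //.
      by move=> g /(JQ _ FQ); apply: sub_radical.
    by move=> P' pP' JP' P'Q; apply: contrapT => ne; apply: nex; exists P'.
  have [||g [u [[N0 QgN] tg]]] := nonminimal_prime_top_term primeQ primeP' JP' P'Q neP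
    idJ compE latL.
  - move=> a b Na Nb Lab; exists (pc_val rho (mdiff a b)); first exact: pc_unit.
    apply: ext_sub_sat_sum => //.
    exact/lattice_ideal_sub_ext/lattice_binomials_sub/lattice_binomialsX.
  - move=> i iD; have [_ _ _ /(_ i iD)[N0 IX]] := cellI.
    by apply: (primeX primeP'); apply: JP'; apply: sub_sat_sum IX.
  by exists (g ^+ N0); [apply/presX/(pres_top g u)|apply: ideal_mulr].
have [g pg Jg] : exists2 g, pres g & J (g * f).
  suff [g pg Qg] : exists2 g, pres g & forall Q, Q \in s -> Q (g * f).
    by exists g => //; rewrite JF => Q; rewrite sF; apply: Qg.
  have sub Q : Q \in s -> F Q by rewrite sF.
  elim: s sub {sF} => [|Q s IH] sub; first by exists 1.
  have [g pg Qg] := each Q (sub Q (mem_head _ _)).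
  have [|g' pg' Qg'] := IH; first by move=> Q' Q's; apply: sub; rewrite inE Q's orbT.
  exists (g * g') => [|Q']; first exact: presM.
  rewrite inE => /predU1P[->|Q's].
    by rewrite mulrAC; apply: ideal_mulr => //; case: (Fprim Q (sub Q (mem_head _ _))).
  rewrite -mulrA; apply: ideal_mull; last exact: Qg'.
  by case: (Fprim Q') => //; apply: sub; rewrite inE Q's orbT.
have [w dw []] := pg f (ex_intro2 _ _ m dm nIp).
by have [_ bI _] := dw; apply: (sat_sum_mproj idI satI grI bI Jg).
Qed.

Lemma sub_Hull : J `<=` Hull J.
Proof. by move=> f Jf Q [_ [F [[_ _ JF] _ _] FQ]]; move: Jf; rewrite JF; apply. Qed.

End Hull.

(** * Decomposition over an algebraically closed field *)

Section Splitting.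
Variables (k : fieldType) (n : nat) (Delta : {set 'I_n}).
Implicit Types (rho sigma tau : partial_char k Delta).
Implicit Types (a b t u v w z m : 'X_{1..n}) (f h : {mpoly k[n]}).

Local Notation N := (NDelta Delta).

Variables (S : set 'rV[int]_n) (rho : partial_char k Delta) (g : nat).
Variable rhol : 'I_g -> partial_char k Delta.
Hypothesis rholS : forall l, pc_lat (rhol l) = S.
Hypothesis rhol_ext : forall l, pc_extends rho (rhol l).
Hypothesis rhol_inj : forall l l', pc_eq (rhol l) (rhol l') -> l = l'.
Hypothesis S0 : S 0.
Hypothesis indexS : has_index S (pc_lat rho) g.

(** Dedekind's argument: subtracting [pc_val (rhol l0) t] times a relation from its translate by [t]
    kills the coefficient at [l0], but not the one at a character that differs there. *)
Lemma characters_independent (c : 'I_g -> k) :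
  (forall s, S s -> \sum_l c l * pc_val (rhol l) s = 0) -> forall l, c l = 0.
Proof.
move: {2}(#|_|) (leqnn #|[set l | c l != 0]%SET|) => d.
elim: d c => [|d IH] c.
  by rewrite leqn0 cards_eq0 => /eqP/setP c0 _ l; have := c0 l; rewrite !inE => /negbFE/eqP.
move=> szc rel l0; apply/eqP/negPn/negP => cl0.
have [l1 /andP[l10 cl1]|nex] := pickP (fun l => (l != l0) && (c l != 0)).
  have [t [St neq]] : exists t : 'rV[int]_n, S t /\ pc_val (rhol l1) t != pc_val (rhol l0) t.
    apply: contrapT => nex; move/eqP: l10; apply; apply: rhol_inj.
    have eqv s : S s -> pc_val (rhol l1) s = pc_val (rhol l0) s.
      by move=> Ss; apply/eqP/negPn/negP => ne; apply: nex; exists s.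
    by split; split=> [|s]; rewrite !rholS // => /eqv.
  pose c' l := c l * (pc_val (rhol l) t - pc_val (rhol l0) t).
  have c'0 : forall l, c' l = 0.
    apply: IH.
      rewrite -ltnS; apply: leq_trans szc; apply: proper_card; apply/properP; split.
        by apply/fintype.subsetP => l; rewrite !inE; apply: contraNneq => c0;
           rewrite /c' c0 mul0r.
      by exists l0; rewrite inE // /c' subrr mulr0 eqxx.
    move=> s Ss.
    rewrite (eq_bigr (fun l => c l * pc_val (rhol l) (t + s)
                      - pc_val (rhol l0) t * (c l * pc_val (rhol l) s))); last first.
      by move=> l _; rewrite pc_mul ?rholS // /c'; ring.
    rewrite sumrB -mulr_sumr !rel ?mulr0 ?subr0 //.
    by rewrite -(rholS l0) in St Ss *; apply: pc_latD.
  by have /eqP := c'0 l1; rewrite mulf_eq0 (negPf cl1) subr_eq0 (negPf neq).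
have := rel 0 S0; rewrite (bigD1 l0) //= big1 ?addr0 => [|l ll0].
  by rewrite pc_val0 mulr1 => /eqP; rewrite (negPf cl0).
by have := nex l; rewrite ll0 /= => /negbFE/eqP->; rewrite mul0r.
Qed.

Lemma S_ZDelta : S `<=` ZDelta Delta.
Proof.
have [r [rS rP]] := indexS; move=> s Ss; have [l _] := rP s Ss.
by rewrite -(rholS l) in Ss; apply: pc_ZDelta Ss.
Qed.

(* Up to a monomial and scalars, the [h l] are the idempotents of the twisted group
   algebra of [S / L_rho]. *)
Lemma splitting_exists : exists (h : 'I_g -> {mpoly k[n]}) d, [/\ N d,
  \sum_l h l = 'X_[d] &
  forall l e, lattice_binomials (rhol l) e -> lattice_ideal_ext rho (e * h l)].
Proof.
have [r [rS rP]] := indexS.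
have [p pP] := choice (fun j => ZDeltaP (S_ZDelta (rS j))).
have [q {}pP] := choice pP.
(* There are as many extensions as cosets, so the table of values is square; independence of the
   characters makes it invertible. *)
pose A : 'M[k]_g := \matrix_(l, j) pc_val (rhol l) (r j).
have unitA : A \in unitmx.
  rewrite -row_free_unit -kermx_eq0; apply/eqP/row_matrixP => i.
  rewrite row0; have : row i (kermx A) *m A = 0 by rewrite -row_mul mulmx_ker row0.
  set c := row i _ => cA; apply/rowP => l; rewrite [RHS]mxE.
  apply: (characters_independent (c := c 0)) => s Ss.
  have [j [Lsj _]] := rP s Ss.
  rewrite (eq_bigr (fun l => pc_val rho (s - r j) * (c 0 l * A l j))); last first.
    move=> l' _; have [_ <-] // := rhol_ext l'.
    rewrite !mxE mulrCA -pc_mul ?rholS ?addrK ?subrK //.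
    by rewrite -(rholS l'); apply: (rhol_ext l').1.
  rewrite -mulr_sumr; move/rowP: cA => /(_ j); rewrite !mxE => ->.
  by rewrite mulr0.
(* [j0] is the coset of [0]; the row of the inverse at [j0] combines the characters into the
   indicator of that coset. *)
have [j0 _] := rP 0 S0.
pose c := row j0 (invmx A).
have cA j : \sum_l c 0 l * pc_val (rhol l) (r j) = (j0 == j)%:R.
  have /matrixP/(_ j0 j) := mulVmx unitA; rewrite !mxE => <-.
  by apply: eq_bigr => l _; rewrite !mxE.
(* [e j] represents [D - r j]; [D] is large enough to keep all these exponents nonnegative. *)
pose D := (\sum_j p j)%MM; pose e j := (D - p j + q j)%MM.
have pN j : N (p j) by case: (pP j).
have qN j : N (q j) by case: (pP j).
have DN : N D by apply: (big_ind N) => [||//]; [exact: NDelta0|move=> ? ?; exact: NDeltaD].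
have eN j : N (e j).
  by apply: NDeltaD => //; apply: NDelta_mono DN; apply: lem_subr.
have pD j : (p j <= D)%MM.
  by apply/mnm_lepP => i; rewrite /D mnm_sumE (bigD1 j) //= leq_addr.
have er j : mdiff (e j) D = - r j.
  have [_ _ ->] := pP j; rewrite mdiffN; apply/rowP => i.
  have /mnm_lepP/(_ i) := pD j; rewrite !mdiffE /e mnmDE mnmBE.
  by lia.
exists (fun l => c 0 l *: \sum_j pc_val (rhol l) (r j) *: 'X_[e j]), (e j0).
split=> //.
  under eq_bigr do rewrite scaler_sumr.
  rewrite exchange_big /= (bigD1 j0) //= [X in _ + X]big1 => [|j jj0].
    rewrite addr0; under eq_bigr do rewrite scalerA.
    by rewrite -scaler_suml cA eqxx scale1r.
  under eq_bigr do rewrite scalerA.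
  by rewrite -scaler_suml cA eq_sym (negPf jj0) scale0r.
move=> l _ [u [v [Nu Nv Luv ->]]].
have idR := is_ideal_lattice_ext rho.
rewrite -scalerAr; apply: idealZ => //.
set s := mdiff u v in Luv *; set x := pc_val (rhol l) s.
have Ss : S s by rewrite -(rholS l).
have latS : is_lattice S by rewrite -(rholS l); apply: pc_lattice.
have latL := pc_lattice rho.
(* Translation by [- s] permutes the cosets. Reindexing one sum by this permutation pairs the terms
   of the product into multiples of binomials of [rho]. *)
have [sg sgP] := choice (fun j => rP _ (latticeB latS (rS j) Ss)).
have sg_inj : injective sg.
  move=> j j' sgE; have [Lj _] := sgP j; have [Lj' _] := sgP j'.
  have [i [_ uniq_i]] := rP _ (rS j).
  rewrite -(uniq_i j) ?subrr; last exact: lattice0.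
  apply: uniq_i; rewrite sgE in Lj.
  have := latticeB latL Lj Lj'.
  by rewrite opprB addrA subrK opprB addrA subrK.
rewrite mulrBl mulr_sumr -scalerAl mulr_sumr scaler_sumr.
rewrite [X in _ - X](reindex_inj sg_inj) /= -sumrB.
apply: ideal_sum => // j _.
have [Lj _] := sgP j.
have md : mdiff (u + e j)%MM (v + e (sg j))%MM = - (r j - s - r (sg j)).
  have -> : mdiff (u + e j)%MM (v + e (sg j))%MM
            = s + (mdiff (e j) D - mdiff (e (sg j)) D).
    by rewrite mdiffN mdiff_trans mdiffD.
  by rewrite !er opprK !opprB addrA addrC.
have Lmd : pc_lat rho (mdiff (u + e j)%MM (v + e (sg j))%MM).
  by rewrite md; apply: latticeN.
have valE : pc_val (rhol l) (r j) * pc_val rho (mdiff (u + e j)%MM (v + e (sg j))%MM)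
    = x * pc_val (rhol l) (r (sg j)).
  have [sub ext] := rhol_ext l; rewrite -ext // -!pc_mul ?rholS //.
    by congr (pc_val _ _); rewrite md !opprB addrC -addrA subrK addrC.
  by rewrite -(rholS l); apply: sub.
rewrite -!scalerAr -!mpolyXD scalerA -valE -scalerA -scalerBr.
apply: idealZ => //; apply/lattice_ideal_sub_ext/lattice_binomials_sub.
by apply: lattice_binomialsX => //; apply: NDeltaD.
Qed.

Lemma sat_sum_split (I : set {mpoly k[n]}) (M : set {mpoly k[n]}) f :
    is_ideal I -> is_ideal M ->
    (forall l, ideal_add (sat_sum I (rhol l)) M f) ->
  exists2 d, N d & ideal_add (sat_sum I rho) M (f * 'X_[d]).
Proof.
move=> idI idM fl; have [h [d [Nd sumh hP]]] := splitting_exists.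
have idJ := is_ideal_sat_sum rho idI.
exists d => //; rewrite -sumh mulr_sumr; apply: ideal_sum => [|l _].
  exact: is_ideal_add.
have [j Kj [mu Mmu ->]] := fl l; exists (j * h l); last first.
  by exists (mu * h l); [apply: ideal_mulr|rewrite mulrDl].
have /sat_sumP[//|u Nu [f1 If1 [f2 ef2 E]]] := Kj.
apply/sat_sumP => //; exists u => //; rewrite mulrAC E mulrDl.
exists (f1 * h l); first exact: ideal_mulr.
exists (f2 * h l) => //; move: ef2; rewrite lattice_ideal_extE.
apply: (ideal_gen_min (I := ideal_colon (lattice_ideal_ext rho) (h l))).
  exact/is_ideal_colon/is_ideal_lattice_ext.
exact: hP.
Qed.

End Splitting.

(** * The part of the saturation prime to the characteristic *)

Section PrimePart.
Variables (n : nat) (Delta : {set 'I_n}) (L : set 'rV[int]_n) (p : nat).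
Hypotheses (latL : is_lattice L) (ZL : L `<=` ZDelta Delta).
Implicit Types (S : set 'rV[int]_n) (x y : 'rV[int]_n).

Lemma is_lattice_Sat : is_lattice (Sat Delta L).
Proof.
apply: is_latticeI => [|x y /SatP-/(_ latL)[Zx Lx] /SatP-/(_ latL)[Zy Ly]]; apply/SatP => //.
  by split=> [i _|]; [rewrite mxE|apply: sub_rat_sat; apply: lattice0].
split; first by move=> i iD; rewrite !mxE Zx ?Zy.
by apply: rat_satD => //; apply: rat_satN.
Qed.

Lemma is_Sat'_lattice S : is_Sat' p Delta L S -> [/\ is_lattice S, L `<=` S &
  forall x, S x -> rat_sat L x].
Proof.
rewrite /is_Sat'; case: eqP => [_ ->|_ [[latS LS SSat _] _]].
  split; [exact: is_lattice_Sat| |by move=> x /SatP-/(_ latL)[]].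
  by move=> x Lx; apply/SatP => //; split; [exact: ZL|exact: sub_rat_sat].
by split=> // x /SSat/SatP-/(_ latL)[].
Qed.

Lemma is_Sat'_uniq S S' : is_Sat' p Delta L S -> is_Sat' p Delta L S' -> S = S'.
Proof.
rewrite /is_Sat'; case: eqP => [_ -> ->//|_ [oS maxS] [oS' maxS']].
by apply/seteqP; split; [apply: maxS'|apply: maxS].
Qed.

Lemma has_index_card S (T : finType) (r : T -> 'rV[int]_n) : (forall i, S (r i)) ->
  (forall u, S u -> exists! i, L (u - r i)) -> has_index S L #|T|.
Proof.
move=> rS rP; exists (fun i => r (enum_val i)); split=> // u /rP[i [Li uniq_i]].
exists (enum_rank i); split=> [|j Lj]; first by rewrite enum_rankK.
by rewrite (uniq_i _ Lj) enum_valK.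
Qed.

(** The order [d] of [v] modulo [S] divides [N0], so it is prime to [p]. Adjoining [v] multiplies
    the index by [d], the new representatives being [r i + v *+ j] with [j < d]. *)
Lemma overlattice_extend S v N0 : prime_to_p_overlattice p Delta L S ->
  Sat Delta L v -> (0 < N0)%N -> coprime N0 p -> S (v *+ N0) ->
  exists2 S', prime_to_p_overlattice p Delta L S' & S' v.
Proof.
move=> [latS LS SSat [g [r [rS rP]] cop_g]] Satv N0_gt0 copN SvN.
have exd : exists d, (0 < d)%N && `[< S (v *+ d) >].
  by exists N0; rewrite N0_gt0; apply/asboolP.
case: (ex_minnP exd) => d /andP[d0 /asboolP Svd] mind.
have small j : (j < d)%N -> S (v *+ j) -> j = 0%N.
  case: j => // j ltj Sj; have : (d <= j.+1)%N by apply: mind; apply/asboolP.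
  by rewrite leqNgt ltj.
have dN : (d %| N0)%N.
  apply/eqP/small; first by rewrite ltn_mod.
  have -> : v *+ (N0 %% d) = v *+ N0 - (v *+ d) *+ (N0 %/ d).
    by rewrite -mulrnA mulnC {2}(divn_eq N0 d) mulrnDr addrC addKr.
  by apply: latticeB => //; apply: latticeMn.
pose S' := [set x : 'rV[int]_n | exists s (z : int), S s /\ x = s + v *~ z].
exists S'; last by exists 0, 1; rewrite add0r mulr1z; split=> //; apply: lattice0.
have latSat := is_lattice_Sat.
have subS' : S `<=` S' by move=> x Sx; exists x, 0; rewrite mulr0z addr0.
split.
- apply: is_latticeI => [|_ _ [s [z [Ss ->]]] [s' [z' [Ss' ->]]]].
    by apply: subS'; apply: lattice0.
  exists (s - s'), (z - z'); split; first exact: latticeB.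
  by rewrite mulrzBr opprD addrACA.
- by move=> x /LS/subS'.
- move=> _ [s [z [/SSat Ss ->]]]; apply: latticeD => //.
  exact: latticeMz.
exists (g * d)%N; last by rewrite coprimeMl cop_g (coprime_dvdl dN).
pose rr (i : 'I_g * 'I_d) := r i.1 + v *+ i.2.
have -> : (g * d)%N = #|{: 'I_g * 'I_d}| by rewrite card_prod !card_ord.
apply: (@has_index_card _ _ rr) => [i|_ [s [z [Ss ->]]]].
  by exists (r i.1), (Posz i.2).
have dz0 : (d : int) != 0 by rewrite -lt0n.
pose jz := (z %% d)%Z.
have jz0 : 0 <= jz by rewrite modz_ge0.
have jzd : (`|jz| < d)%N.
  by rewrite -ltz_nat gez0_abs // ltz_mod.
pose s' := s + (v *+ d) *~ (z %/ d)%Z.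
have Ss' : S s' by apply: latticeD => //; apply: latticeMz.
have E : s + v *~ z = s' + v *+ `|jz|%N.
  rewrite /s' -addrA; congr (_ + _).
  rewrite [v *+ `|jz|%N]pmulrn gez0_abs // /jz {1}(divz_eq z d) mulrzDr; congr (_ + _).
  by rewrite pmulrn -mulrzA mulrC.
have [i [Li uniq_i]] := rP _ Ss'.
exists (i, Ordinal jzd); split=> [|[i' j'] /=].
  by rewrite /rr /= E opprD addrACA subrr addr0.
rewrite /rr /= E => Lij'.
have SD : S (v *+ `|jz| - v *+ j').
  have -> : v *+ `|jz| - v *+ j' = s' + v *+ `|jz| - (r i' + v *+ j') - (s' - r i').
    by rewrite [- (r i' + _)]opprD addrACA [RHS]addrAC subrr add0r.
  by apply: latticeB => //; [apply: LS|apply: latticeB].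
have jE : `|jz|%N = j'.
  have [ltj|gej] := leqP j' `|jz|%N.
    move: SD; rewrite -mulrnBr // => /small; rewrite (leq_ltn_trans (leq_subr _ _)) //.
    by move=> /(_ isT) /eqP; rewrite subn_eq0 => le; apply/eqP; rewrite eqn_leq le.
  move: SD; rewrite -opprB => /(latticeN latS); rewrite opprK.
  rewrite -mulrnBr ?(ltnW gej) // => /small.
  rewrite (leq_ltn_trans (leq_subr _ _)) // => /(_ isT) /eqP.
  by rewrite subn_eq0 => le; apply/eqP; rewrite eqn_leq le ltnW.
congr (_, _); last exact: val_inj.
by apply: uniq_i; move: Lij'; rewrite jE opprD addrACA subrr addr0.
Qed.

(** If [x *+ N0] is in [L], multiplying [x] by the [p]-part of [N0] leaves a vector whose order
    modulo [L] is prime to [p]; maximality of [S] absorbs it. *)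
Lemma is_Sat'_power S : (p == 0%N) || prime p -> is_Sat' p Delta L S ->
  forall x, ZDelta Delta x -> rat_sat L x ->
  exists e, S (x *+ ((if p == 0%N then 1%N else p) ^ e)%N).
Proof.
rewrite /is_Sat'; case: eqP => [_ _ -> x Zx Lx|p0 /= p_pr [oS maxS] x Zx [N0 N0_gt0 LN]].
  by exists 0%N; apply/SatP.
exists (logn p N0); have [latS LS _ _] := oS.
have N0E : N0 = (p ^ logn p N0 * N0`_p^')%N by rewrite -p_part partnC.
have latSat := is_lattice_Sat.
have [||||S' /maxS sub] := @overlattice_extend S (x *+ (p ^ logn p N0)) N0`_p^' oS.
- apply: latticeMn => //; apply/SatP => //; split=> //.
  by exists N0.
- exact: part_gt0.
- by rewrite coprime_sym prime_coprime // -p'natE // part_pnat.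
- by rewrite -mulrnA -N0E; apply: LS.
exact: sub.
Qed.

End PrimePart.

Section Primary.
Variables (k : fieldType) (n : nat) (Delta : {set 'I_n}) (p : nat).
Hypothesis charp : has_char k p.
Implicit Types (a b t u v w z m : 'X_{1..n}) (f g h : {mpoly k[n]}).

Local Notation N := (NDelta Delta).
(** The characteristic exponent: [q ^ e] is [1] in characteristic zero. *)
Local Notation q := (if p == 0%N then 1%N else p).

Lemma char_prime : (p == 0%N) || prime p.
Proof. by move: charp; rewrite /has_char; case: eqP => //= _ /andP[]. Qed.

Lemma Frobenius_power (e : nat) g :
  g ^+ (q ^ e)%N = \sum_(u <- msupp g) g@_u ^+ (q ^ e)%N *: 'X_[u *+ (q ^ e)%N].
Proof.
have qD : forall f h, (f + h) ^+ (q ^ e)%N = f ^+ (q ^ e)%N + h ^+ (q ^ e)%N.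
  move: charp; rewrite /has_char; case: eqP => [_ _ f h|_ pk f h].
    by rewrite exp1n !expr1.
  apply: exprDn_pchar; rewrite pnatX; apply/orP; left.
  have p_pr : prime p by case/andP: pk.
  by rewrite pnatE // (pchar_lalg {mpoly k[n]}).
have q0 : (0 < q ^ e)%N.
  by rewrite expn_gt0; have := char_prime; case: eqP => //= _ /prime_gt0->.
have q00 : 0 ^+ (q ^ e)%N = 0 :> {mpoly k[n]} by rewrite expr0n eqn0Ngt q0.
rewrite {1}[g]mpolyE (big_morph (fun f => f ^+ (q ^ e)%N) qD q00).
by apply: eq_bigr => u _; rewrite exprZn mpolyXn.
Qed.

End Primary.

(** * The components are primary *)

Section PrimaryComponent.
Variables (k : fieldType) (n : nat) (Delta : {set 'I_n}) (p : nat).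
Hypothesis charp : has_char k p.
Variable I : set {mpoly k[n]}.
Hypotheses (cellI : cellular Delta I) (grI : class_graded I).
Variable rho : 'X_{1..n} -> partial_char k Delta.
Hypothesis rhoP : forall m, M_index Delta I m ->
  ideal_colon I 'X_[m] `&` polyN Delta = lattice_ideal (rho m).
Variables (m0 : 'X_{1..n}) (S : set 'rV[int]_n) (sigma : partial_char k Delta).
Hypotheses (Mm0 : M_index Delta I m0) (SatS : is_Sat' p Delta (pc_lat (rho m0)) S).
Hypotheses (sigmaS : pc_lat sigma = S) (sigma_ext : pc_extends (rho m0) sigma).
Implicit Types (a b t u v w z m : 'X_{1..n}) (f g h : {mpoly k[n]}).

Local Notation N := (NDelta Delta).
Local Notation q := (if p == 0%N then 1%N else p).
Local Notation L := (pc_lat (rho m0)).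

Let K := sat_sum I sigma.
Let J := sat_sum I (rho m0).
Let M := M_emb Delta J.
Let Q := ideal_add K M.

Let idI : is_ideal I. Proof. by case: cellI. Qed.
Let nI1 : ~ I 1. Proof. by case: cellI. Qed.
Let satI : saturated Delta I. Proof. exact: cellular_saturated. Qed.
Let idK : is_ideal K. Proof. exact: is_ideal_sat_sum. Qed.
Let idJ : is_ideal J. Proof. exact: is_ideal_sat_sum. Qed.
Let satK : saturated Delta K. Proof. exact: sat_sum_saturated. Qed.
Let satJ : saturated Delta J. Proof. exact: sat_sum_saturated. Qed.
Let grJ : class_graded J. Proof. exact: sat_sum_graded. Qed.
Let grK : class_graded K. Proof. exact: sat_sum_graded. Qed.
Let idM : is_ideal M. Proof. exact: is_ideal_M_emb. Qed.
Let idQ : is_ideal Q. Proof. exact: is_ideal_add. Qed.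
Let KQ : K `<=` Q. Proof. exact: sub_ideal_addl. Qed.
Let MQ : M `<=` Q. Proof. exact: sub_ideal_addr. Qed.
Let IK : I `<=` K. Proof. exact: sub_sat_sum. Qed.
Let IJ : I `<=` J. Proof. exact: sub_sat_sum. Qed.
Let latL : is_lattice L. Proof. exact: pc_lattice. Qed.

Let ext_sigma : lattice_ideal_ext (rho m0) `<=` lattice_ideal_ext sigma.
Proof.
have [sub ext] := sigma_ext.
apply: lattice_ext_min; first exact: is_ideal_lattice_ext.
move=> _ [u [v [Nu Nv Luv ->]]]; rewrite -ext //.
by apply/lattice_ideal_sub_ext/lattice_binomials_sub/lattice_binomialsX => //; apply: sub.
Qed.

Let JK : J `<=` K.
Proof.
apply: sat_sum_min => // f /lattice_ideal_sub_ext/ext_sigma.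
exact: ext_sub_sat_sum.
Qed.

Let S_rat_sat x : S x -> rat_sat L x.
Proof. by have [_ _] := is_Sat'_lattice latL (@pc_ZDelta _ _ _ _) SatS; apply. Qed.

Let J_polyN : J `&` polyN Delta = lattice_ideal (rho m0).
Proof. exact: sat_sum_polyN. Qed.

Let W : set 'X_{1..n} := [set w | ~ K 'X_[w] /\ ~ M 'X_[w]].

Let nK_shift w t : N t -> ~ K 'X_[w] -> ~ K 'X_[t + w].
Proof. by move=> Nt nKw /(saturated_mono satK Nt). Qed.

(** [M] is built from [J], not from [K], so the congruence modulo [K] is first lifted by
    [sat_sum_mcong] to one modulo [I], at the price of extra monomials in the variables of Delta. *)
Let W_mcong w z t t' : N t -> N t' -> W w -> mcong K (t' + z)%MM (t + w)%MM -> W z.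
Proof.
move=> Nt Nt' [nKw nMw] zw; split.
  move=> Kz; apply: (nK_shift Nt nKw); apply: mcong_mem zw _ => //.
  by rewrite mpolyXD; apply: ideal_mull.
move=> Mz; apply: nMw.
have [s [s' [Ns Ns' _]]] := sat_sum_mcong idI satI grI (nK_shift Nt nKw) zw.
rewrite !addmA => zw'.
apply: (M_emb_mcong (K := J) (rho := rho m0) (t := s + t) (t' := s' + t')) Mz => //.
- exact: NDeltaD.
- exact: NDeltaD.
- by move/JK.
- exact: mcong_sub zw'.
Qed.

(** The same lifting changes [t - t'] by a vector of [S], which is harmless because [S] is inside
    the saturation of [L]. *)
Let W_sat w t t' : N t -> N t' -> W w -> mcong K (t + w)%MM (t' + w)%MM ->
  rat_sat L (mdiff t t').
Proof.
move=> Nt Nt' [nKw nMw] tw.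
have [s [s' [Ns Ns' Sss']]] := sat_sum_mcong idI satI grI (nK_shift Nt' nKw) tw.
rewrite !addmA ![(_ + w)%MM]addmC => /(mcong_sub IJ) sw.
have nJw : ~ J 'X_[w] by move/JK.
have := M_emb_rat_sat idJ satJ grJ nJw J_polyN nMw (NDeltaD Ns' Nt) (NDeltaD Ns Nt') sw.
rewrite mdiffD => H; rewrite -[mdiff t t'](addKr (mdiff s' s)) mdiffN.
apply: rat_satD => //; apply: S_rat_sat.
by rewrite -sigmaS.
Qed.

Let Q_vanish w f : W w -> Q f -> K (mproj [set z | mcong K z w] f).
Proof.
move=> Ww [j Kj [mu Mmu ->]]; rewrite mprojD (M_emb_mproj Mmu).
  by rewrite addr0; apply: grK => //; apply: mcong_closed_class.
move=> z zw; apply: (W_mcong (@NDelta0 _ _) (@NDelta0 _ _) Ww _).2.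
exact: mcong_add.
Qed.

Let Q_detect f : ~ Q f -> detected K W f.
Proof.
move=> nQf; have [w [_ nQw nQp]] := class_detect idK idQ KQ nQf.
exists w; last by move/KQ.
by split=> [/KQ|/MQ].
Qed.

Let top_term_regular E h u f : lattice_complement Delta L E ->
  top_term Delta E L h u -> Q (h * f) -> Q f.
Proof.
move=> compE th Qhf; apply: contrapT => /Q_detect df.
have [w Ww] := detected_top_term latL compE idK satK W_mcong W_sat th df.
by apply; apply: Q_vanish.
Qed.

Let uniform_power (s : seq 'rV[int]_n) : exists e, forall x, x \in s ->
  ZDelta Delta x -> rat_sat L x -> S (x *+ (q ^ e)%N).
Proof.
have [latS _ _] := is_Sat'_lattice latL (@pc_ZDelta _ _ _ _) SatS.
elim: s => [|x s [e IH]]; first by exists 0%N.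
have [[Zx Lx]|nx] := pselect (ZDelta Delta x /\ rat_sat L x); last first.
  exists e => y; rewrite inE => /predU1P[-> Zx Lx|]; last exact: IH.
  by case: nx.
have [e' Sx] := is_Sat'_power latL (char_prime charp) SatS Zx Lx.
exists (e' + e)%N => y; rewrite expnD inE => /predU1P[-> _ _|ys Zy Ly].
  by rewrite mulrnA; apply: latticeMn.
by rewrite mulnC mulrnA; apply: latticeMn => //; apply: IH.
Qed.

(* Once a power [p ^ e] has moved the differences of exponents from the saturation
   into [S], monomials with the same image modulo the saturation can be merged. *)
Let collapse h : polyN Delta h ->
    (forall u v, u \in msupp h -> v \in msupp h -> rat_sat L (mdiff u v) -> S (mdiff u v)) ->
  exists h', [/\ lattice_ideal_ext sigma (h - h'), polyN Delta h' &
    forall u v, u \in msupp h' -> v \in msupp h' -> rat_sat L (mdiff u v) -> u = v].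
Proof.
have idE := is_ideal_lattice_ext sigma.
move: {2}(size _) (leqnn (size (msupp h))) => d; elim: d h => [|d IH] h szh Nh Sh.
  exists h; rewrite subrr; split=> //; first exact: ideal_0.
  by move: szh; rewrite leqn0 size_eq0 => /eqP-> u v.
have [[u [v [uh vh Luv neq]]]|nex] := pselect (exists u v,
    [/\ u \in msupp h, v \in msupp h, rat_sat L (mdiff u v) & u != v]); last first.
  exists h; rewrite subrr; split=> //; first exact: ideal_0.
  move=> u v uh vh Luv; apply/eqP/negPn/negP => neq.
  by apply: nex; exists u, v.
pose b : {mpoly k[n]} := 'X_[u] - pc_val sigma (mdiff u v) *: 'X_[v].
have Bb : lattice_ideal_ext sigma b.
  apply/lattice_ideal_sub_ext/lattice_binomials_sub/lattice_binomialsX.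
  - exact: Nh.
  - exact: Nh.
  - by rewrite sigmaS; apply: Sh.
pose h1 := h - h@_u *: b.
have sub : {subset msupp h1 <= rem u (msupp h)}.
  move=> z; rewrite mcoeff_msupp /h1 mcoeffB mcoeffZ /b mcoeffB mcoeffZ !mcoeffX => hz.
  rewrite (rem_filter _ (msupp_uniq h)) mem_filter /=.
  have zu : z != u.
    apply: contraNneq hz => ->; rewrite eqxx [v == u]eq_sym (negPf neq).
    by rewrite mulr0 subr0 mulr1 subrr.
  rewrite zu /=; have [<-//|vz] := eqVneq v z.
  move: hz; rewrite (negPf vz) [u == z]eq_sym (negPf zu) mulr0 subr0 mulr0 subr0.
  by rewrite -mcoeff_msupp.
have sub' z : z \in msupp h1 -> z \in msupp h by move/sub/mem_rem.
have [||z zh1|h' [Eh' Nh' uh']] := IH h1.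
- rewrite -ltnS; apply: leq_trans szh.
  rewrite (perm_size (perm_to_rem uh)) /= ltnS.
  exact: uniq_leq_size (msupp_uniq _) sub.
- by move=> z /sub'/Nh.
- by move=> y /sub' yh; apply: Sh => //; apply: sub'.
exists h'; split=> //.
have -> : h - h' = (h1 - h') + h@_u *: b by rewrite /h1 addrAC subrK.
by apply: idealD => //; apply: idealZ.
Qed.

(** One exponent [e] serves all differences of exponents of [g]. After [collapse], distinct
    exponents differ modulo the saturation, so the order is total on the support and a maximal
    exponent is a leading one. *)
Let polyN_regular_or_nilpotent g f : polyN Delta g -> Q (g * f) -> Q f \/ radical Q g.
Proof.
move=> Ng Qgf.
have [e eP] := uniform_power [seq mdiff u v | u <- msupp g, v <- msupp g].
set qe := (q ^ e)%N in eP.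
have supp z : z \in msupp (g ^+ qe) -> exists2 u, u \in msupp g & z = (u *+ qe)%MM.
  rewrite (Frobenius_power charp) => /msupp_sum_le/flattenP[s /mapP[u ug ->]].
  move/msuppZ_le; rewrite msuppX inE => /eqP->; exists u => //.
  by move: ug; rewrite mem_filter.
have [||h' [Eh' Nh' uh']] := @collapse (g ^+ qe).
- by move=> z /supp[u /Ng Nu ->]; apply: NDeltaMn.
- move=> _ _ /supp[u ug ->] /supp[v vg ->]; rewrite mdiffMn => Luv.
  apply: eP.
  + by apply/allpairsP; exists (u, v).
  + by apply: mdiff_ZDelta; apply: Ng.
  + apply: rat_sat_idem; exists qe => //.
    rewrite /qe expn_gt0; have := char_prime charp.
    by case: eqP => //= _ /prime_gt0->.
have EQ : Q (g ^+ qe - h') by apply/KQ/ext_sub_sat_sum.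
have [h'0|h'0] := eqVneq h' 0.
  by right; exists qe; move: EQ; rewrite h'0 subr0.
left; have [E compE] := lattice_complement_exists Delta latL.
have [u [uh _ maxu]] : exists u, [/\ u \in msupp h', True &
    forall v, v \in msupp h' -> True -> ~ Pos L E (mdiff v u)].
  apply: (exists_maximal (R := fun u v => Pos L E (mdiff v u))) => //.
  - move=> u _; rewrite mdiffxx => /(Pos_rat_sat latL compE); apply.
    by apply: sub_rat_sat; apply: lattice0.
  - by move=> u v w Pvu Pwv; rewrite -(mdiff_trans v); apply: PosD.
  - by exists (mlead h') => //; apply: mlead_supp.
have th : top_term Delta E L h' u.
  split=> // v vh vu.
  case: (Pos_total latL compE (mdiff_ZDelta (Nh' _ uh) (Nh' _ vh))) => [//||].
    by rewrite mdiffN => /(maxu _ vh Logic.I).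
  by move/(uh' _ _ uh vh) => uv; rewrite uv eqxx in vu.
apply: (top_term_regular compE th).
have -> : h' * f = g ^+ qe * f - (g ^+ qe - h') * f by rewrite mulrBl subKr.
apply: idealB => //; last exact: ideal_mulr.
have : (0 < qe)%N.
  by rewrite /qe expn_gt0; have := char_prime charp; case: eqP => //= _ /prime_gt0->.
by case: (qe) => // d _; rewrite exprSr -mulrA; apply: ideal_mull.
Qed.

Let nilpotent_part g : radical Q (mproj (~` N) g).
Proof.
have idR := is_ideal_radical idQ.
rewrite /mproj; apply: ideal_sum => // z /asboolP nNz; apply: idealZ => //.
have [i [iD zi]] : exists i, i \notin Delta /\ z i != 0%N.
  apply: contrapT => nex; apply: nNz => i iD; apply/eqP/negPn/negP => zi.
  by apply: nex; exists i.
have [_ _ _ /(_ i iD)[d Id]] := cellI.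
exists d; rewrite mpolyXn; apply: KQ; apply: IK.
have le : (U_(i) *+ d <= z *+ d)%MM.
  apply/mnm_lepP => j; rewrite !mulmnE mnm1E leq_mul2r; apply/orP; right.
  by case: eqVneq => [<-|//]; rewrite lt0n.
by rewrite -(submK le) mpolyXD -(mpolyXn _ U_(i)); apply: ideal_mull.
Qed.

(** A monomial involving a variable outside Delta is nilpotent modulo [I]. One in the Delta
    variables is not, since by saturation [1] would then be in [I]. *)
Let N_closed : mcong_closed I N.
Proof.
move=> z w [c c0 Ic] Nz; apply: contrapT => nNw.
have [i [iD wi]] : exists i, i \notin Delta /\ w i != 0%N.
  apply: contrapT => nex; apply: nNw => i iD; apply/eqP/negPn/negP => wi.
  by apply: nex; exists i.
have [_ _ _ /(_ i iD)[d Id]] := cellI.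
have rI : radical I ('X_[z] : {mpoly k[n]}).
  have idR := is_ideal_radical idI.
  rewrite -(subrK (c *: 'X_[w]) 'X_[z]); apply: idealD => //; first exact: sub_radical.
  apply: idealZ => //; exists d; rewrite mpolyXn.
  have le : (U_(i) *+ d <= w *+ d)%MM.
    apply/mnm_lepP => j; rewrite !mulmnE mnm1E leq_mul2r; apply/orP; right.
    by case: eqVneq => [<-|//]; rewrite lt0n.
  by rewrite -(submK le) mpolyXD -(mpolyXn _ U_(i)); apply: ideal_mull.
case: rI => d'; rewrite mpolyXn => Iz; apply: nI1.
by apply: (satI (NDeltaMn d' Nz)); rewrite mul1r.
Qed.

(** Projected to [k[N^Delta]], the equation would put a monomial into the lattice ideal of [sigma],
    because the part of [I] in [k[N^Delta]] lies in the lattice ideal of [rho m0]. *)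
Let nK1 : ~ K 1.
Proof.
move=> /sat_sumP[//|d Nd [f1 If1 [f2 ef2]]]; rewrite mul1r => E.
apply: (@lattice_ext_monomial _ _ _ sigma d).
rewrite -(mproj_id (C := N) (f := 'X_[d])); last by move=> z; rewrite msuppX inE => /eqP->.
rewrite E mprojD; apply: idealD; first exact: is_ideal_lattice_ext.
  apply: ext_sigma; apply: lattice_ideal_sub_ext; rewrite -rhoP //; split.
    by apply: ideal_mulr => //; apply: grI.
  by move=> z; rewrite mcoeff_msupp mcoeff_mproj; case: ifP => [/asboolP//|]; rewrite eqxx.
exact/lattice_ideal_sub_ext/mproj_polyN_lattice_ext.
Qed.

Let nM1 : ~ M 1.
Proof.
rewrite -mpolyX0; apply: (@M_emb_free _ _ _ _ (rho m0)) => //.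
  by move=> g Lg; apply: ext_sub_sat_sum => //; apply: lattice_ideal_sub_ext.
move=> a b Na Nb [c c0 Jab]; apply: sub_rat_sat.
have nJ0 : ~ J 'X_[0] by rewrite mpolyX0 => /JK.
have := @lattice_ideal_witness _ _ _ J 0%MM idJ satJ nJ0 (rho m0).
rewrite mpolyX0 ideal_colon1 => /(_ J_polyN) [w1 _].
exact: (w1 _ _ _ Na Nb c0 Jab).1.
Qed.

Lemma component_primary :
  primary_ideal (ideal_add (sat_sum I sigma) (M_emb Delta (sat_sum I (rho m0)))).
Proof.
rewrite -/K -/J -/M -/Q; split=> // [Q1|f g Qfg].
  have W0 : W 0%MM by split; rewrite mpolyX0.
  apply: nK1; have := Q_vanish W0 Q1.
  rewrite mproj_id // => z; rewrite msupp1 inE => /eqP->.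
  exact: mcong_refl.
pose g0 := mproj N g; pose nu := mproj (~` N) g.
have gE : g = g0 + nu by rewrite -mproj_setC.
have [d Qnu] := nilpotent_part g.
have Ng0 : polyN Delta g0.
  by move=> z; rewrite mcoeff_msupp mcoeff_mproj; case: ifP => [/asboolP//|]; rewrite eqxx.
(* Since [f * g] is in [Q], multiplying [f] by [g0] amounts modulo [Q] to multiplying it by [- nu],
   which is nilpotent. *)
have Qdiff j : Q (g0 ^+ j * f - (- nu) ^+ j * f).
  elim: j => [|j IH]; first by rewrite !expr0 subrr; apply: ideal_0.
  have -> : g0 ^+ j.+1 * f - (- nu) ^+ j.+1 * f =
      g0 * (g0 ^+ j * f - (- nu) ^+ j * f) + (- nu) ^+ j * (f * g).
    by rewrite gE !exprS; ring.
  by apply: idealD => //; apply: ideal_mull.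
have Qg0 : Q (g0 ^+ d * f).
  rewrite -(subrK ((- nu) ^+ d * f) (g0 ^+ d * f)); apply: idealD => //.
  by rewrite exprNn; apply: ideal_mulr => //; apply: ideal_mull.
have Ng0d : polyN Delta (g0 ^+ d).
  elim: d {Qnu Qg0} => [|d IH]; first by rewrite expr0; apply: polyN1.
  by rewrite exprS; apply: polyNM.
have [Qf|[d' Qg0d]] := polyN_regular_or_nilpotent Ng0d Qg0; first by left.
right; rewrite gE; apply: idealD; first exact: is_ideal_radical.
  by exists (d * d')%N; rewrite exprM.
by exists d.
Qed.

End PrimaryComponent.

(** * Finiteness of the set of components *)

Section Finiteness.
Variables (k : fieldType) (n : nat) (Delta : {set 'I_n}) (I : set {mpoly k[n]}).
Hypotheses (cellI : cellular Delta I).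
Variable rho : 'X_{1..n} -> partial_char k Delta.
Hypothesis rhoP : forall m, M_index Delta I m ->
  ideal_colon I 'X_[m] `&` polyN Delta = lattice_ideal (rho m).
Variables (p : nat) (g : 'X_{1..n} -> nat) (rhol : forall m, 'I_(g m) -> partial_char k Delta).
Arguments rhol : clear implicits.
Hypothesis rholP : forall m, M_index Delta I m -> attached_chars p (rho m) (rhol m).
Implicit Types (a b t u v w z m : 'X_{1..n}) (f h : {mpoly k[n]}).

Local Notation M_emb K := (M_emb Delta K).
Local Notation nilpart m := (Delta_part (~: Delta) m).

Let idI : is_ideal I. Proof. by case: cellI. Qed.
Let nI1 : ~ I 1. Proof. by case: cellI. Qed.
Let satI : saturated Delta I. Proof. exact: cellular_saturated. Qed.

Lemma eq_lattice_ideal_sat_sum (tau tau' : partial_char k Delta) :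
  lattice_ideal tau = lattice_ideal tau' -> sat_sum I tau = sat_sum I tau'.
Proof. by rewrite /sat_sum /lattice_ideal_ext => ->. Qed.

Lemma pc_eq_lattice_ideal (tau tau' : partial_char k Delta) :
  pc_eq tau tau' -> lattice_ideal tau = lattice_ideal tau'.
Proof.
move=> [[sub ext] [sub' ext']]; congr ideal_gen_in; apply/seteqP.
by split=> _ [u [v [Nu Nv Luv ->]]]; exists u, v; split=> //;
  [exact: sub|rewrite ext|exact: sub'|rewrite ext'].
Qed.

Lemma lattice_ideal_extends m (tau tau' : partial_char k Delta) : ~ I 'X_[m] ->
    ideal_colon I 'X_[m] `&` polyN Delta = lattice_ideal tau' ->
    lattice_ideal tau `<=` lattice_ideal tau' -> pc_extends tau tau'.
Proof.
move=> nIm defT' sub.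
have [w1 _] := lattice_ideal_witness idI satI nIm defT'.
have ext (u : 'rV[int]_n) : pc_lat tau u -> pc_lat tau' u /\ pc_val tau' u = pc_val tau u.
  move=> Lu; have [a [b [Na Nb uE]]] := ZDeltaP (pc_ZDelta Lu).
  rewrite uE in Lu *; apply: w1 => //; first exact: pc_unit.
  have := sub _ (lattice_binomials_sub (lattice_binomialsX Na Nb Lu)).
  rewrite -defT' => -[+ _].
  by rewrite /ideal_colon /= mulrBl -scalerAl -!mpolyXD ![(_ + m)%MM]addmC.
by split=> u /ext[].
Qed.

Lemma colon_nilpart m : ideal_colon I 'X_[m] = ideal_colon I 'X_[nilpart m].
Proof.
have mE : 'X_[m] = 'X_[Delta_part Delta m] * 'X_[nilpart m] :> {mpoly k[n]}.
  by rewrite -mpolyXD Delta_part_add.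
apply/seteqP; split=> f; rewrite /ideal_colon /= mE.
  by rewrite mulrCA mulrC => /satI; apply; apply: NDelta_part.
by move=> If; rewrite mulrCA; apply: ideal_mull.
Qed.

Let comp m l := ideal_add (sat_sum I (rhol m l)) (M_emb (sat_sum I (rho m))).
Arguments comp : clear implicits.

(** Both indices give the same colon ideal, hence the same character and the same overlattice. Their
    extensions may be listed in different orders, so [l'] comes from the completeness of the second
    list. *)
Lemma component_nilpart m m' l : M_index Delta I m -> M_index Delta I m' ->
  nilpart m = nilpart m' -> exists l', comp m l = comp m' l'.
Proof.
move=> Mm Mm' nE.
have latE : lattice_ideal (rho m) = lattice_ideal (rho m').
  by rewrite -!rhoP // colon_nilpart nE -colon_nilpart.
have ext : pc_extends (rho m) (rho m').
  apply: (lattice_ideal_extends (M_index_nmem nI1 Mm') (rhoP Mm')).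
  by rewrite latE.
have ext' : pc_extends (rho m') (rho m).
  apply: (lattice_ideal_extends (M_index_nmem nI1 Mm) (rhoP Mm)).
  by rewrite latE.
have LE : pc_lat (rho m) = pc_lat (rho m').
  by apply/seteqP; split; [apply: ext.1|apply: ext'.1].
have [S [SatS _ lS _ _]] := rholP Mm; have [S' [SatS' _ _ _ complete]] := rholP Mm'.
have SS' : S = S' by rewrite LE in SatS; apply: is_Sat'_uniq SatS SatS'.
have [lSl extl] := lS l.
have [||l' eql] := complete (rhol m l); first by rewrite lSl.
  have [sub val] := extl; have [sub' val'] := ext'.
  by split=> u Lu; [apply/sub/sub'|rewrite val ?val' //; apply: sub'].
exists l'; rewrite /comp (eq_lattice_ideal_sat_sum latE).
by rewrite (eq_lattice_ideal_sat_sum (pc_eq_lattice_ideal eql)).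
Qed.

Lemma exponent_bound : exists A : nat, forall m i, ~ I 'X_[m] -> i \notin Delta -> (m i < A)%N.
Proof.
have [_ _ _ nil] := cellI.
have ex i : exists A : nat, i \notin Delta -> I ('X_i ^+ A).
  have [iD|iD] := boolP (i \in Delta); first by exists 0%N.
  by have [A IA] := nil i iD; exists A.
have [A AP] := choice ex; exists (\sum_i A i)%N => m i nIm iD.
rewrite ltnNge; apply/negP => le; apply: nIm.
have le' : (U_(i) *+ A i <= m)%MM.
  apply/mnm_lepP => j; rewrite mulmnE mnm1E; case: eqVneq => [<-|//].
  by rewrite mul1n; apply: leq_trans le; rewrite (bigD1 i) //= leq_addr.
by rewrite -(submK le') mpolyXD -(mpolyXn _ U_(i)); apply: ideal_mull => //; apply: AP.
Qed.

Lemma components_finite :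
  finite_set [set Q | exists2 m, M_index Delta I m & exists l, Q = comp m l].
Proof.
have [A AP] := exponent_bound.
(* The bound is [A.+1] so that the value [0], taken at the variables of Delta, fits even when [A] is
   zero. *)
pose code m : {ffun 'I_n -> 'I_A.+1} := [ffun i => inord (nilpart m i)].
have codeP m m' : M_index Delta I m -> M_index Delta I m' -> code m = code m' ->
    nilpart m = nilpart m'.
  move=> Mm Mm' /ffunP cE; apply/mnmP => i; have := cE i; rewrite !ffunE => /(congr1 val).
  have bound m1 : M_index Delta I m1 -> (nilpart m1 i < A.+1)%N.
    move=> /(M_index_nmem nI1) nI; rewrite mnmE inE; case: ifPn => // iD.
    by rewrite ltnW // ltnS AP.
  by rewrite /= !inordK // bound.
(* A code that no index attains gets the default [0], which only enlarges the finite list [s]. *)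
have ex (c : {ffun 'I_n -> 'I_A.+1}) : exists m1 : 'X_{1..n},
    forall m, M_index Delta I m -> code m = c -> M_index Delta I m1 /\ code m1 = c.
  have [[m [Mm cm]]|nex] := pselect (exists m, M_index Delta I m /\ code m = c).
    by exists m.
  by exists 0%MM => m Mm cm; case: nex; exists m.
have [rep repP] := choice ex.
pose s := flatten [seq [seq comp (rep c) l | l <- enum 'I_(g (rep c))]
                     | c <- enum {: {ffun 'I_n -> 'I_A.+1}}].
apply: (@sub_finite_set _ _ [set` s]); last exact: finite_seq.
move=> _ [m Mm [l ->]]; have [Mr cr] := repP _ m Mm erefl.
have [l' ->] := component_nilpart l Mm Mr (codeP _ _ Mm Mr (esym cr)).
apply/flattenP; exists [seq comp (rep (code m)) l0 | l0 <- enum 'I_(g (rep (code m)))].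
  by apply/mapP; exists (code m); rewrite ?mem_enum.
by apply/mapP; exists l'; rewrite ?mem_enum.
Qed.

End Finiteness.

Theorem theorem2p11 (k : fieldType) (n : nat) (Delta : {set 'I_n})
    (I : set {mpoly k[n]})
    (I_cellular : cellular Delta I) (I_binomial : binomial_ideal I)
    (rho : 'X_{1..n} -> partial_char k Delta)
    (rhoP : forall m, M_index Delta I m ->
       ideal_colon I 'X_[m] `&` polyN Delta = lattice_ideal (rho m)) :
  [/\ I = \bigcap_(m in M_index Delta I) Hull (sat_sum I (rho m)),
      I = \bigcap_(m in M_index Delta I)
            ideal_add (sat_sum I (rho m)) (M_emb Delta (sat_sum I (rho m))) &
      GRing.closed_field_axiom k ->
      forall (p : nat) (g : 'X_{1..n} -> nat)
        (rhol : forall m, 'I_(g m) -> partial_char k Delta),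
      has_char k p ->
      (forall m, M_index Delta I m -> attached_chars p (rho m) (rhol m)) ->
      let comp m l := ideal_add (sat_sum I (rhol m l))
                                (M_emb Delta (sat_sum I (rho m))) in
      I = \bigcap_(m in M_index Delta I)
            \bigcap_(l in [set: 'I_(g m)]) comp m l /\
      primary_decomposition I
        [set Q | exists2 m, M_index Delta I m & exists l, Q = comp m l]].
Proof.
have [idI nI1 _ _] := I_cellular.
have satI := cellular_saturated I_cellular.
have grI := binomial_ideal_graded I_binomial.
have detect f : ~ I f -> exists m m0, [/\ M_index Delta I m0, detects I (rho m0) m &
    ~ I (mproj [set z | mcong I z m] f)].
  move=> nIf; have [m [_ nIm nIp]] := class_detect idI idI (@subset_refl _ I) nIf.
  by have [m0 Mm0 dm] := detects_exists idI satI grI rhoP nIm; exists m, m0.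
split; last 1 first.
- move=> _ p g rhol charp rholP comp.
  have capE : I = \bigcap_(m in M_index Delta I) \bigcap_(l in [set: 'I_(g m)]) comp m l.
    apply/seteqP; split=> [f If m _ l _|f capf].
      by apply: sub_ideal_addl; [exact: is_ideal_M_emb|exact: sub_sat_sum].
    apply: contrapT => /detect[m [m0 [Mm0 dm]]]; apply.
    have [S [SatS indexS lS inj _]] := rholP _ Mm0.
    have [latS _ _] := is_Sat'_lattice (pc_lattice _) (@pc_ZDelta _ _ _ _) SatS.
    have [d Nd fd] := sat_sum_split (fun l => (lS l).1) (fun l => (lS l).2) inj
      (lattice0 latS) indexS idI (is_ideal_M_emb Delta _) (fun l => capf _ Mm0 l Logic.I).
    (* The splitting puts [f * 'X_[d]], not [f], into the component of [rho m0]. It is tested on the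
       class of [d + m], where its projection is that of [f] on the class of [m] times ['X_[d]]. *)
    have := detects_component idI satI grI (detects_shift idI satI Nd dm) fd.
    rewrite mproj_mulX => /(satI _ _ Nd).
    rewrite (@eq_mproj _ _ _ [set z | mcong I z m]) // => z _ /=; split.
      exact: (saturated_mcong satI Nd).
    exact: mcong_add.
  split=> //; split.
  + exact: components_finite rholP.
  + move=> _ [m Mm [l ->]]; have [S [SatS _ lS _ _]] := rholP _ Mm.
    have [lSl extl] := lS l.
    exact: (component_primary charp I_cellular grI rhoP Mm SatS lSl extl).
  rewrite {1}capE; apply/seteqP; split=> [f capf _ [m Mm [l ->]]|f capf m Mm l _].
    exact: capf.
  by apply: capf; exists m => //; exists l.
- apply/seteqP; split=> [f If m Mm|f capf].
    by apply: sub_Hull; apply: sub_sat_sum.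
  apply: contrapT => /detect[m [m0 [Mm0 dm]]]; apply.
  exact: (Hull_detected I_cellular grI dm (capf _ Mm0)).
- exact: component_decomposition.
Qed.
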